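(* Let $F$ be a formally real field and let $K$ be a totally positive field extension of $F$. Let $(A,\sigma)$ be a central simple algebra with an orthogonal involution over $F$. If $(A,\sigma)$ is weakly hyperbolic over $K$, i.e. $(A\otimes_F K,\sigma\otimes \mathrm{id}_K)$ is weakly hyperbolic, then $(A,\sigma)$ is weakly hyperbolic over $F$.
   Context: A field $F$ is formally real if $-1$ is not a sum of squares in $F$. A semiordering of a field $F$ is a subset $S\subset F$ with $1\in S$, $F^2S\subset S$, $S+S\subset S$, $S\cup -S=F$ and $S\cap -S=\{0\}$. A field extension $K/F$ is totally positive if every semiordering $S$ of $F$ extends to a semiordering $S'$ of $K$ (i.e. $S'\cap F=S$). A central simple algebra with orthogonal involution $(A,\sigma)$ over a field $F$ is hyperbolic if there is $e\in A$ with $e^2=e$ and $\sigma(e)=1-e$. It is weakly hyperbolic if there is $n\in\mathbb{N}$, $n\ge 1$, such that $(M_n(F),t)\otimes_F(A,\sigma)$ is hyperbolic, where $t$ is the transpose involution. *)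

(* Defs.v *)
From HB Require Import structures.
From mathcomp Require Import all_boot all_order all_algebra falgebra.
From mathcomp Require Import boolp classical_sets.

Set Implicit Arguments.
Unset Strict Implicit.
Unset Printing Implicit Defensive.

Import GRing.Theory.

Local Open Scope ring_scope.

Definition formally_real (F : fieldType) : Prop :=
  ~ exists s : seq F, -1 = \sum_(x <- s) x ^+ 2.

Record semiordering (F : fieldType) (S : set F) : Prop := Semiordering {
  semiordering1 : S 1;
  semiordering_sqrM : forall x y, S y -> S (x ^+ 2 * y);
  semiorderingD : forall x y, S x -> S y -> S (x + y);
  semiordering_total : (S `|` [set - x | x in S] = setT)%classic;
  semiordering_anti : (S `&` [set - x | x in S] = [set 0])%classic
}.

(* A field extension K/F, of arbitrary degree, is a field K together with a
   ring morphism iota : F -> K; S' `&` F is the preimage of S' under iota. *)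
Definition totally_positive (F K : fieldType) (iota : {rmorphism F -> K}) :
  Prop :=
  forall S : set F, semiordering S ->
    exists S' : set K, semiordering S' /\ (iota @^-1` S' = S)%classic.

(* The tensor product over F of a finite-dimensional F-algebra A and a
   K-algebra B (an F-algebra through iota : F -> K), as a K-algebra.  With
   (e_i) the basis vbasis {:A} of A, the element \sum_i e_i (x) x_i is encoded
   by the family of its coordinates x_i in B.  Taking B := K gives the scalar
   extension of A to K; taking K := F gives the usual tensor product. *)
Definition tensor (F K : fieldType) (iota : {rmorphism F -> K})
  (A : falgType F) (B : algType K) : Type := {ffun 'I_(\dim {:A}) -> B}.

Section Tensor.
Variables (F K : fieldType) (iota : {rmorphism F -> K}).
Variables (A : falgType F) (B : algType K).

Local Notation n := (\dim {:A}).
Local Notation e i := ((vbasis {:A})`_i).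
Local Notation T := (tensor iota A B).

HB.instance Definition _ := GRing.Lmodule.copy T {ffun 'I_n -> B}.

Definition tens (a : A) (b : B) : T :=
  [ffun i => iota (coord (vbasis {:A}) i a) *: b].

Lemma tensDl a a' b : tens (a + a') b = tens a b + tens a' b.
Proof. by apply/ffunP=> i; rewrite !ffunE linearD rmorphD scalerDl. Qed.

Lemma tensDr a b b' : tens a (b + b') = tens a b + tens a b'.
Proof. by apply/ffunP=> i; rewrite !ffunE scalerDr. Qed.

Lemma tensZl c a b : tens (c *: a) b = tens a (iota c *: b).
Proof.
by apply/ffunP=> i; rewrite !ffunE linearZ /= rmorphM scalerA mulrC.
Qed.

Lemma tensZr c a b : tens a (c *: b) = c *: tens a b.
Proof. by apply/ffunP=> i; rewrite !ffunE !scalerA mulrC. Qed.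

Lemma tens0l b : tens 0 b = 0.
Proof. by rewrite -(scale0r 0) tensZl rmorph0 tensZr scale0r. Qed.

Lemma tens0r a : tens a 0 = 0.
Proof. by rewrite -(scale0r 0) tensZr scale0r. Qed.

Lemma tens_suml I (r : seq I) (P : pred I) (f : I -> A) b :
  tens (\sum_(i <- r | P i) f i) b = \sum_(i <- r | P i) tens (f i) b.
Proof. by apply: (big_morph (tens^~ b)) => [x y|]; rewrite ?tensDl ?tens0l. Qed.

Lemma tens_sumr I (r : seq I) (P : pred I) a (f : I -> B) :
  tens a (\sum_(i <- r | P i) f i) = \sum_(i <- r | P i) tens a (f i).
Proof. by apply: (big_morph (tens a)) => [x y|]; rewrite ?tensDr ?tens0r. Qed.

Lemma tens_coord (x : T) : x = \sum_(i < n) tens (e i) (x i).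
Proof.
apply/ffunP=> j; rewrite sum_ffunE (bigD1 j) //= big1 => [|i ij].
  rewrite addr0 ffunE coord_free ?(basis_free (vbasisP _)) //.
  by rewrite eqxx rmorph1 scale1r.
rewrite ffunE coord_free ?(basis_free (vbasisP _)) //.
by rewrite (negPf ij) rmorph0 scale0r.
Qed.

Section Balanced.
Variables (V : zmodType) (f : A -> B -> V).
Hypothesis fDl : forall a a' b, f (a + a') b = f a b + f a' b.
Hypothesis fDr : forall a b b', f a (b + b') = f a b + f a b'.
Hypothesis fZ : forall c a b, f (c *: a) b = f a (iota c *: b).

Definition tens_lift (x : T) : V := \sum_(i < n) f (e i) (x i).

Lemma tens_liftD x y : tens_lift (x + y) = tens_lift x + tens_lift y.
Proof.
by rewrite /tens_lift -big_split; apply: eq_bigr => i _; rewrite ffunE fDr.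
Qed.

Lemma tens_liftE a b : tens_lift (tens a b) = f a b.
Proof.
have f0 : f 0 b = 0 by apply: (addrI (f 0 b)); rewrite -fDl !addr0.
rewrite [in RHS](coord_vbasis (memvf a)).
rewrite (big_morph (f^~ b) (fun x y => fDl x y b) f0).
by apply: eq_bigr => i _; rewrite ffunE fZ.
Qed.

End Balanced.

Lemma tens_ext (V : zmodType) (g h : T -> V) :
    {morph g : x y / x + y} -> {morph h : x y / x + y} ->
  (forall a b, g (tens a b) = h (tens a b)) -> g =1 h.
Proof.
move=> gD hD gh x.
have g0 : g 0 = 0 by apply: (addrI (g 0)); rewrite -gD !addr0.
have h0 : h 0 = 0 by apply: (addrI (h 0)); rewrite -hD !addr0.
rewrite [x]tens_coord (big_morph g gD g0) (big_morph h hD h0).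
by apply: eq_bigr => i _.
Qed.

Theorem tens_universal (V : zmodType) (f : A -> B -> V) :
    (forall a a' b, f (a + a') b = f a b + f a' b) ->
    (forall a b b', f a (b + b') = f a b + f a b') ->
    (forall c a b, f (c *: a) b = f a (iota c *: b)) ->
  exists! h : T -> V,
    {morph h : x y / x + y} /\ forall a b, h (tens a b) = f a b.
Proof.
move=> fDl fDr fZ; exists (tens_lift f); split.
  split; [exact: (tens_liftD fDr) | exact: (tens_liftE fDl fZ)].
move=> h [hD hE]; apply: funext; apply: tens_ext => //.
  exact: (tens_liftD fDr).
by move=> a b; rewrite hE (tens_liftE fDl fZ).
Qed.

Definition tensor_one : T := tens 1 1.

Definition tensor_mul (x y : T) : T :=
  \sum_(i < n) \sum_(j < n) tens (e i * e j) (x i * y j).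

Fact tensor_mulDl : left_distributive tensor_mul +%R.
Proof.
move=> x y z; rewrite /tensor_mul -big_split; apply: eq_bigr => i _.
rewrite -big_split; apply: eq_bigr => j _ /=.
by rewrite ffunE mulrDl tensDr.
Qed.

Fact tensor_mulDr : right_distributive tensor_mul +%R.
Proof.
move=> x y z; rewrite /tensor_mul -big_split; apply: eq_bigr => i _.
rewrite -big_split; apply: eq_bigr => j _ /=.
by rewrite ffunE mulrDr tensDr.
Qed.

Fact tensor_mulE a b a' b' :
  tensor_mul (tens a b) (tens a' b') = tens (a * a') (b * b').
Proof.
rewrite [in RHS](coord_vbasis (memvf a)) [in RHS](coord_vbasis (memvf a')).
rewrite mulr_suml tens_suml; apply: eq_bigr => i _.
rewrite mulr_sumr tens_suml; apply: eq_bigr => j _.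
rewrite !ffunE -!scalerAl -!scalerAr !tensZl.
by rewrite !scalerA [in RHS]mulrC.
Qed.

Fact tensor_mul1l : left_id tensor_one tensor_mul.
Proof.
apply: (@tens_ext T (tensor_mul tensor_one) idfun) => [x y||a b] //.
  by rewrite tensor_mulDr.
by rewrite /= tensor_mulE !mul1r.
Qed.

Fact tensor_mul1r : right_id tensor_one tensor_mul.
Proof.
apply: (@tens_ext T (tensor_mul^~ tensor_one) idfun) => [x y||a b] //.
  by rewrite tensor_mulDl.
by rewrite /= tensor_mulE !mulr1.
Qed.

Fact tensor_mulA : associative tensor_mul.
Proof.
move=> x y z.
apply: (@tens_ext T (fun x => tensor_mul x (tensor_mul y z))
          (fun x => tensor_mul (tensor_mul x y) z)) => [u v|u v|a b].
- by rewrite tensor_mulDl.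
- by rewrite !tensor_mulDl.
apply: (@tens_ext T (fun y => tensor_mul (tens a b) (tensor_mul y z))
          (fun y => tensor_mul (tensor_mul (tens a b) y) z)) => [u v|u v|a' b'].
- by rewrite tensor_mulDl tensor_mulDr.
- by rewrite tensor_mulDr tensor_mulDl.
apply: (@tens_ext T
          (fun z => tensor_mul (tens a b) (tensor_mul (tens a' b') z))
          (fun z => tensor_mul (tensor_mul (tens a b) (tens a' b')) z))
  => [u v|u v|a'' b''].
- by rewrite !tensor_mulDr.
- by rewrite tensor_mulDr.
by rewrite !tensor_mulE !mulrA.
Qed.

Fact tensor_oner_neq0 : tensor_one != 0.
Proof.
apply/eqP=> /ffunP h1; have /eqP[] := oner_neq0 A.
rewrite (coord_vbasis (memvf (1 : A))) big1 // => i _.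
have /eqP := h1 i; rewrite !ffunE scaler_eq0 oner_eq0 orbF fmorph_eq0.
by move=> /eqP ->; rewrite scale0r.
Qed.

HB.instance Definition _ := GRing.Zmodule_isNzRing.Build T
  tensor_mulA tensor_mul1l tensor_mul1r tensor_mulDl tensor_mulDr
  tensor_oner_neq0.

Fact tensor_scaleAl (c : K) (x y : T) : c *: (x * y) = (c *: x) * y.
Proof.
rewrite /GRing.mul /= /tensor_mul scaler_sumr; apply: eq_bigr => i _.
rewrite scaler_sumr; apply: eq_bigr => j _.
by rewrite ffunE -scalerAl tensZr.
Qed.

HB.instance Definition _ := GRing.Lmodule_isLalgebra.Build K T tensor_scaleAl.

Fact tensor_scaleAr (c : K) (x y : T) : c *: (x * y) = x * (c *: y).
Proof.
rewrite /GRing.mul /= /tensor_mul scaler_sumr; apply: eq_bigr => i _.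
rewrite scaler_sumr; apply: eq_bigr => j _.
by rewrite ffunE -scalerAr tensZr.
Qed.

HB.instance Definition _ := GRing.Lalgebra_isAlgebra.Build K T tensor_scaleAr.

Lemma tens1 : tens 1 1 = 1 :> T.
Proof. by []. Qed.

Lemma tensM a b a' b' : tens a b * tens a' b' = tens (a * a') (b * b').
Proof. exact: tensor_mulE. Qed.

(* The map f (x) g, for f : A -> A F-linear and g : B -> B K-linear. *)
Definition tensor_map (f : A -> A) (g : B -> B) (x : T) : T :=
  \sum_(i < n) tens (f (e i)) (g (x i)).

Lemma tensor_map_tens f g a b : linear f -> linear g ->
  tensor_map f g (tens a b) = tens (f a) (g b).
Proof.
move=> lf lg.
have fD u v : f (u + v) = f u + f v by rewrite -[u]scale1r lf !scale1r.
have gD u v : g (u + v) = g u + g v by rewrite -[u]scale1r lg !scale1r.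
have f0 : f 0 = 0 by apply: (addrI (f 0)); rewrite -fD !addr0.
have g0 : g 0 = 0 by apply: (addrI (g 0)); rewrite -gD !addr0.
have fZ c u : f (c *: u) = c *: f u by rewrite -[c *: u]addr0 lf f0 addr0.
have gZ c u : g (c *: u) = c *: g u by rewrite -[c *: u]addr0 lg g0 addr0.
apply: (tens_liftE (f := fun a b => tens (f a) (g b))) => [u v w|c u v].
  by rewrite fD tensDl.
by rewrite fZ gZ tensZl.
Qed.

End Tensor.

Arguments tensor_map {F K} iota {A B} f g x.

(* A ranges over falgType F, hence is finite-dimensional and nonzero; two-sided
   ideals of a unital F-algebra are F-subspaces. *)
Definition central_simple (F : fieldType) (A : falgType F) : Prop :=
  ('Z({:A}) = 1)%VS /\
  forall I : {vspace A}, (fullv * I <= I)%VS -> (I * fullv <= I)%VS ->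
    I = 0%VS \/ I = fullv.

Record first_kind_involution (F : fieldType) (A : falgType F)
  (sigma : A -> A) : Prop := FirstKindInvolution {
  involution_linear : linear sigma;
  involution_mul : forall x y, sigma (x * y) = sigma y * sigma x;
  involution_invol : involutive sigma
}.

(* An involution of the first kind is orthogonal if, over a splitting field L
   of A, it becomes the adjoint involution of a nondegenerate symmetric
   bilinear form b (u, v) = u^T *m B *m v on the column space L^m+1:
   b (sigma f u, v) = b (u, f v) for all u and v.  The definition is meant for
   fields of characteristic different from 2 (for characteristic 2 one would
   also ask that b be non-alternating). *)
Definition orthogonal_involution (F : fieldType) (A : falgType F)
  (sigma : A -> A) : Prop :=
  first_kind_involution sigma /\
  exists (L : fieldType) (iota : {rmorphism F -> L}) (m : nat)
      (phi : {lrmorphism tensor iota A L^o -> 'M[L]_m.+1}) (B : 'M[L]_m.+1),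
    [/\ bijective phi, B \in unitmx, B^T = B &
      forall x, (phi (tensor_map iota sigma idfun x))^T *m B = B *m phi x].

Definition hyperbolic (A : nzRingType) (sigma : A -> A) : Prop :=
  exists e : A, e ^+ 2 = e /\ sigma e = 1 - e.

Definition weakly_hyperbolic (F : fieldType) (A : algType F)
  (sigma : A -> A) : Prop :=
  exists n : nat,
    hyperbolic (tensor_map (A := 'M[F]_n.+1) (B := A) idfun trmx sigma).

(* Main.v *)
Require Import Defs.
From HB Require Import structures.
From mathcomp Require Import all_boot all_order all_fingroup all_algebra all_field.
From mathcomp Require Import generic_quotient.
From mathcomp Require Import boolp classical_sets.
From mathcomp Require Import zify ring.
Set Implicit Arguments.
Unset Strict Implicit.
Unset Printing Implicit Defensive.

Import Order.TTheory GRing.Theory Num.Theory.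

Local Open Scope ring_scope.

(** By contraposition.  Diagonal hermitian forms over (A, sigma), modulo torsion,
    generate a torsion-free group, in which the class of <1> vanishes only if
    (A, sigma) is weakly hyperbolic.  If it does not vanish, Zorn's lemma gives an
    ordering P of F such that <1> survives multiplication by every Pfister form
    over F with slots in P.  Since P extends to a semiordering of K, weak
    hyperbolicity over K makes the trace form tr(sigma(x)y) of A have signature 0
    at P.  Take a symmetric s in A with separable minimal polynomial and centralizer
    F[s]; P extends to an ordering Q of M = F(al), with al a root of that
    polynomial.  The idempotent of M[s] at al
    has rank one and splits A over M, turning sigma into the adjoint involution of
    a diagonal form phi.  The trace form of A over M is a multiple of phi (x) phi,
    so phi has as many positive as negative entries at Q, and an explicit Pfister
    form with positive slots over M becomes isometric to its negative over A.
    Its transfer to F is then torsion over A, although its signature at P is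
    positive: Q contributes a positive term and, in total, the other roots of the
    minimal polynomial contribute a nonnegative one.  This contradicts the choice
    of P. *)

(** A semiordering is closed under sums and under multiplication by squares only, so over K nothing
    but counting is available: weak hyperbolicity embeds [n.+1] copies of the extended trace form
    isometrically into as many copies of its negative, and an inertia bound valid for semiorderings
    balances the signs of its entries, which come from F. Products of signs are used only over F and
    M. Dividing by torsion makes the Zorn argument work: without 2-torsion a repeated slot is
    harmless, and each axiom of an ordering becomes an identity between Pfister forms. The price is
    paid on returning to A, where a stable isometry between multiples of <1> and <-1> must be
    cancelled; this is done on two copies, twisted by a rational rotation chosen so that the map to
    be inverted has no kernel. The final contradiction rests on one more remark. If <d_1, ..., d_r>
    over F has positive signature at P and all its multiples vanish over A modulo torsion, then so
    do all multiples of the Pfister form with slots |d_i|: these slots absorb the d_i up to sign and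
    leave the signature as a positive multiplicity. Its slots lie in P. *)

Section Semilinear.
Variables (R : pzRingType) (U : lmodType R) (V : zmodType).
Variables (s : R -> V -> V) (f : U -> V).
Hypothesis s1 : forall v, s 1 v = v.
Hypothesis fL : forall a x y, f (a *: x + y) = s a (f x) + f y.

(** The action [s] is either scaling in a module or multiplication in a field, so the same lemmas
    serve involutions, traces and bilinear forms in one argument. *)
Lemma semilinD : {morph f : x y / x + y}.
Proof. by move=> x y; rewrite -[x]scale1r fL s1 scale1r. Qed.

Lemma semilin0 : f 0 = 0.
Proof. by apply: (addrI (f 0)); rewrite -semilinD !addr0. Qed.

Lemma semilinZ a x : f (a *: x) = s a (f x).
Proof. by rewrite -[a *: x]addr0 fL semilin0 addr0. Qed.

Lemma semilin_sum (I : Type) (r : seq I) (P : pred I) (x : I -> U) :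
  f (\sum_(i <- r | P i) x i) = \sum_(i <- r | P i) f (x i).
Proof. exact: (big_morph f semilinD semilin0). Qed.

End Semilinear.
Arguments semilinD {R U V s} f s1 fL.
Arguments semilin0 {R U V s} f s1 fL.
Arguments semilinZ {R U V s} f s1 fL.
Arguments semilin_sum {R U V s} f s1 fL [I r P].

(** * Diagonal hermitian forms over a ring with involution and their isometric embeddings *)

Section Embeddings.
Variables (B : nzRingType) (sigma : B -> B).
Hypothesis sigmaD : {morph sigma : x y / x + y}.
Hypothesis sigmaM : forall x y, sigma (x * y) = sigma y * sigma x.
Hypothesis sigma1 : sigma 1 = 1.

Definition herm (I : finType) (c : I -> B) (x y : I -> B) : B :=
  \sum_i sigma (x i) * c i * y i.

(* Isometric embeddings of diagonal forms; surjectivity is not required. *)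
Definition emb (I J : finType) (c : I -> B) (d : J -> B) : Prop :=
  exists f : (I -> B) -> J -> B,
    [/\ forall x y, f (fun i => x i + y i) = (fun j => f x j + f y j),
        forall x a, f (fun i => x i * a) = (fun j => f x j * a) &
        forall x y, herm d (f x) (f y) = herm c x y].

Lemma sigma_add0 : sigma 0 = 0.
Proof. by apply: (addrI (sigma 0)); rewrite -sigmaD !addr0. Qed.

Lemma sigma_sum (I : Type) (r : seq I) (P : pred I) (F : I -> B) :
  sigma (\sum_(i <- r | P i) F i) = \sum_(i <- r | P i) sigma (F i).
Proof. exact: (big_morph sigma sigmaD sigma_add0). Qed.

Lemma emb_trans (I J L : finType) (c : I -> B) (d : J -> B) (e : L -> B) :
  emb c d -> emb d e -> emb c e.
Proof.
move=> [f [fD fZ fh]] [g [gD gZ gh]]; exists (g \o f); split=> /= [x y|x a|x y].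
- by rewrite fD gD.
- by rewrite fZ gZ.
- by rewrite gh fh.
Qed.

Lemma emb_reindex (I J : finType) (c : I -> B) (d : J -> B) (h : I -> J) :
  bijective h -> (forall i, d (h i) = c i) -> emb c d.
Proof.
move=> [h' hK h'K] dh; exists (fun x j => x (h' j)); split=> // x y.
rewrite /herm (reindex h) /=; last by exists h' => j _.
by apply: eq_bigr => i _; rewrite hK dh.
Qed.

(** [u] is the matrix of the embedding and the hypothesis is the congruence relation between Gram
    matrices; left multiplication by a matrix commutes with the right action of [B]. *)
Lemma emb_matrix (I J : finType) (c : I -> B) (d : J -> B) (u : J -> I -> B) :
  (forall i i', \sum_j sigma (u j i) * d j * u j i' = (c i) *+ (i == i')) ->
  emb c d.
Proof.
move=> uE; exists (fun x j => \sum_i u j i * x i); split=> [x y|x a|x y].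
- apply: funext => j; rewrite -big_split; apply: eq_bigr => i _ /=.
  by rewrite mulrDr.
- apply: funext => j; rewrite mulr_suml; apply: eq_bigr => i _.
  by rewrite mulrA.
transitivity (\sum_i \sum_i' sigma (x i) *
    (\sum_j sigma (u j i) * d j * u j i') * y i').
  rewrite /herm; under eq_bigr => j _.
    rewrite sigma_sum !mulr_suml; under eq_bigr => i _.
      rewrite mulr_sumr; under eq_bigr => i' _ do rewrite sigmaM.
    over.
  over.
  rewrite exchange_big; apply: eq_bigr => i _; rewrite exchange_big /=.
  apply: eq_bigr => i' _; rewrite mulr_sumr mulr_suml; apply: eq_bigr => j _.
  by rewrite !mulrA.
apply: eq_bigr => i _; rewrite (bigD1 i) //= uE eqxx mulr1n big1 ?addr0 //.
by move=> i' i'i; rewrite uE eq_sym (negPf i'i) mulr0n mulr0 mul0r.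
Qed.

Lemma emb_scale (a : B) (I J : finType) (c : I -> B) (d : J -> B) :
  (forall x, a * x = x * a) -> emb c d ->
  emb (fun i => a * c i) (fun j => a * d j).
Proof.
move=> ac [f [fD fZ fh]]; exists f; split=> // x y.
have hE (L : finType) (e : L -> B) u v :
    herm (fun i => a * e i) u v = a * herm e u v.
  by rewrite /herm mulr_sumr; apply: eq_bigr => i _; rewrite !mulrA ac.
by rewrite !hE fh.
Qed.

Definition embl (c d : seq B) : Prop :=
  emb (fun i : 'I_(size c) => c`_i) (fun j : 'I_(size d) => d`_j).

Lemma embl_trans d c e : embl c d -> embl d e -> embl c e.
Proof. exact: emb_trans. Qed.

Lemma embl_codom (I J : finType) (c : I -> B) (d : J -> B) :
  emb c d -> embl (codom c) (codom d).
Proof.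
have eI (L : finType) (e : L -> B) : size (codom e) = #|L|.
  by rewrite size_codom.
have nthE (L : finType) (e : L -> B) (i : 'I_#|L|) : (codom e)`_i = e (enum_val i).
  by rewrite codomE (nth_map (enum_val i)) -?cardE // -enum_val_nth.
move=> cd; apply: (@emb_trans _ I _ _ c).
  apply: (@emb_reindex _ _ _ _ (fun i => enum_val (cast_ord (eI I c) i))).
    by apply: bij_comp; [exact: enum_val_bij|exists (cast_ord (esym (eI I c)));
       [exact: cast_ordK|exact: cast_ordKV]].
  by move=> i; rewrite -nthE.
apply: (emb_trans cd).
apply: (@emb_reindex _ _ _ _ (fun i => cast_ord (esym (eI J d)) (enum_rank i))).
  apply: bij_comp; last exact: enum_rank_bij.
  by exists (cast_ord (eI J d)); [exact: cast_ordKV|exact: cast_ordK].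
by move=> i; rewrite /= nthE enum_rankK.
Qed.

Lemma embl_cat c d c' d' :
  embl c d -> embl c' d' -> embl (c ++ c') (d ++ d').
Proof.
move=> [f [fD fZ fh]] [g [gD gZ gh]].
pose l (s t : seq B) (i : 'I_(size s)) : 'I_(size (s ++ t)) :=
  cast_ord (esym (size_cat s t)) (lshift _ i).
pose r (s t : seq B) (i : 'I_(size t)) : 'I_(size (s ++ t)) :=
  cast_ord (esym (size_cat s t)) (rshift _ i).
have splitE (s t : seq B) (x y : 'I_(size (s ++ t)) -> B) :
  herm (fun i : 'I_(size (s ++ t)) => (s ++ t)`_i) x y =
  herm (fun i : 'I_(size s) => s`_i) (x \o @l s t) (y \o @l s t) +
  herm (fun i : 'I_(size t) => t`_i) (x \o @r s t) (y \o @r s t).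
  rewrite /herm.
  have cast_bij : bijective (cast_ord (esym (size_cat s t))).
    by exists (cast_ord (size_cat s t)); [exact: cast_ordKV|exact: cast_ordK].
  rewrite (reindex _ (onW_bij _ cast_bij)) big_split_ord /=.
  congr (_ + _); apply: eq_bigr => i _; rewrite nth_cat /=.
    by rewrite ltn_ord.
  by rewrite ltnNge leq_addr /= addKn.
pose h x (j : 'I_(size (d ++ d'))) :=
  match split (cast_ord (size_cat d d') j) with
  | inl i => f (x \o @l c c') i | inr i => g (x \o @r c c') i end.
exists h; split=> [x y|x a|x y].
- apply: funext => j; rewrite /h; case: (split _) => i.
    by rewrite -[LHS]/(f (fun i => _) i) fD.
  by rewrite -[LHS]/(g (fun i => _) i) gD.
- apply: funext => j; rewrite /h; case: (split _) => i.
    by rewrite -[LHS]/(f (fun i => _) i) fZ.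
  by rewrite -[LHS]/(g (fun i => _) i) gZ.
have hl z : h z \o @l d d' = f (z \o @l c c').
  apply: funext => i; rewrite /h /= /l cast_ordKV.
  by rewrite -[lshift _ i]/(unsplit (inl i)) unsplitK.
have hr z : h z \o @r d d' = g (z \o @r c c').
  apply: funext => i; rewrite /h /= /r cast_ordKV.
  by rewrite -[rshift _ i]/(unsplit (inr i)) unsplitK.
by rewrite !splitE !hl !hr fh gh.
Qed.

Lemma embl_perm c d : perm_eq c d -> embl c d.
Proof.
move=> cd; have sz := esym (perm_size cd).
have /tuple_permP[p pE] : perm_eq c (tcast sz (in_tuple d)) by rewrite val_tcast.
have pb : bijective (fun i => cast_ord (esym sz) (p i)).
  apply: bij_comp; last by exists (p^-1)%g; [exact: permK|exact: permKV].
  by exists (cast_ord sz); [exact: cast_ordKV|exact: cast_ordK].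
apply: (emb_reindex pb) => i; rewrite /=.
transitivity (tnth (in_tuple c) i); last by rewrite (tnth_nth 0).
have -> : in_tuple c = [tuple tnth (tcast sz (in_tuple d)) (p i) | i < size c].
  exact/val_inj.
by rewrite tnth_mktuple tcastE (tnth_nth 0).
Qed.

Lemma embl_refl c : embl c c.
Proof. by apply: (emb_reindex (h := id)); first by exists id. Qed.

Definition mulc k (c : seq B) := flatten (nseq k c).

Lemma count_mulc p k c : count p (mulc k c) = (k * count p c)%N.
Proof. by rewrite /mulc count_flatten map_nseq sumn_nseq mulnC. Qed.

Lemma map_mulc (f : B -> B) k c : map f (mulc k c) = mulc k (map f c).
Proof. by rewrite /mulc map_flatten map_nseq. Qed.

Lemma embl_mulc k c d : embl c d -> embl (mulc k c) (mulc k d).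
Proof.
move=> cd; elim: k => [|k IHk]; [exact: embl_refl|exact: embl_cat].
Qed.

Lemma nth_map0 (f : B -> B) s i : f 0 = 0 -> (map f s)`_i = f s`_i.
Proof.
move=> f0; have [lt_is|le_si] := ltnP i (size s); first by rewrite (nth_map 0).
by rewrite !nth_default ?size_map.
Qed.

Lemma embl_scale a c d : (forall x, a * x = x * a) -> embl c d ->
  embl (map ( *%R a) c) (map ( *%R a) d).
Proof.
move=> ac cd.
suff : emb (fun i : 'I_(size c) => a * c`_i) (fun i : 'I_(size d) => a * d`_i).
  rewrite /embl !size_map; congr emb; apply: funext => i;
  by rewrite nth_map0 ?mulr0.
exact: emb_scale.
Qed.

Lemma embl_opp c d : embl c d -> embl (map -%R c) (map -%R d).
Proof.
have oppE : -%R =1 ( *%R (-1)) :> (B -> B) by move=> x; rewrite mulN1r.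
by rewrite !(eq_map oppE); apply: embl_scale => x; rewrite mulN1r mulrN1.
Qed.

End Embeddings.

(** * The Witt group of diagonal forms modulo torsion *)

Section Neutral.
Variables (B : nzRingType) (sigma : B -> B).
Hypothesis sigmaD : {morph sigma : x y / x + y}.
Hypothesis sigmaM : forall x y, sigma (x * y) = sigma y * sigma x.

Local Notation embl := (embl sigma).
Local Notation opps := (map (@GRing.opp B)).

(* The form <c> is torsion: by dimension, the embedding is an isometry between
   k <c> + <z> and k <-c> + <z>. *)
Definition neutral (c : seq B) : Prop :=
  exists k z, embl (mulc k.+1 c ++ z) (mulc k.+1 (opps c) ++ z).

Ltac perm_count :=
  apply/seq.permP => p; rewrite !(count_cat, count_mulc, count_map); ring.

Lemma embl_catr c d z : embl c d -> embl (c ++ z) (d ++ z).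
Proof. by move=> cd; apply: embl_cat cd (embl_refl _ _). Qed.

Lemma embl_eqperm c' d' c d : perm_eq c c' -> perm_eq d' d -> embl c' d' ->
  embl c d.
Proof.
move=> cc' d'd c'd'; apply: (embl_trans (embl_perm _ cc')).
exact: (embl_trans c'd' (embl_perm _ d'd)).
Qed.

Lemma neutral_emb k z c : embl (mulc k.+1 c ++ z) (mulc k.+1 (opps c) ++ z) ->
  forall k', exists z', embl (mulc (k.+1 * k') c ++ z')
                             (mulc (k.+1 * k') (opps c) ++ z').
Proof.
move=> cz k'; exists (mulc k' z); apply: embl_eqperm (embl_mulc k' cz).
  by perm_count.
by perm_count.
Qed.

Lemma neutral_emb2 c d : neutral c -> neutral d -> exists k z z',
  embl (mulc k.+1 c ++ z) (mulc k.+1 (opps c) ++ z) /\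
  embl (mulc k.+1 d ++ z') (mulc k.+1 (opps d) ++ z').
Proof.
move=> [k1 [z1 cz]] [k2 [z2 dz]].
have [z cz'] := neutral_emb cz k2.+1; have [z' dz'] := neutral_emb dz k1.+1.
exists (k1.+1 * k2.+1).-1, z, z'; rewrite prednK ?muln_gt0 //; split=> //.
by rewrite mulnC.
Qed.

Lemma neutral_perm c d : perm_eq c d -> neutral c -> neutral d.
Proof.
move=> /seq.permP cd [k [z cz]]; exists k, z; apply: embl_eqperm cz.
  by apply/seq.permP=> p; rewrite !(count_cat, count_mulc) cd.
by apply/seq.permP=> p; rewrite !(count_cat, count_mulc, count_map) cd.
Qed.

Lemma neutral_cat c d : neutral c -> neutral d -> neutral (c ++ d).
Proof.
move=> nc nd; have [k [z [z' [cz dz]]]] := neutral_emb2 nc nd.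
exists k, (z ++ z'); apply: embl_eqperm (embl_cat cz dz).
  by perm_count.
by rewrite map_cat; perm_count.
Qed.

Lemma oppsK : involutive opps.
Proof. exact/mapK/opprK. Qed.

Lemma neutral_opp c : neutral c -> neutral (opps c).
Proof.
move=> [k [z cz]]; exists k, (opps z).
by have := embl_opp cz; rewrite !map_cat !map_mulc.
Qed.

(** The copies of [d] are kept in the tail: the relation for [c ++ d] turns them into copies of
    [opps d], and the negated relation for [d] turns these back. *)
Lemma neutral_cancel c d : neutral (c ++ d) -> neutral d -> neutral c.
Proof.
move=> ncd nd; have [k [z [z' [cdz dz]]]] := neutral_emb2 ncd nd.
exists k, (mulc k.+1 d ++ (z ++ opps z')).
apply: (embl_trans (embl_perm _ _)); last first.
- apply: (embl_trans (embl_catr (opps z') cdz)).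
  apply: (embl_trans (embl_perm _ _)); last first.
    have := embl_opp dz; rewrite !map_cat !map_mulc oppsK => dz'.
    apply: (embl_trans (embl_catr (mulc k.+1 (opps c) ++ z) dz')).
    apply: embl_perm.
    by perm_count.
  rewrite map_cat; apply/seq.permP => p; rewrite !(count_cat, count_mulc, count_map). ring.
by perm_count.
Qed.

Lemma neutral_opp_cat c : neutral (c ++ opps c).
Proof.
by exists 0%N, [::]; apply: embl_perm; rewrite map_cat oppsK; perm_count.
Qed.

Lemma neutralI m z c : (0 < m)%N ->
  embl (mulc m c ++ z) (mulc m (opps c) ++ z) -> neutral c.
Proof. by case: m => // m _ cz; exists m, z. Qed.

Lemma mulcA m k (c : seq B) : mulc m (mulc k c) = mulc (m * k) c.
Proof.
elim: m => [|m IHm]; first by [].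
rewrite mulSn /mulc nseqD flatten_cat -[flatten (nseq (m * k) c)]/(mulc _ _).
by rewrite -IHm.
Qed.

Lemma neutral_mulc k c : neutral (mulc k.+1 c) -> neutral c.
Proof.
move=> [k' [z kcz]]; apply: (@neutralI (k'.+1 * k.+1) z); first by [].
by rewrite -!mulcA -map_mulc.
Qed.

(** Side by side, the embedding of [c] in [d] and the negated embedding of [d] in [c] carry
    [c ++ opps d] to its own negative. *)
Lemma neutral_embl c d : embl c d -> embl d c -> neutral (c ++ opps d).
Proof.
move=> cd dc; exists 0%N, [::]; rewrite /mulc /= !cats0 map_cat oppsK.
apply: embl_eqperm (embl_cat cd (embl_opp dc)); first exact: perm_refl.
by rewrite perm_catC.
Qed.

Lemma neutral_scale a c : (forall x, a * x = x * a) -> neutral c ->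
  neutral (map ( *%R a) c).
Proof.
move=> ac [k [z cz]]; exists k, (map ( *%R a) z).
have := embl_scale ac cz; rewrite !map_cat !map_mulc.
have -> // : map ( *%R a) (opps c) = opps (map ( *%R a) c).
by rewrite -!map_comp; apply: eq_map => x /=; rewrite mulrN.
Qed.

Lemma neutral_trans c d e :
  neutral (c ++ opps d) -> neutral (d ++ opps e) -> neutral (c ++ opps e).
Proof.
move=> cd de; apply: (@neutral_cancel _ (opps d ++ d)).
  apply: neutral_perm (neutral_cat cd de); perm_count.
apply: neutral_perm (neutral_opp_cat d); perm_count.
Qed.

(** Since [c ++ opps c] is neutral, negating entries gives opposites in the quotient; since
    [neutral] admits multiples and a tail, the quotient already has no torsion. *)
Definition witt_eq (c d : seq B) : bool := `[< neutral (c ++ opps d) >].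

Lemma witt_eq_refl : reflexive witt_eq.
Proof. by move=> c; apply/asboolP/neutral_opp_cat. Qed.

Lemma witt_eq_sym : symmetric witt_eq.
Proof.
suff sym c d : witt_eq c d -> witt_eq d c by move=> c d; apply/idP/idP; apply: sym.
move=> /asboolP/neutral_opp; rewrite map_cat oppsK => cd; apply/asboolP.
by apply: neutral_perm cd; perm_count.
Qed.

Lemma witt_eq_trans : transitive witt_eq.
Proof.
move=> d c e /asboolP cd /asboolP de; apply/asboolP.
exact: neutral_trans cd de.
Qed.

Definition witt_equiv : equiv_rel (seq B) :=
  EquivRel witt_eq witt_eq_refl witt_eq_sym witt_eq_trans.

Definition witt : Type := {eq_quot witt_equiv}%qT.
HB.instance Definition _ := Choice.on witt.
HB.instance Definition _ := EqQuotient.on witt.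

Definition wcl (c : seq B) : witt := (\pi_witt c)%qT.

Lemma wcl_eq c d : (wcl c = wcl d) <-> neutral (c ++ opps d).
Proof.
split=> [/eqquotP/asboolP //|cd]; apply/eqquotP; exact/asboolP.
Qed.

Lemma wclP (x : witt) : exists c, x = wcl c.
Proof. by exists (repr x); rewrite /wcl reprK. Qed.

Lemma wcl_repr c : neutral (repr (wcl c) ++ opps c).
Proof. by apply/wcl_eq; rewrite /wcl reprK. Qed.

Definition witt_add (x y : witt) := wcl (repr x ++ repr y).
Definition witt_opp (x : witt) := wcl (opps (repr x)).

Lemma witt_addE c d : witt_add (wcl c) (wcl d) = wcl (c ++ d).
Proof.
apply/wcl_eq; rewrite map_cat.
apply: neutral_perm (neutral_cat (wcl_repr c) (wcl_repr d)); perm_count.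
Qed.

Lemma witt_oppE c : witt_opp (wcl c) = wcl (opps c).
Proof.
by apply/wcl_eq; have := neutral_opp (wcl_repr c); rewrite map_cat.
Qed.

Lemma wcl_perm c d : perm_eq c d -> wcl c = wcl d.
Proof.
move=> cd; apply/wcl_eq; apply: neutral_perm (neutral_opp_cat d).
by rewrite perm_cat2r perm_sym.
Qed.

Lemma witt_addA : associative witt_add.
Proof.
move=> x y z; have [c ->] := wclP x; have [d ->] := wclP y.
by have [e ->] := wclP z; rewrite !witt_addE catA.
Qed.

Lemma witt_addC : commutative witt_add.
Proof.
move=> x y; have [c ->] := wclP x; have [d ->] := wclP y.
by rewrite !witt_addE; apply: wcl_perm; rewrite perm_catC.
Qed.

Lemma witt_add0 : left_id (wcl [::]) witt_add.
Proof. by move=> x; have [c ->] := wclP x; rewrite !witt_addE. Qed.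

Lemma witt_addN : left_inverse (wcl [::]) witt_opp witt_add.
Proof.
move=> x; have [c ->] := wclP x; rewrite witt_oppE witt_addE.
apply/wcl_eq; rewrite cats0; apply: neutral_perm (neutral_opp_cat c).
by rewrite perm_catC.
Qed.

HB.instance Definition _ := GRing.isZmodule.Build witt
  witt_addA witt_addC witt_add0 witt_addN.

Definition wt (b : B) : witt := wcl [:: b].

Lemma sum_wt (c : seq B) : \sum_(b <- c) wt b = wcl c.
Proof.
elim: c => [|b c IHc]; first by rewrite big_nil.
by rewrite big_cons IHc -[LHS]/(witt_add _ _) witt_addE.
Qed.

Lemma sum_wt_eq0 (c : seq B) : \sum_(b <- c) wt b = 0 <-> neutral c.
Proof. by rewrite sum_wt wcl_eq cats0. Qed.

Lemma wtN b : wt (- b) = - wt b.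
Proof. by rewrite -[RHS]/(witt_opp _) witt_oppE. Qed.

Lemma witt_torsion_free (x : witt) k : x *+ k.+1 = 0 -> x = 0.
Proof.
have [c ->] := wclP x; rewrite -sum_wt => xk.
apply/sum_wt_eq0/(neutral_mulc (k := k))/sum_wt_eq0.
transitivity ((\sum_(b <- c) wt b) *+ k.+1); last exact: xk.
elim: k {xk} => [|k IHk]; first by rewrite /mulc /= cats0 mulr1n.
by rewrite -[mulc _ _]/(c ++ mulc k.+1 c) big_cat IHk [in RHS]mulrS.
Qed.

Lemma wt_emb (c d : seq B) : embl c d -> embl d c ->
  \sum_(b <- c) wt b = \sum_(b <- d) wt b.
Proof.
by move=> cd dc; rewrite !sum_wt; apply/wcl_eq; apply: neutral_embl.
Qed.

Lemma sum_wt_scale a (c : seq B) : (forall x, a * x = x * a) ->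
  \sum_(b <- c) wt b = 0 -> \sum_(b <- c) wt (a * b) = 0.
Proof.
move=> ac /sum_wt_eq0 c0; rewrite -[LHS](big_map ( *%R a) predT wt).
by apply/sum_wt_eq0; apply: neutral_scale.
Qed.

End Neutral.

(** * Pfister multiples and the construction of orderings *)

Record is_ordering (F : fieldType) (P : set F) : Prop := IsOrdering {
  ordering_add : forall x y, P x -> P y -> P (x + y);
  ordering_mul : forall x y, P x -> P y -> P (x * y);
  ordering_total : forall x, P x \/ P (- x);
  ordering_anti : forall x, P x -> P (- x) -> x = 0
}.

Section WittMap.
Variables (G : zmodType) (M : comNzRingType) (w : M -> G).
Implicit Types (a b c x : M) (l : seq M).

(* [w] extended additively to [b] times the Pfister form of [l], the tensor
   product of the <1, a> for [a] in [l]. *)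
Fixpoint wpf b l : G := if l is a :: l' then wpf b l' + wpf (b * a) l' else w b.

(** Quantifying over the multiplier [b] makes the condition stable under adding further slots. *)
Definition torsl l := forall b, wpf b l = 0.

Lemma wpf_swap b l a m : wpf b (l ++ a :: m) = wpf b (a :: l ++ m).
Proof.
elim: l b => [//|c l IHl] b /=; rewrite !IHl /= [b * a * c]mulrAC.
by rewrite !addrA; congr (_ + _); rewrite addrAC.
Qed.

Lemma torsl_cat l m : torsl l -> torsl (l ++ m).
Proof.
move=> tl; elim: m => [|a m IHm]; first by rewrite cats0.
by move=> b; rewrite wpf_swap /= !IHm addr0.
Qed.

End WittMap.

Section OrderingExistence.
Variables (G : zmodType) (M : fieldType) (w : M -> G).
Hypothesis G_tf : forall (x : G) k, x *+ k.+1 = 0 -> x = 0.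
Hypothesis wN : forall a, w (- a) = - w a.
Hypothesis wX : forall a x, x != 0 -> w (a * x ^+ 2) = w a.
Hypothesis wD : forall a b, a + b != 0 ->
  w a + w b = w (a + b) + w (a * b * (a + b)).
Implicit Types (a b c x : M) (l : seq M).

Local Notation wf := (wpf w).
Local Notation tors := (torsl w).

Lemma double_eq0 (x : G) : x + x = 0 -> x = 0.
Proof. by rewrite -mulr2n; apply: G_tf. Qed.

Lemma wpfN b l : wf (- b) l = - wf b l.
Proof.
by elim: l b => [|a l IHl] b /=; rewrite ?wN // mulNr !IHl opprD.
Qed.

Lemma wpf0 l : wf 0 l = 0.
Proof. by apply: double_eq0; have := wpfN 0 l; rewrite oppr0 => {1}->; rewrite addNr. Qed.

Lemma wpfX b x l : x != 0 -> wf (b * x ^+ 2) l = wf b l.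
Proof.
move=> x0; elim: l b => [|a l IHl] b /=; rewrite ?wX //.
by rewrite mulrAC !IHl.
Qed.

(** The relation <a, b> = <a + b, ab(a + b)> is inherited slot by slot: scaling [a] and [b] by a
    slot [c] changes the last entry by [c] times a square. *)
Lemma wpfD a b l : a + b != 0 ->
  wf a l + wf b l = wf (a + b) l + wf (a * b * (a + b)) l.
Proof.
elim: l a b => [|c l IHl] a b ab0 /=; first exact: wD.
rewrite addrACA (IHl a b ab0) [RHS]addrACA; congr (_ + _).
have [->|c0] := eqVneq c 0; first by rewrite !mulr0 !wpf0.
rewrite (IHl (a * c) (b * c)) -?mulrDl ?mulf_neq0 //; congr (_ + _).
have -> : a * c * (b * c) * ((a + b) * c) = a * b * (a + b) * c * c ^+ 2 by ring.
by rewrite wpfX.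
Qed.

(** A Pfister form is unchanged by multiplication with one of its slots: a<1, a> = <a, a^2> = <a,
    1>. *)
Lemma wpf_absorb b a l : a != 0 -> a \in l -> wf (b * a) l = wf b l.
Proof.
move=> a0; elim: l b => [//|c l IHl] b; rewrite inE => /orP[/eqP<-|al] /=.
  by rewrite -mulrA -expr2 wpfX // addrC.
by rewrite IHl // [b * a * c]mulrAC IHl.
Qed.

(** A repeated slot only doubles the form, and [G] has no 2-torsion. *)
Lemma torsl_strip a l : a \in l -> tors (a :: l) -> tors l.
Proof.
move=> al tal b; have := tal b; rewrite /=.
have [->|a0] := eqVneq a 0; first by rewrite mulr0 wpf0 addr0.
by rewrite wpf_absorb // => /double_eq0.
Qed.

Lemma torsl_sub l m : {subset l <= m} -> tors l -> tors m.
Proof.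
move=> lm /(torsl_cat m); elim: l lm => [//|a l IHl] lm t.
apply: IHl => [x xl|]; first by rewrite lm // inE xl orbT.
apply: (torsl_strip _ t); by rewrite mem_cat lm ?mem_head ?orbT.
Qed.

Definition consistent (S : set M) := forall l, {in l, forall a, S a} -> ~ tors l.

(** Consistency concerns finite lists, so it passes to unions of chains. In a maximal consistent set
    each axiom of an ordering says that some slot may be adjoined without creating torsion, and this
    is an identity between Pfister forms. *)
Lemma consistent_ordering (S0 : set M) : consistent S0 ->
  exists Q : set M, [/\ is_ordering Q, (S0 `<=` Q)%classic & consistent Q].
Proof.
move=> S0c.
have [|A [Ac Amax]] := @Zorn_bigcup M (fun A => consistent (S0 `|` A)%classic).
  move=> C CP Ctot l lS.
  have [[X CX lX]|S0l] : (exists2 X, C X & {in l, forall a, (S0 `|` X)%classic a}) \/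
      {in l, forall a, S0 a}.
  - elim: l lS => [|a l IHl] lS; first by right.
    have /IHl[[X CX lX]|lS0] : {in l, forall a, (S0 `|` \bigcup_(X in C) X)%classic a}.
      by move=> x xl; apply: lS; rewrite inE xl orbT.
    + have [aS0|[Y CY aY]] := lS a (mem_head _ _); left.
        exists X => // x; rewrite inE => /orP[/eqP->|]; [by left|exact: lX].
      have [XY|YX] := Ctot X Y CX CY.
        exists Y => // x; rewrite inE => /orP[/eqP->|/lX]; first by right.
        by case; [left|right; apply: XY].
      by exists X => // x; rewrite inE => /orP[/eqP->|/lX //]; right; apply: YX.
    + have [aS0|[Y CY aY]] := lS a (mem_head _ _).
        by right=> x; rewrite inE => /orP[/eqP->|/lS0].
      left; exists Y => // x; rewrite inE => /orP[/eqP->|/lS0]; by [right|left].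
  - exact: CP CX _ lX.
  - exact: S0c.
have maxA a : ~ A a -> exists2 l, {in l, forall x, (S0 `|` A)%classic x} & tors (a :: l).
  move=> nAa; apply: contrapT => h.
  apply: (Amax (A `|` [set a])%classic).
    split; [by move=> x; left|by move=> /(_ a (or_intror erefl))].
  move=> l lS tl; apply: h; exists [seq x <- l | x != a].
    move=> x; rewrite mem_filter => /andP[xa /lS[|[|/eqP]]]; [by left|by right|].
    by rewrite (negPf xa).
  apply: torsl_sub tl => x xl; rewrite inE mem_filter xl andbT.
  by case: eqP.
set Q := (S0 `|` A)%classic in maxA *.
have Qmax a : ~ Q a -> exists2 l, {in l, forall x, Q x} & tors (a :: l).
  by move=> nQ; apply: maxA => Aa; apply: nQ; right.
have Qin2 l1 l2 : {in l1, forall x, Q x} -> {in l2, forall x, Q x} ->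
    {in l1 ++ l2, forall x, Q x}.
  by move=> h1 h2 x; rewrite mem_cat => /orP[/h1|/h2].
(* Membership by maximality: were [a] outside [Q], some [m] in [Q] would make [a :: m] torsion,
   hence also [l ++ m], against consistency. *)
have QI a l : {in l, forall x, Q x} ->
    (forall m, {subset l <= m} -> tors (a :: m) -> tors m) -> Q a.
  move=> lQ h; apply: contrapT => /Qmax[m mQ tm].
  apply: (Ac (l ++ m)); first exact: Qin2.
  apply: h => [x xl|]; first by rewrite mem_cat xl.
  apply: torsl_sub tm => x; rewrite !inE mem_cat => /orP[->//|->].
  by rewrite !orbT.
exists Q; split=> //; last by left.
split=> [a b Qa Qb|a b Qa Qb|a|a Qa Qna].
- have [->|a0] := eqVneq a 0; first by rewrite add0r.
  have [->|b0] := eqVneq b 0; first by rewrite addr0.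
  apply: (QI _ [:: a; b]) => [x|m sm tm c].
    by rewrite !inE => /orP[/eqP->|/eqP->].
  have am : a \in m by apply: sm; rewrite mem_head.
  have bm : b \in m by apply: sm; rewrite !inE eqxx orbT.
  have := tm c; rewrite /=; have [->|ab0] := eqVneq (a + b) 0.
    by rewrite mulr0 wpf0 addr0.
  have [->|c0] := eqVneq c 0; first by rewrite wpf0.
  have := @wpfD (c * a) (c * b) m; rewrite -mulrDr mulf_neq0 // => /(_ isT).
  have -> : c * a * (c * b) * (c * (a + b)) = c * (a + b) * a * b * c ^+ 2 by ring.
  rewrite wpfX // !(wpf_absorb _ b0 bm) !(wpf_absorb _ a0 am).
  (* With x and y the Pfister multiples of [c] and of [c * (a + b)], [cab] reads x + x = y + y after
     absorption and [c_ab] reads x + y = 0, so four times x vanishes. *)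
  move=> cab c_ab; apply/double_eq0/double_eq0.
  move/eqP: c_ab; rewrite addr_eq0 => /eqP c_ab.
  by rewrite {1}cab c_ab addrACA addrN addr0.
- have [->|a0] := eqVneq a 0; first by rewrite mul0r; apply: (QI _ [::]) => // m _ t b';
    have := t b'; rewrite /= mulr0 wpf0 addr0.
  have [->|b0] := eqVneq b 0; first by rewrite mulr0; apply: (QI _ [::]) => // m _ t b';
    have := t b'; rewrite /= mulr0 wpf0 addr0.
  apply: (QI _ [:: a; b]) => [x|m sm tm c].
    by rewrite !inE => /orP[/eqP->|/eqP->].
  have am : a \in m by apply: sm; rewrite mem_head.
  have bm : b \in m by apply: sm; rewrite !inE eqxx orbT.
  have := tm c; rewrite /= mulrA (wpf_absorb _ b0 bm) (wpf_absorb _ a0 am); exact: double_eq0.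
- have [//|nQa] := pselect (Q a); [by left|right].
  have [l lQ tl] := Qmax _ nQa; apply: (QI _ l lQ) => m sm tm b.
  have := torsl_sub (m := a :: m) _ tl; rewrite /torsl /= => /(_ _ b) h.
  have {}h : wf b m + wf (b * a) m = 0.
    by apply: h => x; rewrite !inE => /orP[->//|/sm->]; rewrite orbT.
  have := tm b; rewrite /= mulrN wpfN => /eqP; rewrite subr_eq0 => /eqP ba.
  by apply: double_eq0; rewrite {2}ba.
- apply: contrapT => /eqP a0; apply: (Ac [:: a; - a]) => [x|b].
    by rewrite !inE => /orP[/eqP->|/eqP->].
  apply: double_eq0.
  have h1 := @wpf_absorb b a [:: a; - a] a0 (mem_head _ _).
  have := @wpf_absorb b (- a) [:: a; - a]; rewrite oppr_eq0 !inE eqxx orbT a0.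
  move=> /(_ isT isT); rewrite mulrN wpfN h1 => h2.
  by rewrite -{1}h2 addNr.
Qed.

End OrderingExistence.

(** * Inertia for semiorderings, and signs at an ordering *)

Section Semiorderings.
Variables (K : fieldType) (S : set K).
Hypothesis S_semi : semiordering S.

Lemma semiordering_dich x : S x \/ S (- x).
Proof.
have : (S `|` [set - y | y in S])%classic x by rewrite (semiordering_total S_semi).
by case=> [|[y Sy <-]]; [left|right; rewrite opprK].
Qed.

Lemma semiordering_eq0 x : S x -> S (- x) -> x = 0.
Proof.
move=> Sx Snx; suff : (S `&` [set - y | y in S])%classic x.
  by rewrite (semiordering_anti S_semi).
by split=> //; exists (- x); rewrite // opprK.
Qed.

Lemma semiordering0 : S 0.
Proof. by case: (semiordering_dich 0); rewrite ?oppr0. Qed.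

Lemma semiordering_sum (I : Type) (r : seq I) (P : pred I) (a : I -> K) :
  (forall i, P i -> S (a i)) -> S (\sum_(i <- r | P i) a i).
Proof.
move=> Sa; apply: (big_ind S) => //; first exact: semiordering0.
exact: semiorderingD.
Qed.

Lemma semiordering_sum_eq0 (I : finType) (a : I -> K) :
  (forall i, S (a i)) -> \sum_i a i = 0 -> forall i, a i = 0.
Proof.
move=> Sa s0 i; apply: semiordering_eq0 => //.
move/eqP: s0; rewrite (bigD1 i) //= addrC addr_eq0 => /eqP<-.
exact: semiordering_sum.
Qed.

(* Otherwise a nonzero combination of the [i] with [a i] in [S] is orthogonal to
   all [j] with [b j] in [S], and its value is in [S] and in [- S]. *)
Lemma orth_count (I J : finType) (a : I -> K) (b : J -> K) (g : I -> J -> K) :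
  (forall i, a i != 0) ->
  (forall i i', \sum_j g i j * b j * g i' j = a i *+ (i == i')) ->
  (#|[pred i | `[< S (a i) >]]| <= #|[pred j | `[< S (b j) >]]|)%N.
Proof.
move=> a0 gE; set Ip := [pred i | _]; set Jp := [pred j | _].
rewrite leqNgt; apply/negP => lt_JI.
pose N : 'M[K]_(#|Ip|, #|Jp|) := \matrix_(i, j) g (enum_val i) (enum_val j).
have kerN : kermx N != 0.
  rewrite -mxrank_eq0 mxrank_ker subn_eq0 -ltnNge.
  exact: leq_ltn_trans (rank_leq_col N) lt_JI.
have /rowV0Pn[x /sub_kermxP xN x0] := kerN.
pose y j := \sum_k x 0 k * g (enum_val k) j.
have yp j : S (b j) -> y j = 0.
  move=> Sbj; have jp : j \in Jp by apply/asboolP.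
  have /rowP/(_ (enum_rank_in jp j)) := xN; rewrite !mxE => <-.
  by apply: eq_bigr => k _; rewrite mxE enum_rankK_in.
have yE : \sum_j b j * y j ^+ 2 = \sum_k a (enum_val k) * x 0 k ^+ 2.
  transitivity (\sum_k \sum_k' x 0 k * x 0 k' *
      (\sum_j g (enum_val k) j * b j * g (enum_val k') j)).
    under [RHS]eq_bigr => k _ do under eq_bigr => k' _ do rewrite mulr_sumr.
    under [RHS]eq_bigr => k _ do rewrite exchange_big.
    rewrite [RHS]exchange_big; apply: eq_bigr => j _ /=.
    rewrite expr2 /y mulr_suml mulr_sumr; apply: eq_bigr => k _.
    rewrite !mulr_sumr; apply: eq_bigr => k' _; ring.
  apply: eq_bigr => k _; rewrite (bigD1 k) //= gE eqxx big1 ?addr0 => [|k' k'k].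
    by rewrite mulr1n mulrC expr2.
  by rewrite gE (inj_eq enum_val_inj) eq_sym (negPf k'k) mulr0n mulr0.
pose c (i : 'I_#|Ip| + J) := match i with
  | inl k => x 0 k ^+ 2 * a (enum_val k) | inr j => y j ^+ 2 * - b j end.
have c0 : forall i, c i = 0.
  apply: semiordering_sum_eq0 => [[k|j] /=|].
  - apply: semiordering_sqrM => //; apply/asboolP; exact: (enum_valP k).
  - have [Sb|Snb] := semiordering_dich (b j); last exact: semiordering_sqrM.
    by rewrite yp // expr0n mul0r; apply: semiordering0.
  rewrite big_sumType /=; apply/eqP; rewrite addr_eq0; apply/eqP.
  rewrite -sumrN; under eq_bigr => k _ do rewrite mulrC.
  by rewrite -yE; apply: eq_bigr => j _; rewrite mulrN opprK mulrC.
case/eqP: x0; apply/rowP => k; rewrite mxE; have /eqP := c0 (inl k).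
by rewrite /= mulf_eq0 (negPf (a0 _)) orbF expf_eq0 => /eqP.
Qed.

End Semiorderings.

Section Orderings.
Variables (F : fieldType) (P : set F).
Hypothesis P_ord : is_ordering P.

Lemma ordering_sqr x : P (x ^+ 2).
Proof.
rewrite expr2; have [Px|Px] := ordering_total P_ord x; last rewrite -mulrNN;
  exact: ordering_mul.
Qed.

Lemma ordering1 : P 1.
Proof. by rewrite -[1](expr1n _ 2); apply: ordering_sqr. Qed.

Lemma ordering_semi : semiordering P.
Proof.
split; first exact: ordering1.
- by move=> x y Py; apply: ordering_mul => //; apply: ordering_sqr.
- exact: ordering_add.
- apply/seteqP; split=> // x _; have [Px|Px] := ordering_total P_ord x; first by left.
  by right; exists (- x); rewrite ?opprK.
apply/seteqP; split=> [x [Px [y Py yx]]|x -> /=].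
  by apply: (ordering_anti P_ord) => //; rewrite -yx opprK.
have P0 : P 0 by have [] := ordering_total P_ord 0; rewrite ?oppr0.
by split=> //; exists 0; rewrite ?oppr0.
Qed.

Definition sgP (x : F) : int :=
  if x == 0 then 0 else if `[< P x >] then 1 else -1.

Lemma sgP0 : sgP 0 = 0.
Proof. by rewrite /sgP eqxx. Qed.

Lemma sgP_pos x : x != 0 -> P x -> sgP x = 1.
Proof. by rewrite /sgP => /negPf-> /asboolT->. Qed.

Lemma sgP_neg x : x != 0 -> P (- x) -> sgP x = -1.
Proof.
rewrite /sgP => x0 Pnx; rewrite (negPf x0); case: asboolP => // Px.
by case/eqP: x0; apply: ordering_anti Pnx.
Qed.

Lemma sgP1 : sgP 1 = 1.
Proof. by rewrite sgP_pos ?oner_eq0 //; apply: ordering1. Qed.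

Lemma sgPM x y : sgP (x * y) = sgP x * sgP y.
Proof.
have [->|x0] := eqVneq x 0; first by rewrite mul0r sgP0 mul0r.
have [->|y0] := eqVneq y 0; first by rewrite mulr0 sgP0 mulr0.
have xy0 : x * y != 0 by rewrite mulf_neq0.
have PM := ordering_mul P_ord.
have [Px|Px] := ordering_total P_ord x; have [Py|Py] := ordering_total P_ord y.
- by rewrite !sgP_pos //; apply: PM.
- by rewrite (sgP_pos x0) // !sgP_neg // -mulrN; apply: PM.
- by rewrite (sgP_neg x0) // (sgP_pos y0) // sgP_neg // -mulNr; apply: PM.
- by rewrite (sgP_neg x0) // (sgP_neg y0) // sgP_pos // -mulrNN; apply: PM.
Qed.

Lemma sgPN x : sgP (- x) = - sgP x.
Proof.
have [->|x0] := eqVneq x 0; first by rewrite oppr0 sgP0.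
have nx0 : - x != 0 by rewrite oppr_eq0.
have [Px|Px] := ordering_total P_ord x.
  by rewrite sgP_neg ?opprK // sgP_pos.
by rewrite (sgP_pos nx0) // (sgP_neg x0).
Qed.

Lemma sgP_sqr x : x != 0 -> sgP x * sgP x = 1.
Proof.
move=> x0; have [Px|Px] := ordering_total P_ord x.
  by rewrite sgP_pos.
by rewrite sgP_neg.
Qed.

Lemma sgP_count (I : finType) (a : I -> F) : (forall i, a i != 0) ->
  \sum_i sgP (a i) =
  #|[pred i | `[< P (a i) >]]|%:Z - #|[pred i | `[< P (- a i) >]]|%:Z.
Proof.
move=> a0.
have sgE i : sgP (a i) = `[< P (a i) >]%:Z - `[< P (- a i) >]%:Z.
  have [Pa|Pa] := ordering_total P_ord (a i).
    rewrite sgP_pos // asboolT // asboolF ?subr0 // => Pna.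
    by have /eqP := a0 i; apply; apply: ordering_anti Pna.
  rewrite sgP_neg // (asboolT Pa) asboolF ?sub0r // => Pa'.
  by have /eqP := a0 i; apply; apply: ordering_anti Pa.
have cardE (p : pred I) : \sum_i (p i)%:Z = #|p|%:Z.
  rewrite -natz -sum1_card natr_sum [RHS]big_mkcond /=.
  by apply: eq_bigr => i _; rewrite unfold_in; case: (p i).
under eq_bigr => i _ do rewrite sgE.
by rewrite sumrB; congr (_ - _); exact: cardE.
Qed.

Lemma orth_count_sgP (I J : finType) (a : I -> F) (b : J -> F)
    (g : I -> J -> F) :
  (forall i, a i != 0) -> (forall j, b j != 0) ->
  (forall i i', \sum_j g i j * b j * g i' j = a i *+ (i == i')) ->
  (#|[pred i | `[< P (a i) >]]| <= #|[pred j | `[< P (b j) >]]|)%N /\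
  (#|[pred i | `[< P (- a i) >]]| <= #|[pred j | `[< P (- b j) >]]|)%N.
Proof.
move=> a0 b0 gE; split; first exact: (orth_count ordering_semi a0 gE).
apply: (orth_count (g := g) ordering_semi) => [i|i i']; first by rewrite oppr_eq0.
under eq_bigr => j _ do rewrite mulrN mulNr.
by rewrite sumrN gE mulNrn.
Qed.

End Orderings.

(** * Orthogonal bases modulo the radical, and signatures *)

Section Frames.
Variables (F : fieldType) (V : Type) (beta : V -> V -> F).
Hypothesis beta_sym : forall x y, beta x y = beta y x.

Definition orth (I : finType) (v : I -> V) : Prop :=
  (forall i j, i != j -> beta (v i) (v j) = 0) /\
  (forall i, beta (v i) (v i) != 0).

(** The last clause is Parseval's identity: for bilinear [beta] it makes [v] an orthogonal basis
    modulo the radical. Degenerate forms and infinite-dimensional carriers such as [{poly F}] are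
    thereby allowed. *)
Definition frame (I : finType) (v : I -> V) : Prop :=
  orth v /\
  forall x y, beta x y = \sum_i beta x (v i) * beta (v i) y / beta (v i) (v i).

Lemma orth_frame_count (I J : finType) (v : I -> V) (u : J -> V) (P : set F) :
  is_ordering P -> orth v -> frame u ->
  (#|[pred i | `[< P (beta (v i) (v i)) >]]| <=
     #|[pred j | `[< P (beta (u j) (u j)) >]]|)%N /\
  (#|[pred i | `[< P (- beta (v i) (v i)) >]]| <=
     #|[pred j | `[< P (- beta (u j) (u j)) >]]|)%N.
Proof.
move=> P_ord [vo v0] [[uo u0] uE].
apply: (orth_count_sgP P_ord
  (g := fun i j => beta (v i) (u j) / beta (u j) (u j))) => // i i'.
transitivity (beta (v i) (v i')); last first.
  by have [<-|/vo ii'] := eqVneq i i'.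
rewrite uE; apply: eq_bigr => j _; rewrite (beta_sym (u j)).
by field.
Qed.

Lemma frame_sgP (I J : finType) (v : I -> V) (u : J -> V) (P : set F) :
  is_ordering P -> frame v -> frame u ->
  \sum_i sgP P (beta (v i) (v i)) = \sum_j sgP P (beta (u j) (u j)).
Proof.
move=> P_ord fv fu; have [[ov _] [ou _]] := (fv, fu).
rewrite !sgP_count //; [|by case: ou|by case: ov].
have [le1 le2] := orth_frame_count P_ord ov fu.
have [ge1 ge2] := orth_frame_count P_ord ou fv.
by congr (Posz _ - Posz _); apply/eqP; rewrite eqn_leq ?le1 ?le2.
Qed.

End Frames.

Lemma sum_option (V : nmodType) (I : finType) (f : option I -> V) :
  \sum_o f o = f None + \sum_i f (Some i).
Proof.
rewrite (bigD1 None) //=; congr (_ + _).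
rewrite (reindex_omap Some id) => [|[i|] //].
by apply: eq_bigl => i; rewrite eqxx.
Qed.

(** Gram-Schmidt: a vector [v] with [beta v v] nonzero is split off by passing to the part [beta']
    of the form orthogonal to [v], which is generated by one vector fewer. *)
Lemma frame_exists (F : fieldType) (V : lmodType F) (n : nat)
    (beta : V -> V -> F) (e : 'I_n -> V) :
  2%:R != 0 :> F -> (forall x y, beta x y = beta y x) ->
  (forall a x y z, beta (a *: x + y) z = a * beta x z + beta y z) ->
  (forall x, exists c : 'I_n -> F,
     forall y, beta x y = \sum_i c i * beta (e i) y) ->
  exists (I : finType) (v : I -> V), frame beta v.
Proof.
move=> F2; elim: n beta e => [|n IHn] beta e bS bL bE.
  exists void, (fun i : void => match i with end); split; first by split; case.
  move=> x y; have [c ->] := bE x; rewrite !big1 //; by case.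
have bL' z a x y := bL a x y z.
have b0 z : beta 0 z = 0 := semilin0 (beta^~ z) (@mul1r F) (bL' z).
have bDl x y z : beta (x + y) z = _ := semilinD (beta^~ z) (@mul1r F) (bL' z) x y.
have bZl a x z : beta (a *: x) z = _ := semilinZ (beta^~ z) (@mul1r F) (bL' z) a x.
have [[v v0]|nv] := pselect (exists v, beta v v != 0); last first.
  exists void, (fun i : void => match i with end); split; first by split; case.
  move=> x y; rewrite big1; last by case.
  (* Without such a vector the form is zero, by polarization in characteristic not 2. *)
  have bv z : beta z z = 0.
    by apply/eqP; apply: contrapT => /negP h; apply: nv; exists z.
  have := bv (x + y); rewrite bDl [beta x _]bS [beta y (x + y)]bS !bDl !bv.
  rewrite add0r addr0.
  rewrite [beta y x]bS -mulr2n -mulr_natl => /eqP.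
  by rewrite mulf_eq0 (negPf F2) => /eqP.
set q := beta v v in v0.
pose beta' x y := beta x y - beta x v * beta v y / q.
have b'v y : beta' v y = 0 by rewrite /beta' -/q mulrAC divff // mul1r subrr.
have b'S x y : beta' x y = beta' y x.
  by rewrite /beta' bS [beta x v]bS [beta v y]bS [beta v x * _]mulrC.
have b'L a x y z : beta' (a *: x + y) z = a * beta' x z + beta' y z.
  by rewrite /beta' !bL; ring.
have [c cE] := bE v.
have [k ck] : exists k, c k != 0.
  apply: contrapT => h; case/eqP: v0; rewrite /q cE big1 // => i _.
  have [->|ci] := eqVneq (c i) 0; first by rewrite mul0r.
  by case: h; exists i.
have b'E x d : (forall y, beta x y = \sum_i d i * beta (e i) y) ->
    forall y, beta' x y = \sum_i d i * beta' (e i) y.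
  move=> xE y; rewrite /beta' !xE !mulr_suml -sumrB.
  by apply: eq_bigr => i _; ring.
(* The generator [e k] becomes redundant: [v] lies in the radical of [beta'], and its expansion, in
   which [c k] is nonzero, expresses [e k] through the others. *)
have [|I [u [[uo u0] uE]]] := IHn beta' (fun i => e (lift k i)) b'S b'L.
  move=> x; have [d /b'E dE] := bE x.
  exists (fun i => d (lift k i) - d k / c k * c (lift k i)) => y.
  have /eqP := b'E v c cE y; rewrite b'v eq_sym (bigD1_ord k) //= addr_eq0.
  move=> /eqP ek; rewrite dE (bigD1_ord k) //=.
  have -> : d k * beta' (e k) y = - (d k / c k) *
      (\sum_i c (lift k i) * beta' (e (lift k i)) y).
    have -> : \sum_i c (lift k i) * beta' (e (lift k i)) y = - (c k * beta' (e k) y).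
      by rewrite ek opprK.
    by field.
  rewrite mulr_sumr -big_split; apply: eq_bigr => i _ /=; ring.
(* Orthogonal projection along [v], so that the frame of [beta'] becomes orthogonal to [v] for
   [beta] itself. *)
pose u' i := u i - (beta (u i) v / q) *: v.
have u'E i y : beta (u' i) y = beta' (u i) y.
  by rewrite /u' bDl -scaleNr bZl /beta'; ring.
have u'v i : beta v (u' i) = 0 by rewrite bS u'E b'S b'v.
have b'u' x i : beta' x (u' i) = beta' x (u i).
  by rewrite b'S /u' addrC -scaleNr b'L b'v mulr0 add0r b'S.
exists (option I), (fun o => if o is Some i then u' i else v).
split; first split.
- move=> [i|] [j|] // ij.
  + by rewrite u'E b'u' uo //; apply: contraNneq ij => ->.
  + by rewrite bS u'v.
- by move=> [i|] //; rewrite u'E b'u'.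
move=> x y; rewrite sum_option /= -/q.
have -> : beta x y = beta x v * beta v y / q + beta' x y by rewrite /beta' addrC subrK.
congr (_ + _); rewrite uE; apply: eq_bigr => i _.
by rewrite [beta x _]bS !u'E b'u' [beta' x _]b'S.
Qed.

Section Signature.
Variables (F : fieldType) (P : set F).
Hypothesis P_ord : is_ordering P.

(* Independent of the frame by Sylvester's law [frame_sgP]; 0 without a frame. *)
Definition sgn (V : Type) (beta : V -> V -> F) : int :=
  xget 0 [set k : int | exists (I : finType) (v : I -> V),
            frame beta v /\ k = \sum_i sgP P (beta (v i) (v i))]%classic.

Definition framed (V : Type) (beta : V -> V -> F) : Prop :=
  (forall x y, beta x y = beta y x) /\
  exists (I : finType) (v : I -> V), frame beta v.

Lemma sgn_frame (V : Type) (beta : V -> V -> F) (I : finType) (v : I -> V) :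
  (forall x y, beta x y = beta y x) -> frame beta v ->
  sgn beta = \sum_i sgP P (beta (v i) (v i)).
Proof.
move=> bS fv; rewrite /sgn; case: xgetP => [k -> [J [u [fu ->]]]|].
  exact: frame_sgP.
by move=> /(_ (\sum_i sgP P (beta (v i) (v i)))) h; case: h; exists I, v.
Qed.

Lemma sgnN (V : Type) (beta : V -> V -> F) : framed beta ->
  sgn (fun x y => - beta x y) = - sgn beta.
Proof.
move=> [bS [I [v fv]]]; rewrite (sgn_frame bS fv) (@sgn_frame _ _ I v).
- by rewrite -sumrN; apply: eq_bigr => i _; rewrite sgPN.
- by move=> x y; rewrite bS.
have [[vo v0] vE] := fv; split; first split.
- by move=> i j /vo ->; rewrite oppr0.
- by move=> i; rewrite oppr_eq0.
move=> x y; rewrite vE -sumrN; apply: eq_bigr => i _.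
by rewrite mulrNN invrN mulrN.
Qed.

(** Frames only see the values of the form, so a right inverse [T'] of [T] modulo the radical moves
    a frame of [beta] to one of its pullback; linearity of the maps does not enter. *)
Lemma sgn_transport (V V' : Type) (beta : V -> V -> F) (beta' : V' -> V' -> F)
    (T : V' -> V) (T' : V -> V') :
  framed beta -> (forall x y, beta' x y = beta (T x) (T y)) ->
  (forall x y, beta (T (T' x)) y = beta x y) ->
  framed beta' /\ sgn beta' = sgn beta.
Proof.
move=> [bS [I [v fv]]] b'E TT'.
have b'S x y : beta' x y = beta' y x by rewrite !b'E bS.
have [[vo v0] vE] := fv.
have TT2 x y : beta (T (T' x)) (T (T' y)) = beta x y.
  by rewrite TT' bS TT' bS.
have fv' : frame beta' (T' \o v).
  split; first split; rewrite /=.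
  - by move=> i j ij; rewrite b'E TT2 vo.
  - by move=> i; rewrite b'E TT2.
  move=> x y; rewrite b'E vE; apply: eq_bigr => i _.
  by rewrite !b'E TT2 TT' [beta (T x) (T _)]bS TT' [beta (v i) (T x)]bS.
split; first by split=> //; exists I, (T' \o v).
rewrite (sgn_frame b'S fv') (sgn_frame bS fv); apply: eq_bigr => i _ /=.
by rewrite b'E TT2.
Qed.

(** The carriers are bare types, so an element of each radical plays the part of 0 when the two
    frames are put into the product. *)
Lemma sgn_sum (V1 V2 : Type) (b1 : V1 -> V1 -> F) (b2 : V2 -> V2 -> F) :
  framed b1 -> framed b2 ->
  let b (x y : V1 * V2) := b1 x.1 y.1 + b2 x.2 y.2 in
  (exists x, forall y, b1 x y = 0) -> (exists x, forall y, b2 x y = 0) ->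
  framed b /\ sgn b = sgn b1 + sgn b2.
Proof.
move=> [b1S [I [v fv]]] [b2S [J [u fu]]] b [z1 z1E] [z2 z2E].
have [[vo v0] vE] := fv; have [[uo u0] uE] := fu.
have bS x y : b x y = b y x by rewrite /b b1S b2S.
pose vu (k : I + J) := match k with inl i => (v i, z2) | inr j => (z1, u j) end.
have z1E' x : b1 x z1 = 0 by rewrite b1S.
have z2E' x : b2 x z2 = 0 by rewrite b2S.
have fvu : frame b vu.
  split; first split.
  - move=> [i|i] [j|j] ij; rewrite /b /= ?z1E ?z2E ?z1E' ?z2E' ?addr0 ?add0r //.
      by rewrite vo //; apply: contraNneq ij => ->.
    by rewrite uo //; apply: contraNneq ij => ->.
  - by move=> [i|i]; rewrite /b /= ?z1E ?z2E ?addr0 ?add0r.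
  move=> x y; rewrite big_sumType /= {1}/b vE uE; congr (_ + _).
    by apply: eq_bigr => i _; rewrite /b /= !z2E !z2E' !addr0.
  by apply: eq_bigr => i _; rewrite /b /= !z1E !z1E' !add0r.
split; first by split=> //; exists (I + J)%type, vu.
rewrite (sgn_frame bS fvu) (sgn_frame b1S fv) (sgn_frame b2S fu) big_sumType /=.
congr (_ + _); apply: eq_bigr => i _; rewrite /b /=.
  by rewrite z2E addr0.
by rewrite z1E add0r.
Qed.

Lemma ordering_char0 n : n.+1%:R != 0 :> F.
Proof.
have Pn m : P m%:R.
  elim: m => [|m IHm]; first by case: (ordering_total P_ord 0); rewrite ?oppr0.
  by rewrite -addn1 natrD; apply: ordering_add => //; apply: ordering1.
apply/eqP => n0; have /eqP := oner_neq0 F; apply.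
apply: (ordering_anti P_ord); first exact: ordering1.
suff -> : -1 = n%:R :> F by [].
by apply/eqP; rewrite eq_sym -addr_eq0 -n0 -[n.+1]addn1 natrD.
Qed.

End Signature.

(** * Trace forms of F[X]/(f) *)

Section TraceForm.
Variable F : fieldType.
Implicit Types f g h p q u : {poly F}.

(* By Euler's formula, [ptr f p] below is the sum of the values of [p] at the roots
   of a separable monic [f]. *)
Definition res f p : F := (p %% f)`_(size f).-2.

Lemma resD f p q : res f (p + q) = res f p + res f q.
Proof. by rewrite /res modpD coefD. Qed.

Lemma resZ f a p : res f (a *: p) = a * res f p.
Proof. by rewrite /res modpZl coefZ. Qed.

Lemma res_dvd f p : f %| p -> res f p = 0.
Proof. by rewrite /res => /modp_eq0 ->; rewrite coef0. Qed.

Lemma coefM_top p q m n : (size p <= m.+1)%N -> (size q <= n.+1)%N ->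
  (p * q)`_(m + n) = p`_m * q`_n.
Proof.
move=> sp sq; rewrite coefM.
have mP : (m < (m + n).+1)%N by rewrite ltnS leq_addr.
rewrite (bigD1 (Ordinal mP)) //= addKn big1 ?addr0 // => i im.
have [lt_mi|] := ltnP m i.
  by rewrite [p`_i]nth_default ?mul0r //; apply: leq_trans sp _.
rewrite leq_eqVlt => /orP[/eqP eim|lt_im].
  by case/eqP: im; apply: val_inj.
rewrite [q`_ _]nth_default ?mulr0 //; apply: leq_trans sq _; lia.
Qed.

(** For monic f, [res f p] is the coefficient of 1/X in the expansion of p/f at infinity; it depends
    on the fraction only, so a common factor cancels. *)
Lemma resM g h p : g \is monic -> h \is monic ->
  res (g * h) (p * g) = res h p.
Proof.
move=> mg mh; have g0 := monic_neq0 mg; have h0 := monic_neq0 mh.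
rewrite /res [p * g]mulrC.
have -> : (g * p) %% (g * h) = g * (p %% h).
  have E : g * p = (p %/ h) * (g * h) + g * (p %% h).
    by rewrite {1}(divp_eq p h); ring.
  rewrite {1}E modpD modp_mull add0r modp_small //.
  have [->|r0] := eqVneq (p %% h) 0.
    by rewrite mulr0 size_poly0 size_poly_gt0 mulf_neq0.
  rewrite !size_mul //; have : (0 < size g)%N by rewrite size_poly_gt0.
  have := ltn_modpN0 p h0.
  by move: (size g) (size h) (size (p %% h)) => a b c; lia.
(* For constant [h] the index [(size h).-2] is truncated, but all remainders are 0. *)
have [h1|h1] := leqP (size h) 1.
  suff -> : p %% h = 0 by rewrite mulr0 !coef0.
  apply/eqP; rewrite -size_poly_eq0 -leqn0 -ltnS.
  exact: leq_trans (ltn_modpN0 p h0) h1.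
have -> : (size (g * h)%R).-2 = ((size g).-1 + (size h).-2)%N.
  rewrite size_mul //; have : (0 < size g)%N by rewrite size_poly_gt0.
  by move: (size g) (size h) h1 => a b; lia.
rewrite coefM_top -?lead_coefE ?(monicP mg) ?mul1r //.
  exact: leqSpred.
have := ltn_modpN0 p h0; move: (size (p %% h)) (size h) h1 => a b; lia.
Qed.

Definition ptr f p : F := res f (p * f^`()).

Lemma ptrD f p q : ptr f (p + q) = ptr f p + ptr f q.
Proof. by rewrite /ptr mulrDl resD. Qed.

Lemma ptrZ f a p : ptr f (a *: p) = a * ptr f p.
Proof. by rewrite /ptr -scalerAl resZ. Qed.

Lemma ptr_dvd f p : f %| p -> ptr f p = 0.
Proof. by move=> fp; rewrite /ptr res_dvd // dvdp_mulr. Qed.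

Lemma ptr_mod f p q : f %| p - q -> ptr f p = ptr f q.
Proof.
by move=> /ptr_dvd pq0; rewrite -[p](subrK q) ptrD pq0 add0r.
Qed.

(** Logarithmic derivatives add up: (gh)'/(gh) = g'/g + h'/h. *)
Lemma ptrM g h p : g \is monic -> h \is monic ->
  ptr (g * h) p = ptr g p + ptr h p.
Proof.
move=> mg mh; rewrite /ptr derivM mulrDr resD; congr (_ + _).
  by rewrite mulrA [g * h]mulrC resM.
by rewrite [g * h^`()]mulrC mulrA resM.
Qed.

Lemma ptr_XsubC a p : ptr ('X - a%:P) p = p.[a].
Proof.
by rewrite /ptr derivXsubC mulr1 /res size_XsubC modp_XsubC coefC.
Qed.

(** The trace form of F[X]/(f) scaled by [u], kept on all polynomials: the multiples of [f] lie in
    its radical, and quotient rings are avoided. *)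
Definition tform f u p q : F := ptr f (u * p * q).

Lemma tform_sym f u p q : tform f u p q = tform f u q p.
Proof. by rewrite /tform mulrAC. Qed.

Lemma tform_linear f u a p q r :
  tform f u (a *: p + q) r = a * tform f u p r + tform f u q r.
Proof. by rewrite /tform mulrDr mulrDl -scalerAr -scalerAl ptrD ptrZ. Qed.

Lemma tform_mod f u p q p' : f %| p - q -> tform f u p p' = tform f u q p'.
Proof.
move=> fpq; apply: ptr_mod; rewrite -mulrBl -mulrBr.
by rewrite dvdp_mulr // dvdp_mull.
Qed.

Lemma tform_framed f u : 2%:R != 0 :> F -> f != 0 -> framed (tform f u).
Proof.
move=> F2 f0; split; first exact: tform_sym.
apply: (frame_exists (n := size f) (e := fun i => 'X^i)) => //.
- exact: tform_sym.
- exact: tform_linear.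
move=> p; exists (fun i => (p %% f)`_i) => q.
rewrite (@tform_mod f u p (p %% f)); last first.
  by rewrite {1}(divp_eq p f) addrK dvdp_mull.
have pE : p %% f = \sum_(i < size f) (p %% f)`_i *: 'X^i.
  rewrite -[LHS](@coefK _ (p %% f)) poly_def.
  rewrite (big_ord_widen _ (fun i => (p %% f)`_i *: 'X^i) (ltnW (ltn_modpN0 p f0))).
  rewrite big_mkcond; apply: eq_bigr => i _; case: ltnP => // le.
  by rewrite nth_default // scale0r.
have t0 r : tform f u 0 r = 0 by rewrite /tform mulr0 mul0r ptr_dvd ?dvdp0.
have tD r : {morph (tform f u)^~ r : x y / x + y}.
  by move=> x y; rewrite -[x]scale1r tform_linear mul1r scale1r.
rewrite {1}pE (big_morph _ (tD q) (t0 q)); apply: eq_bigr => i _.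
by rewrite -[X in tform _ _ X _]addr0 tform_linear t0 addr0.
Qed.

End TraceForm.

(** * Extension of an ordering to the residue field of a factor of f *)

Lemma root_field (F : fieldType) (g : {poly F}) :
    irreducible_poly g -> g \is monic ->
  exists (M : fieldType) (iota : {rmorphism F -> M}) (al : M),
    (forall p, ((map_poly iota p).[al] == 0) = (g %| p)) /\
    (forall m, exists p, m = (map_poly iota p).[al]).
Proof.
move=> gI gM; pose hI : monic_irreducible_poly g := (gI, gM).
pose M : fieldType := {poly %/ g with hI}.
pose iota : {rmorphism F -> M} := in_alg M.
have pE p : (map_poly iota p).['qX : M] = in_qpoly g p.
  rewrite -[in RHS](coefK p) poly_def raddf_sum /= horner_poly.
  apply: eq_bigr => i _; rewrite linearZ rmorphXn /= mulr_algl.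
  by [].
exists M, iota, ('qX : M); split=> [p|m]; last first.
  exists (val m); rewrite pE; apply: val_inj.
  exact: esym (in_qpoly_small (size_mk_monic m)).
have modE : val (in_qpoly g p) = p %% g.
  by rewrite /= mk_monicE // Pdiv.IdomainMonic.modpE.
rewrite pE; apply/eqP/modp_eq0P => [p0|pg0]; first by rewrite -modE p0.
by apply: val_inj; rewrite modE pg0.
Qed.

(* [w] behaves like u |-> <u> over F[X]/(f), which need not be a field. *)
Record poly_witt (F : fieldType) (G : zmodType) (f : {poly F})
  (w : {poly F} -> G) : Prop := PolyWitt {
  poly_witt_mod : forall p q, f %| p - q -> w p = w q;
  poly_wittN : forall p, w (- p) = - w p;
  poly_wittX : forall p x, coprimep x f -> w (p * x ^+ 2) = w p;
  poly_wittD : forall c a b, coprimep (a + b) f ->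
    w (c * a) + w (c * b) = w (c * (a + b)) + w (c * (a * b * (a + b)));
  poly_witt_split : forall u1 u2 p, f %| u1 + u2 - 1 -> f %| u1 * u2 ->
    w p = w (u1 * p) + w (u2 * p)
}.

(* [u1] and [u2] are complementary idempotents modulo [g * h]. *)
Lemma poly_witt_local (F : fieldType) (G : zmodType) (g h u1 u2 : {poly F})
    (w : {poly F} -> G) :
  poly_witt (g * h) w -> u1 + u2 = 1 -> h %| u1 -> g %| u2 ->
  poly_witt g (fun p => w (u1 * p)).
Proof.
move=> wW u12 hu1 gu2.
have f12 : g * h %| u1 * u2 by rewrite mulrC dvdp_mul.
have u2E : u2 = 1 - u1 by rewrite -u12 addrC addKr.
have fu1 p : g %| p -> g * h %| u1 * p by move=> gp; rewrite mulrC dvdp_mul.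
have u11 p : g * h %| u1 * (u1 * p) - u1 * p.
  have -> : u1 * (u1 * p) - u1 * p = u1 * u2 * - p.
    by rewrite u2E; ring.
  by rewrite dvdp_mulr.
(* The element [u1 * x + u2] is [x] modulo [g] and 1 modulo [h], so units modulo [g] lift to units
   modulo [g * h]. *)
have cop x : coprimep x g -> coprimep (u1 * x + u2) (g * h).
  move=> xg; rewrite coprimepMr.
  have [c1 c1E] : exists c, u1 = 1 - c * g.
    have /dvdpP[c cE] := gu2; by exists c; apply/eqP; rewrite eq_sym subr_eq -cE u12.
  have [c2 c2E] : exists c, u2 = 1 - c * h.
    have /dvdpP[c cE] := hu1; by exists c; apply/eqP; rewrite eq_sym subr_eq -cE addrC u12.
  apply/andP; split.
    have /dvdpP[c cE] := gu2.
    rewrite c1E cE coprimep_sym.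
    have -> : (1 - c1 * g) * x + c * g = (c - c1 * x) * g + x by ring.
    by rewrite coprimep_addl_mul coprimep_sym.
  have /dvdpP[c cE] := hu1.
  rewrite c2E cE coprimep_sym.
  have -> : c * h * x + (1 - c2 * h) = (c * x - c2) * h + 1 by ring.
  by rewrite coprimep_addl_mul coprimep1.
split=> [p q pq|p|p x xg|c a b abg|v1 v2 p v12 vv].
- by apply: (poly_witt_mod wW); rewrite -mulrBr fu1.
- by rewrite mulrN (poly_wittN wW).
- rewrite -(poly_wittX wW (u1 * p) (cop x xg)).
  apply: (poly_witt_mod wW).
  have -> : u1 * (p * x ^+ 2) - u1 * p * (u1 * x + u2) ^+ 2 =
     u1 * u2 * (p * x ^+ 2 * (1 + u1) - 2%:R * u1 * p * x - u2 * p).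
    by rewrite u2E; ring.
  by rewrite dvdp_mulr.
- have := poly_wittD wW (u1 * c) (a := u1 * a + u2) (b := u1 * b).
  have -> : u1 * a + u2 + u1 * b = u1 * (a + b) + u2 by ring.
  move=> /(_ (cop _ abg)) h0.
  have e1 x y : w (u1 * (c * x)) = w (u1 * c * (u1 * x + u2 * y)).
    apply: (poly_witt_mod wW).
    have -> : u1 * (c * x) - u1 * c * (u1 * x + u2 * y) = u1 * u2 * (c * (x - y)).
      by rewrite u2E; ring.
    by rewrite dvdp_mulr.
  rewrite (e1 a 1) (e1 b 0) (e1 (a + b) 1) !mulr1 mulr0 addr0 h0; congr (_ + _).
  rewrite (e1 _ 0) mulr0 addr0; apply: (poly_witt_mod wW).
  have -> : u1 * c * ((u1 * a + u2) * (u1 * b) * (u1 * (a + b) + u2)) -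
      u1 * c * (u1 * (a * b * (a + b))) =
      u1 * u2 * (c * u1 * (b * (u1 * a + u1 * (a + b) + u2) -
                           (u1 + 1) * a * b * (a + b))).
    by rewrite u2E; ring.
  by rewrite dvdp_mulr.
- have gh2 x : g %| x -> g * h %| (u1 * x) by exact: fu1.
  rewrite (poly_witt_split wW (u1 := u1 * v1 + u2) (u2 := u1 * v2) (u1 * p)).
  + congr (_ + _); apply: (poly_witt_mod wW).
      have -> : (u1 * v1 + u2) * (u1 * p) - u1 * (v1 * p) = u1 * u2 * (p - v1 * p).
        by rewrite u2E; ring.
      by rewrite dvdp_mulr.
    have -> : u1 * v2 * (u1 * p) - u1 * (v2 * p) = u1 * u2 * (- v2 * p).
      by rewrite u2E; ring.
    by rewrite dvdp_mulr.
  + have -> : u1 * v1 + u2 + u1 * v2 - 1 = u1 * (v1 + v2 - 1).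
      by rewrite u2E; ring.
    exact: gh2.
  + have -> : (u1 * v1 + u2) * (u1 * v2) = u1 * (u1 * (v1 * v2)) + u1 * u2 * v2.
      ring.
    by apply: dvdp_add; [apply/gh2/dvdp_mull|apply: dvdp_mulr].
Qed.

Lemma torsl_prepend (G : zmodType) (R : comNzRingType) (w : R -> G)
  (l m : seq R) : torsl w l -> torsl w (m ++ l).
Proof.
move=> tl; elim: m => [|a m IHm]; first exact: tl.
by move=> b; rewrite /= !IHm addr0.
Qed.

Section RealFactor.
Variables (F : fieldType) (P : set F) (G : zmodType).
Hypothesis P_ord : is_ordering P.
Hypothesis G_tf : forall (x : G) k, x *+ k.+1 = 0 -> x = 0.

Lemma wpf_addw (w1 w2 w : {poly F} -> G) b (l : seq {poly F}) :
  (forall p, w p = w1 p + w2 p) -> wpf w b l = wpf w1 b l + wpf w2 b l.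
Proof.
by move=> wE; elim: l b => [|a l IHl] b //=; rewrite !IHl addrACA.
Qed.

(** Modulo an irreducible [f] the polynomials form a field through which [w] factors, and Zorn's
    argument there may start from the image of [P]. *)
Lemma real_factor_irreducible (f : {poly F}) (w : {poly F} -> G) :
  irreducible_poly f -> f \is monic -> poly_witt f w ->
  (forall l, {in l, forall a, P a} -> ~ torsl w (map polyC l)) ->
  exists (M : fieldType) (iota : {rmorphism F -> M}) (al : M) (Q : set M),
    [/\ is_ordering Q, (forall x, P x -> Q (iota x)),
       (forall p, ((map_poly iota p).[al] == 0) = (f %| p)) &
       (forall m, exists p, m = (map_poly iota p).[al])].
Proof.
move=> fI fM wW wP; have [M [iota [al [evE surj]]]] := root_field fI fM.
pose lift m : {poly F} := sval (cid (surj m)).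
have liftK m : (map_poly iota (lift m)).[al] = m by rewrite /lift; case: cid.
have wE p q : (map_poly iota p).[al] = (map_poly iota q).[al] -> w p = w q.
  move=> pq; apply: (poly_witt_mod wW); rewrite -evE rmorphB hornerD hornerN.
  by rewrite pq subrr.
have cop p : (map_poly iota p).[al] != 0 -> coprimep p f.
  by rewrite evE coprimep_sym irreducible_poly_coprime.
have [||||Q [Q_ord PQ _]] := @consistent_ordering G M (w \o lift) G_tf _ _ _
    [set iota x | x in P]%classic.
- by move=> a; rewrite /= -(poly_wittN wW); apply: wE; rewrite rmorphN hornerN !liftK.
- move=> a x x0 /=; rewrite -(poly_wittX wW (lift a) (x := lift x)).
    by apply: wE; rewrite rmorphM rmorphXn hornerM horner_exp !liftK.
  by apply: cop; rewrite liftK.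
- move=> a b ab0 /=; have := poly_wittD wW 1 (a := lift a) (b := lift b).
  rewrite !mul1r => -> //.
    by congr (_ + _); apply: wE; rewrite !(rmorphM, rmorphD, hornerM, hornerD) /= ?liftK.
  by apply: cop; rewrite rmorphD hornerD !liftK.
- move=> l lP tl.
  have [l' l'P lE] : exists2 l', {in l', forall a, P a} & l = map iota l'.
    elim: l lP {tl} => [|a l IHl] lP; first by exists [::].
    have [x Px xa] := lP a (mem_head _ _).
    have [|l' l'P ->] := IHl; first by move=> y yl; apply: lP; rewrite inE yl orbT.
    exists (x :: l') => [y|]; last by rewrite /= xa.
    by rewrite inE => /orP[/eqP->|/l'P].
  apply: (wP l' l'P) => b; have := tl (map_poly iota b).[al]; rewrite lE => <-.
  elim: l' b {l'P lE} => [|a l' IHl'] b /=; first by apply: wE; rewrite liftK.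
  by rewrite !IHl' rmorphM hornerM /= map_polyC hornerC.
exists M, iota, al, Q; split=> // x Px; apply: PQ; by exists x.
Qed.

(** Induction on the degree. A proper factorization into coprime [q] and [r] splits [w] by Chinese
    remainders. If Pfister forms with slots in [P] killed both parts, the concatenated slots would
    kill [w]; so one part stays consistent. *)
Lemma real_factor (f : {poly F}) (w : {poly F} -> G) :
  separable_poly f -> poly_witt f w ->
  (forall l, {in l, forall a, P a} -> ~ torsl w (map polyC l)) ->
  exists (g : {poly F}) (M : fieldType) (iota : {rmorphism F -> M}) (al : M)
    (Q : set M),
    [/\ is_ordering Q, (forall x, P x -> Q (iota x)),
       (forall p, ((map_poly iota p).[al] == 0) = (g %| p)),
       (forall m, exists p, m = (map_poly iota p).[al]) &
       g \is monic /\ g %| f].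
Proof.
have [n] := ubnP (size f); elim: n f w => [//|n IHn] f w sf fS wW wP.
have f0 := separable_poly_neq0 fS.
have lf0 : (lead_coef f)^-1 != 0 by rewrite invr_eq0 lead_coef_eq0.
have [fI|fnI] := pselect (irreducible_poly f).
  pose g := (lead_coef f)^-1 *: f.
  have gf : g %= f by rewrite eqp_scale.
  have gM : g \is monic by rewrite monicE lead_coefZ mulVf ?lead_coef_eq0.
  have gI : irreducible_poly g.
    split=> [|q q1 qg]; first by rewrite size_scale //; case: fI.
    apply: eqp_trans (fI.2 q q1 _) _; last by rewrite eqp_sym.
    by rewrite -(eqp_dvdr _ gf).
  have gW : poly_witt g w.
    split=> [p q|p|p x|c a b|u1 u2 p]; rewrite ?(eqp_dvdl _ gf) ?(eqp_coprimepr _ gf).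
    - exact: (poly_witt_mod wW).
    - exact: (poly_wittN wW).
    - exact: (poly_wittX wW).
    - exact: (poly_wittD wW).
    - exact: (poly_witt_split wW).
  have [M [iota [al [Q [? ? ? ?]]]]] := real_factor_irreducible gI gM gW wP.
  by exists g, M, iota, al, Q; split=> //; rewrite (eqp_dvdl _ gf).
have [sf1|sf1] := leqP (size f) 1.
  have f1 : f %| 1 by rewrite dvdp1 eqn_leq sf1 size_poly_gt0.
  have w0 p : w p = 0.
    have -> : w p = w 0 by apply: (poly_witt_mod wW); apply: dvdp_trans f1 (dvd1p _).
    apply: (double_eq0 G_tf); rewrite -{1}[0]oppr0 (poly_wittN wW).
    by rewrite addNr.
  by case: (wP [::]) => // b /=.
have [q [q1 qf nqf]] : exists q : {poly F}, [/\ size q != 1%N, q %| f & ~ (q %= f)].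
  apply: contrapT => h; apply: fnI; split=> // q q1 qf.
  by apply: contrapT => nqf; apply: h; exists q.
have [r fE] := dvdpP _ _ qf.
have fE' : f = q * r by rewrite fE mulrC.
have /andP[q0 r0] : (q != 0) && (r != 0) by rewrite -negb_or -mulf_eq0 -fE'.
have qr : coprimep q r by apply: (separable_coprime fS); rewrite -fE'.
have szf : size f = (size q + size r).-1 by rewrite fE' size_mul.
have r1 : size r != 1%N.
  apply/eqP => r1; apply: nqf; rewrite fE'; apply/andP; split; first exact: dvdp_mulr.
  by rewrite -[X in _ %| X]mulr1 dvdp_mul // dvdp1 r1.
have sq0 : (0 < size q)%N by rewrite size_poly_gt0.
have sr0 : (0 < size r)%N by rewrite size_poly_gt0.
have [[c1 c2] /= cE] := Bezout_eq1_coprimepP _ _ qr.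
have qS : separable_poly q by apply: dvdp_separable fS.
have rS : separable_poly r by apply: dvdp_separable fS; rewrite fE' dvdp_mull.
(* By Bezout, [c2 * r] is the idempotent that is 1 modulo [q] and 0 modulo [r]. *)
have wq : poly_witt q (fun p => w (c2 * r * p)).
  apply: (@poly_witt_local _ _ q r _ (c1 * q)); rewrite -?fE' ?dvdp_mull //.
  by rewrite addrC.
have wr : poly_witt r (fun p => w (c1 * q * p)).
  by apply: (@poly_witt_local _ _ r q _ (c2 * r)); rewrite -1?fE ?dvdp_mull.
have wE p : w p = w (c2 * r * p) + w (c1 * q * p).
  apply: (poly_witt_split wW); first by rewrite [_ + c1 * q]addrC cE subrr dvdp0.
  by rewrite fE' mulrACA dvdp_mull // mulrC.
have [qP|] := pselect (forall l, {in l, forall a, P a} ->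
    ~ torsl (fun p => w (c2 * r * p)) (map polyC l)).
  have [|g [M [iota [al [Q [? ? ? ? [gM gq]]]]]]] := IHn q _ _ qS wq qP.
  - by move: (size f) (size q) (size r) sf szf q1 r1 sq0 sr0 => a b c; lia.
  by exists g, M, iota, al, Q; split=> //; split=> //; apply: dvdp_trans qf.
move=> /existsNP[l1 /not_implyP[l1P /contrapT t1]].
have rP : forall l, {in l, forall a, P a} ->
    ~ torsl (fun p => w (c1 * q * p)) (map polyC l).
  move=> l2 l2P t2; apply: (wP (l1 ++ l2)).
    by move=> x; rewrite mem_cat => /orP[/l1P|/l2P].
  move=> b; rewrite (wpf_addw _ _ wE) map_cat (torsl_cat _ t1) add0r.
  by rewrite (torsl_prepend _ t2).
have [|g [M [iota [al [Q [? ? ? ? [gM gr]]]]]]] := IHn r _ _ rS wr rP.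
- by move: (size f) (size q) (size r) sf szf q1 r1 sq0 sr0 => a b c; lia.
by exists g, M, iota, al, Q; split=> //; split=> //; rewrite fE' dvdp_mull.
Qed.

End RealFactor.

(** * Signatures of scaled trace forms as functions of the scaling factor *)

Section TraceFormWitt.
Variables (F : fieldType) (P : set F).
Hypothesis P_ord : is_ordering P.
Implicit Types f u c p q x : {poly F}.

Let F2 : 2%:R != 0 :> F := ordering_char0 P_ord 1.

(** Signatures are additive and invariant under isometry, so each clause of [poly_witt] is reduced
    to an explicit isometry modulo [f]. *)
Lemma tform_witt1 f c : f != 0 ->
  poly_witt f (fun u => sgn P (tform f (u * c))).
Proof.
move=> f0; have fr u := tform_framed u F2 f0.
have t0 u p : tform f u 0 p = 0 by rewrite /tform mulr0 mul0r ptr_dvd ?dvdp0.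
have z u : exists p, forall q, tform f u p q = 0 by exists 0; apply: t0.
have tu u u' p q : f %| u - u' -> tform f u p q = tform f u' p q.
  by move=> fu; apply: ptr_mod; rewrite -!mulrBl -mulrA dvdp_mulr.
have sgnE u u' : f %| u - u' -> sgn P (tform f u) = sgn P (tform f u').
  by move=> fu; congr (sgn P _); apply: funext => p; apply: funext => q; apply: tu.
split=> [p q pq|p|p x xf|d a b abf|u1 u2 p u12 uu].
- by apply: sgnE; rewrite -mulrBl dvdp_mulr.
- rewrite -(sgnN P_ord (fr _)); congr (sgn P _); apply: funext => q.
  by apply: funext => r; rewrite /tform !mulNr -scaleN1r ptrZ mulN1r.
- have [[y1 y2] /= yE] := Bezout_eq1_coprimepP _ _ xf.
  apply: (sgn_transport P_ord (T := *%R x) (T' := *%R y1) (fr (p * c)) _ _).2.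
    by move=> q r; rewrite /tform; congr ptr; ring.
  move=> q r; apply: tform_mod.
  have -> : x * (y1 * q) - q = f * (- y2 * q).
    have -> : x * (y1 * q) = (1 - y2 * f) * q by rewrite -yE; ring.
    ring.
  exact: dvdp_mulr.
- have [[y1 y2] /= yE] := Bezout_eq1_coprimepP _ _ abf.
  have [fr1 s1] := sgn_sum P_ord (fr (d * a * c)) (fr (d * b * c)) (z _) (z _).
  have [_ s2] := sgn_sum P_ord (fr (d * (a + b) * c))
    (fr (d * (a * b * (a + b)) * c)) (z _) (z _).
  rewrite -s1 -s2; symmetry.
  (* This realizes <a + b, ab(a + b)> = <a, b>, because a(x + by)^2 + b(x - ay)^2 = (a + b)x^2 +
     ab(a + b)y^2; [T'] inverts it through the inverse [y1] of [a + b] modulo [f]. *)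
  pose T (y : {poly F} * {poly F}) := (y.1 + b * y.2, y.1 - a * y.2).
  pose T' (y : {poly F} * {poly F}) :=
    (y.1 - b * (y1 * (y.1 - y.2)), y1 * (y.1 - y.2)).
  apply: (sgn_transport P_ord (T := T) (T' := T') fr1 _ _).2 => [y y'|y y'] /=.
    by rewrite /tform -!ptrD; congr ptr; ring.
  congr (_ + _); apply: tform_mod; first by rewrite subrK subrr dvdp0.
  have -> : y.1 - b * (y1 * (y.1 - y.2)) - a * (y1 * (y.1 - y.2)) - y.2 =
      f * (y2 * (y.1 - y.2)).
    have -> : y.1 - b * (y1 * (y.1 - y.2)) - a * (y1 * (y.1 - y.2)) - y.2 =
      (1 - y1 * (a + b)) * (y.1 - y.2) by ring.
    by rewrite -yE; ring.
  exact: dvdp_mulr.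
- have [fr1 <-] := sgn_sum P_ord (fr (u1 * p * c)) (fr (u2 * p * c)) (z _) (z _).
  have [d1 d1E] := dvdpP _ _ u12; have [d2 d2E] := dvdpP _ _ uu.
  have u2E : u2 = d1 * f + 1 - u1 by rewrite -d1E; ring.
  have u1f : f %| u1 * u1 - u1.
    have -> : u1 * u1 - u1 = f * (d1 * u1) - u1 * u2 by rewrite u2E; ring.
    by apply: dvdp_sub; [exact: dvdp_mulIl|exact: uu].
  have u2f : f %| u2 * u2 - u2.
    have -> : u2 * u2 - u2 = u2 * (u1 + u2 - 1) - u1 * u2 by ring.
    by apply: dvdp_sub; [exact: dvdp_mull|exact: uu].
  pose T x := (u1 * x, u2 * x).
  pose T' (y : {poly F} * {poly F}) := u1 * y.1 + u2 * y.2.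
  apply: (sgn_transport P_ord (T := T) (T' := T') fr1 _ _).2 => [y y'|y y'] /=.
    rewrite /tform -!ptrD; apply: ptr_mod.
    have -> : p * c * y * y' - (u1 * p * c * (u1 * y) * (u1 * y') +
        u2 * p * c * (u2 * y) * (u2 * y')) =
      ((u1 * u2) * (3%:R * (u1 + u2)) - (u1 + u2 - 1) * ((u1 + u2) ^+ 2 + (u1 + u2) + 1))
         * (p * c * y * y') by ring.
    by apply/dvdp_mulr/dvdp_sub; apply: dvdp_mulr.
  congr (_ + _); apply: ptr_mod.
    have -> : u1 * p * c * (u1 * (u1 * y.1 + u2 * y.2)) * y'.1 - u1 * p * c * y.1 * y'.1
      = ((u1 * u1 - u1) * (u1 + 1) * y.1 + u1 * u2 * (u1 * y.2)) * (p * c * y'.1) by ring.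
    by apply/dvdp_mulr/dvdp_add; apply: dvdp_mulr => //; apply: dvdp_mulr.
  have -> : u2 * p * c * (u2 * (u1 * y.1 + u2 * y.2)) * y'.2 - u2 * p * c * y.2 * y'.2
      = ((u2 * u2 - u2) * (u2 + 1) * y.2 + u1 * u2 * (u2 * y.1)) * (p * c * y'.2) by ring.
  by apply/dvdp_mulr/dvdp_add; apply: dvdp_mulr => //; apply: dvdp_mulr.
Qed.

Lemma poly_witt_sum (G : zmodType) (I : finType) f (w : I -> {poly F} -> G) :
  (forall i, poly_witt f (w i)) -> poly_witt f (fun u => \sum_i w i u).
Proof.
move=> wW; split=> [p q pq|p|p x xf|d a b abf|u1 u2 p u12 uu].
- by apply: eq_bigr => i _; apply: (poly_witt_mod (wW i)).
- by rewrite -sumrN; apply: eq_bigr => i _; rewrite (poly_wittN (wW i)).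
- by apply: eq_bigr => i _; rewrite (poly_wittX (wW i)).
- by rewrite -!big_split; apply: eq_bigr => i _; apply: (poly_wittD (wW i)).
- by rewrite -!big_split; apply: eq_bigr => i _; apply: (poly_witt_split (wW i)).
Qed.

Lemma sgn_pos (V : Type) (beta : V -> V -> F) a : framed beta -> a != 0 -> P a ->
  sgn P (fun r s => a * beta r s) = sgn P beta.
Proof.
move=> [bS [I [v fv]]] a0 Pa; rewrite (sgn_frame P_ord bS fv).
rewrite (@sgn_frame _ _ P_ord _ _ I v).
- by apply: eq_bigr => i _; rewrite sgPM // (sgP_pos a0 Pa) mul1r.
- by move=> r s; rewrite bS.
have [[vo v0] vE] := fv; split; first split.
- by move=> i j /vo ->; rewrite mulr0.
- by move=> i; rewrite mulf_neq0.
move=> r s; rewrite vE mulr_sumr; apply: eq_bigr => i _.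
by field; rewrite a0 v0.
Qed.

(** A nonzero slot in [P] doubles every signature and the slot 0 leaves it alone, so such a Pfister
    form multiplies [w] by a positive integer. *)
Lemma tform_consistent (I : finType) f (c : I -> {poly F}) (l : seq F) : f != 0 ->
  let w u := \sum_i sgn P (tform f (u * c i)) in
  {in l, forall a, P a} -> w 1 != 0 -> ~ torsl w (map polyC l).
Proof.
move=> f0 w lP w1 tl.
suff [k kE] : exists k, forall b, wpf w b (map polyC l) = w b *+ k.+1.
  by have /eqP := tl 1; rewrite kE mulrn_eq0 (negPf w1).
elim: l lP {tl} => [|a l IHl] lP; first by exists 0%N.
have [|k kE] := IHl; first by move=> x xl; apply: lP; rewrite inE xl orbT.
have Pa := lP a (mem_head _ _).
have [->|a0] := eqVneq a 0.
  exists k => b /=; rewrite !kE mulr0; suff -> : w 0 = 0 by rewrite mul0rn addr0.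
  have wN : w (- 0) = - w 0 := poly_wittN (poly_witt_sum (fun i => tform_witt1 (c i) f0)) 0.
  apply: (@double_eq0 int) => [x m /eqP|]; first by rewrite mulrn_eq0 => /eqP.
  by rewrite oppr0 in wN; rewrite {1}wN addNr.
exists (k.+1 + k)%N => b /=; rewrite !kE -addnS mulrnDr; congr (_ + _ *+ _).
apply: eq_bigr => i _; rewrite -(sgn_pos (tform_framed (b * c i) F2 f0) a0 Pa).
congr (sgn P _); apply: funext => p; apply: funext => q.
by rewrite /tform -ptrZ; congr ptr; rewrite -!mul_polyC; ring.
Qed.

End TraceFormWitt.

(** * Signatures under field extension, and splitting off an ordered root *)

Section BaseChange.
Variables (F M : fieldType) (iota : {rmorphism F -> M}) (P : set F) (Q : set M).
Hypothesis P_ord : is_ordering P.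
Hypothesis Q_ord : is_ordering Q.
Hypothesis PQ : forall x, P x -> Q (iota x).

Lemma sgP_map x : sgP Q (iota x) = sgP P x.
Proof.
have [->|x0] := eqVneq x 0; first by rewrite rmorph0 !sgP0.
have ix0 : iota x != 0 by rewrite fmorph_eq0.
have [Px|Px] := ordering_total P_ord x.
  by rewrite !sgP_pos //; apply: PQ.
by rewrite !sgP_neg // -rmorphN; apply: PQ.
Qed.

Lemma ptr_map f p : ptr (map_poly iota f) (map_poly iota p) = iota (ptr f p).
Proof.
by rewrite /ptr /res deriv_map -rmorphM -map_modp size_map_poly coef_map.
Qed.

Lemma poly_linear_ext (phi psi : {poly M} -> M) :
  (forall a x y, phi (a *: x + y) = a * phi x + phi y) ->
  (forall a x y, psi (a *: x + y) = a * psi x + psi y) ->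
  (forall i, phi 'X^i = psi 'X^i) -> phi =1 psi.
Proof.
move=> phiL psiL phi_psi x.
rewrite -(coefK x) poly_def; elim: (size x) => [|n IHn].
  by rewrite big_ord0 (semilin0 phi (@mul1r M)) // (semilin0 psi (@mul1r M)).
by rewrite big_ord_recr /= addrC phiL psiL phi_psi IHn.
Qed.

(** A frame over F stays one over M: Parseval's identity is bilinear and holds on monomials, which
    are defined over F. *)
Lemma sgn_tform_map f u : f != 0 ->
  sgn Q (tform (map_poly iota f) (map_poly iota u)) = sgn P (tform f u).
Proof.
move=> f0; have [tS [I [v fv]]] := tform_framed u (ordering_char0 P_ord 1) f0.
rewrite (sgn_frame P_ord tS fv).
have mE p q : tform (map_poly iota f) (map_poly iota u) (map_poly iota p)
    (map_poly iota q) = iota (tform f u p q).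
  by rewrite /tform -!rmorphM ptr_map.
rewrite (@sgn_frame _ _ Q_ord _ _ I (fun i => map_poly iota (v i))).
- by apply: eq_bigr => i _; rewrite mE sgP_map.
- exact: tform_sym.
have [[vo v0] vE] := fv; split; first split.
- by move=> i j ij; rewrite mE vo ?rmorph0.
- by move=> i; rewrite mE fmorph_eq0.
set t := tform _ _; have tS' : forall x y, t x y = t y x by exact: tform_sym.
pose d i := t (map_poly iota (v i)) (map_poly iota (v i)).
have tL z a x y : t (a *: x + y) z = a * t x z + t y z by exact: tform_linear.
have sL z a x y : \sum_i t (a *: x + y) (map_poly iota (v i)) * t (map_poly iota (v i)) z / d i =
   a * (\sum_i t x (map_poly iota (v i)) * t (map_poly iota (v i)) z / d i) +
   \sum_i t y (map_poly iota (v i)) * t (map_poly iota (v i)) z / d i.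
  by rewrite mulr_sumr -big_split; apply: eq_bigr => i _; rewrite tL /=; ring.
have symS x y : \sum_i t x (map_poly iota (v i)) * t (map_poly iota (v i)) y / d i =
    \sum_i t y (map_poly iota (v i)) * t (map_poly iota (v i)) x / d i.
  by apply: eq_bigr => i _; rewrite [t x _]tS' [t y _]tS' [t _ x * _]mulrC.
move=> x y; move: x; apply: (poly_linear_ext (tL y) (sL y)) => i.
rewrite tS' symS; move: y; apply: (poly_linear_ext (tL _) (sL _)) => j.
rewrite -!(map_polyXn iota) /d /t mE vE rmorph_sum; apply: eq_bigr => k _.
by rewrite !mE fmorph_div rmorphM.
Qed.

(** By [ptrM] the form is the sum of the rank-one form [u.[al]] on values at [al] and of
    [tform h u]; the two pieces are made orthogonal by vectors vanishing at [al]. *)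
Lemma sgn_tform_root h al u : h \is monic -> h.[al] != 0 ->
  sgn Q (tform (('X - al%:P) * h) u) = sgP Q u.[al] + sgn Q (tform h u).
Proof.
move=> hM hal; have h0 := monic_neq0 hM.
have tE p q : tform (('X - al%:P) * h) u p q =
    u.[al] * p.[al] * q.[al] + tform h u p q.
  by rewrite /tform ptrM ?monicXsubC // ptr_XsubC !hornerM.
have [u0|u0] := eqVneq u.[al] 0.
  rewrite u0 sgP0 add0r; congr (sgn Q _); apply: funext => p; apply: funext => q.
  by rewrite tE u0 !mul0r add0r.
have [tS [I [v fv]]] := tform_framed u (ordering_char0 Q_ord 1) h0.
pose e := h.[al]^-1 *: h.
have ea : e.[al] = 1 by rewrite hornerZ mulVf.
have te q : tform h u e q = 0.
  rewrite /tform ptr_dvd // dvdp_mulr // dvdp_mull // /e.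
  by rewrite -mul_polyC dvdp_mull.
pose v' i := v i - (v i).[al] *: e.
have v'a i : (v' i).[al] = 0 by rewrite /v' hornerD hornerN hornerZ ea mulr1 subrr.
have tv' i q : tform h u (v' i) q = tform h u (v i) q.
  by rewrite /v' addrC -scaleNr tform_linear te mulr0 add0r.
have tv'r i q : tform h u q (v' i) = tform h u q (v i) by rewrite !(tS q) tv'.
pose vv o := if o is Some i then v' i else e.
have [[vo v0] vE] := fv.
have tvv : tform (('X - al%:P) * h) u e e = u.[al] by rewrite tE te ea !mulr1 addr0.
rewrite (@sgn_frame _ _ Q_ord _ _ _ vv).
- rewrite sum_option /= tvv; congr (_ + _).
  rewrite (sgn_frame Q_ord tS fv); apply: eq_bigr => i _.
  by rewrite tE v'a mulr0 add0r tv' tv'r.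
- exact: tform_sym.
split; first split.
- move=> [i|] [j|] // ij; rewrite tE /= ?v'a ?mulr0 ?mul0r ?add0r.
  + by rewrite tv' tv'r vo //; apply: contraNneq ij => ->.
  + by rewrite tform_sym te.
  + by rewrite te.
- by move=> [i|] /=; rewrite ?tvv // tE v'a mulr0 add0r tv' tv'r.
move=> p q; rewrite sum_option /= tvv !tE; congr (_ + _).
  rewrite ea te [tform h u p e]tform_sym te !mulr1 !addr0.
  by field.
rewrite vE; apply: eq_bigr => i _.
by rewrite !tE !v'a !(mulr0, mul0r, add0r) !(tv', tv'r).
Qed.

End BaseChange.

Lemma sgP_prod (F : fieldType) (P : set F) (I : finType) (a : I -> F) (S : {set I}) :
  is_ordering P -> sgP P (\prod_(i in S) a i) = \prod_(i in S) sgP P (a i).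
Proof.
move=> P_ord; exact: (big_morph _ (sgPM P_ord) (sgP1 P_ord)).
Qed.

(** The signature of a Pfister form is the product of those of its factors <1, a>, each of which
    contributes 0, 1 or 2. *)
Lemma sum_prod_sgP_ge0 (F : fieldType) (P : set F) (I : finType) (a : I -> F) :
  is_ordering P -> 0 <= \sum_(S : {set I}) sgP P (\prod_(i in S) a i).
Proof.
move=> P_ord.
have -> : \sum_(S : {set I}) sgP P (\prod_(i in S) a i) =
    \prod_i (sgP P (a i) + 1).
  rewrite bigA_distr; apply: eq_bigr => S _.
  by rewrite sgP_prod // big_mkcond.
apply: prodr_ge0 => i _; have [->|ai] := eqVneq (a i) 0; first by rewrite sgP0.
have [Pa|Pa] := ordering_total P_ord (a i); first by rewrite sgP_pos.
by rewrite sgP_neg.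
Qed.

Lemma tform_root_split (F M : fieldType) (iota : {rmorphism F -> M})
    (P : set F) (Q : set M) (f : {poly F}) (al : M) :
  is_ordering P -> is_ordering Q -> (forall x, P x -> Q (iota x)) ->
  f \is monic -> separable_poly f -> (map_poly iota f).[al] = 0 ->
  exists h : {poly M}, [/\ h \is monic, separable_poly h, (size h < size f)%N &
    forall u, sgn P (tform f u) =
      sgP Q (map_poly iota u).[al] + sgn Q (tform h (map_poly iota u))].
Proof.
move=> P_ord Q_ord PQ fM fS /eqP f0; have /factor_theorem[h fE] := f0.
have hM : h \is monic.
  have : map_poly iota f \is monic by rewrite map_monic.
  by rewrite fE monicMr ?monicXsubC.
have fS' : separable_poly (map_poly iota f) by rewrite separable_map.
exists h; split=> //.
- by apply: dvdp_separable fS'; rewrite fE dvdp_mulr.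
- rewrite -(size_map_poly iota f) fE size_mul ?monic_neq0 ?monicXsubC //.
  by rewrite size_XsubC addnC.
move=> u; rewrite -(sgn_tform_map P_ord Q_ord PQ u (monic_neq0 fM)) fE mulrC.
apply: sgn_tform_root => //.
have := separable_coprime fS'; rewrite fE => /(_ _ _ (dvdpp _)).
by rewrite coprimep_XsubC.
Qed.

(* The sum is the signature of the transfer of a Pfister form, which cannot be
   negative: as long as it is nonzero, an ordered root of [f] can be split off. *)
Lemma sum_sgn_tform_ge0 (F : fieldType) (P : set F) (I : finType)
    (f : {poly F}) (l : I -> {poly F}) :
  is_ordering P -> f \is monic -> separable_poly f ->
  0 <= \sum_(S : {set I}) sgn P (tform f (\prod_(i in S) l i)).
Proof.
have [n] := ubnP (size f); elim: n F P f l => [//|n IHn] F P f l sf P_ord fM fS.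
have f0 := monic_neq0 fM.
pose w u := \sum_(S : {set I}) sgn P (tform f (u * \prod_(i in S) l i)).
have wW : poly_witt f w by apply: poly_witt_sum => S; apply: tform_witt1.
have w1E : w 1 = \sum_(S : {set I}) sgn P (tform f (\prod_(i in S) l i)).
  by apply: eq_bigr => S _; rewrite mul1r.
rewrite -w1E; have [->//|w1] := eqVneq (w 1) 0.
have int_tf (x : int) k : x *+ k.+1 = 0 -> x = 0.
  by move=> /eqP; rewrite mulrn_eq0 => /eqP.
have [g [M [iota [al [Q [Q_ord PQ evE _ [_ gf]]]]]]] :=
  real_factor int_tf fS wW (fun l' l'P => tform_consistent P_ord f0 l'P w1).
have fal : (map_poly iota f).[al] = 0 by apply/eqP; rewrite evE.
have [h [hM hS szh hE]] := tform_root_split P_ord Q_ord PQ fM fS fal.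
rewrite w1E (eq_bigr _ (fun S _ => hE _)) big_split /= addr_ge0 //.
  have := sum_prod_sgP_ge0 (fun i => (map_poly iota (l i)).[al]) Q_ord.
  congr (_ <= _); apply: eq_bigr => S _; congr sgP.
  by rewrite rmorph_prod horner_prod.
have := IHn M Q h (fun i => map_poly iota (l i)); rewrite (leq_trans szh) //.
move=> /(_ isT Q_ord hM hS); congr (_ <= _); apply: eq_bigr => S _.
by rewrite rmorph_prod.
Qed.

(** * Cancellation of stable isometries on two copies, through rational rotations *)

Lemma inj_linear_surj (F : fieldType) (V : vectType F) (f : V -> V) :
  linear f -> (forall x, f x = 0 -> x = 0) -> forall y, exists x, f x = y.
Proof.
move=> fL f0 y; pose fl : {linear V -> V} :=
  HB.pack f (GRing.isLinear.Build F V V *:%R f fL).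
have k0 : lker (linfun fl) == 0%VS.
  apply/lker0P => u v; rewrite !lfunE /= => uv.
  by apply/eqP; rewrite -subr_eq0; apply/eqP/f0; rewrite -[f]/(fl : V -> V) linearB
     /= uv subrr.
exists ((linfun fl)^-1%VF y).
by have := lker0_lfunVK k0 y; rewrite lfunE.
Qed.

(** A nontrivial common factor with [q 0] can be removed from [p], since the later members are
    coprime to [q 0]; the degree drops each time. *)
Lemma coprime_family (F : fieldType) (p : {poly F}) (q : nat -> {poly F}) :
  p != 0 -> (forall n m, n != m -> coprimep (q n) (q m)) ->
  exists n, coprimep p (q n).
Proof.
have [k] := ubnP (size p); elim: k p q => [//|k IHk] p q sp p0 qc.
have [|ncop] := boolP (coprimep p (q 0%N)); first by exists 0%N.
pose g := gcdp p (q 0%N).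
have [p' pE] := dvdpP _ _ (dvdp_gcdl p (q 0%N)).
have /andP[p'0 g0] : (p' != 0) && (g != 0) by rewrite -negb_or -mulf_eq0 -pE.
have [||m mc] := IHk p' (fun n => q n.+1) _ p'0.
- have g1 : (1 < size g)%N.
    by rewrite ltn_neqAle eq_sym ncop size_poly_gt0.
  move: sp; rewrite pE size_mul //.
  by move: (size p') (size g) g1 => a b; lia.
- by move=> n m nm; apply: qc.
exists m.+1; rewrite pE coprimepMl mc /=.
by apply: coprimep_dvdr (dvdp_gcdr _ _) (qc _ _ _).
Qed.

Import VectorInternalTheory.

Section Rotations.
Variable F : fieldType.
Hypothesis char0 : forall n, n.+1%:R != 0 :> F.

Let den n : F := (n ^ 2).+1%:R.
(** Rational parametrization of the unit circle at integral parameters, where the denominators n^2 +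
    1 do not vanish in characteristic 0. *)
Definition rcos n : F := (1 - n%:R ^+ 2) / den n.
Definition rsin n : F := 2%:R * n%:R / den n.

Let denE n : den n = n%:R ^+ 2 + 1.
Proof. by rewrite /den -addn1 natrD natrX. Qed.

Lemma rcos_rsin n : rcos n ^+ 2 + rsin n ^+ 2 = 1.
Proof.
have d0 : n%:R ^+ 2 + 1 != 0 :> F by rewrite -denE char0.
by rewrite /rcos /rsin denE; field.
Qed.

Lemma natr_inj_char0 : injective (fun n => n%:R : F).
Proof.
suff h n m : (n <= m)%N -> n%:R = m%:R :> F -> n = m.
  move=> n m nm; have [/h|/ltnW/h h'] := leqP n m; first exact.
  by apply/esym/h'.
move=> nm e; have /eqP : (m - n)%:R = 0 :> F by rewrite natrB // e subrr.
case mn : (m - n)%N => [|k]; last by rewrite (negPf (char0 _)).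
by move=> _; apply/eqP; rewrite eqn_leq nm -subn_eq0 mn.
Qed.

Lemma rcos_inj : injective rcos.
Proof.
move=> n m /eqP; rewrite /rcos eqr_div ?char0 // !denE => /eqP e.
have /eqP : 2%:R * (n%:R ^+ 2 - m%:R ^+ 2) = 0 :> F.
  have -> : 2%:R * (n%:R ^+ 2 - m%:R ^+ 2) = (1 - m%:R ^+ 2) * (n%:R ^+ 2 + 1)
      - (1 - n%:R ^+ 2) * (m%:R ^+ 2 + 1) :> F by ring.
  by rewrite e subrr.
rewrite mulf_eq0 (negPf (char0 1)) /= subr_eq0 -!natrX => /eqP/natr_inj_char0.
by move=> /eqP; rewrite eqn_exp2r // => /eqP.
Qed.

(* X^2 - 2 cos(t) X + 1 for infinitely many t with rational cosine and sine: one
   of them is coprime to a given characteristic polynomial. *)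
Definition rpoly n : {poly F} := 'X^2 - (2%:R * rcos n) *: 'X + 1.

Lemma rpoly_coprime n m : n != m -> coprimep (rpoly n) (rpoly m).
Proof.
move=> nm; pose c := 2%:R * (rcos m - rcos n).
have c0 : c != 0.
  by rewrite mulf_neq0 ?(char0 1) // subr_eq0 (inj_eq rcos_inj) eq_sym.
have -> : rpoly n = 1 * rpoly m + c *: 'X.
  by rewrite /rpoly /c -!mul_polyC !(polyCM, polyCB); ring.
rewrite coprimep_sym coprimep_addl_mul coprimepZr // coprimep_sym.
have -> : rpoly m = ('X - (2%:R * rcos m)%:P) * 'X + 1.
  by rewrite /rpoly -mul_polyC; ring.
by rewrite coprimep_addl_mul coprimep1.
Qed.

(** A polynomial coprime to the characteristic polynomial of [s] takes an invertible value at [s],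
    by Bezout and Cayley-Hamilton. *)
Lemma rpoly_inj (V : vectType F) (s : V -> V) : linear s ->
  exists n, forall x, s (s x) - (2%:R * rcos n) *: s x + x = 0 -> x = 0.
Proof.
move=> sL; pose sl : {linear V -> V} :=
  HB.pack s (GRing.isLinear.Build F V V *:%R s sL).
pose S := lin1_mx (v2r \o sl \o r2v).
have SE x : v2r (s x) = v2r x *m S by rewrite mul_rV_lin1 /= v2rK.
suff [n nP] : exists n, forall x : 'rV[F]_(dim V),
    x *m S *m S - (2%:R * rcos n) *: (x *m S) + x = 0 -> x = 0.
  exists n => x x0; apply: (can_inj v2rK); rewrite linear0; apply: nP.
  by rewrite -!SE -linearZ -linearB -linearD x0 linear0.
move: (dim V) S {SE} => [|m] S; first by exists 0%N => x _; apply: thinmx0.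
have [n /Bezout_eq1_coprimepP[[u v] /= uv]] :=
  coprime_family (monic_neq0 (char_poly_monic S)) rpoly_coprime.
exists n => x x0.
have : x *m horner_mx S 1 = x by rewrite rmorph1 mulmx1.
rewrite -uv rmorphD !rmorphM /= Cayley_Hamilton mulr0 add0r.
have comm : horner_mx S v * horner_mx S (rpoly n) =
    horner_mx S (rpoly n) * horner_mx S v by rewrite -!rmorphM mulrC.
rewrite comm -mulmxE mulmxA.
have -> : x *m horner_mx S (rpoly n) = 0.
  rewrite -[RHS]x0 /rpoly rmorphD rmorphB rmorph1 /= linearZ /= rmorphXn /=.
  rewrite horner_mx_X expr2 -mulmxE mulmxDr mulmx1 mulmxBr mulmxA.
  by rewrite -scalemxAr.
by rewrite mul0mx.
Qed.

End Rotations.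

Ltac vector_ring :=
  apply: (can_inj v2rK); apply/rowP => ?;
  rewrite !(linearD, linearN, linearZ, linear0) /= !mxE; ring.

Section Cancellation.
Variables (F : fieldType) (A : falgType F) (sigma : A -> A).
Hypothesis sigmaL : linear sigma.
Hypothesis sigmaM : forall x y, sigma (x * y) = sigma y * sigma x.
Hypothesis sigma1 : sigma 1 = 1.
Hypothesis char0 : forall n, n.+1%:R != 0 :> F.

Let sigmaD : {morph sigma : x y / x + y}.
Proof. exact: (semilinD sigma (@scale1r _ _) sigmaL). Qed.

Let sigma0 : sigma 0 = 0.
Proof. exact: sigma_add0. Qed.

Let sigmaZ a x : sigma (a *: x) = a *: sigma x.
Proof. exact: (semilinZ sigma (@scale1r _ _) sigmaL). Qed.

Definition sumfam (T : Type) (I J : Type) (c : I -> T) (d : J -> T) (k : I + J) : T :=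
  match k with inl i => c i | inr j => d j end.

Lemma embl_sumfam (c d z : seq A) : embl sigma (c ++ z) (d ++ z) ->
  emb sigma (sumfam (fun i : 'I_(size c) => c`_i) (fun i : 'I_(size z) => z`_i))
            (sumfam (fun i : 'I_(size d) => d`_i) (fun i : 'I_(size z) => z`_i)).
Proof.
pose g (s t : seq A) (k : 'I_(size s) + 'I_(size t)) : 'I_(size (s ++ t)) :=
  cast_ord (esym (size_cat s t)) (unsplit k).
pose g' (s t : seq A) (k : 'I_(size (s ++ t))) : 'I_(size s) + 'I_(size t) :=
  split (cast_ord (size_cat s t) k).
have gK s t : cancel (@g s t) (@g' s t).
  by move=> k; rewrite /g /g' cast_ordKV unsplitK.
have g'K s t : cancel (@g' s t) (@g s t).
  by move=> k; rewrite /g /g' splitK cast_ordK.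
have gE s t k : (s ++ t)`_(@g s t k) =
    sumfam (fun i : 'I_(size s) => s`_i) (fun i : 'I_(size t) => t`_i) k.
  case: k => i; rewrite /g /= nth_cat /=; first by rewrite ltn_ord.
  by rewrite ltnNge leq_addr /= addKn.
move=> cd; apply: (@emb_trans _ _ _ _ _ _ (fun i : 'I_(size (c ++ z)) => (c ++ z)`_i)).
  by apply: (@emb_reindex _ _ _ _ _ _ (@g c z)) => [|k]; [exists (@g' c z)|rewrite gE].
apply: emb_trans cd _.
by apply: (@emb_reindex _ _ _ _ _ _ (@g' d z)) => [|k]; [exists (@g d z)|rewrite -gE g'K].
Qed.

Lemma herm_sumfam (I J : finType) (c : I -> A) (d : J -> A) x y :
  herm sigma (sumfam c d) x y =
  herm sigma c (x \o inl) (y \o inl) + herm sigma d (x \o inr) (y \o inr).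
Proof. by rewrite /herm big_sumType. Qed.

(* The vector [x = (v, t)] is completed so that the [z]-part of [f x] is carried
   back to [t] by a rotation of the two copies, which preserves the form on [z];
   what is left is an isometry between the complements of [z]. *)
Lemma emb_cancel (I J Z : finType) (c : I -> A) (d : J -> A) (z : Z -> A) :
  emb sigma (sumfam c z) (sumfam d z) ->
  exists u : J * bool -> I * bool -> A, forall p q,
    \sum_k sigma (u k p) * d k.1 * u k q = c p.1 *+ (p == q).
Proof.
move=> [f [fD fZ fh]].
pose V := {ffun Z -> A}.
pose mk (v : I -> A) (t : V) := sumfam v t.
pose s (t : V) : V := [ffun j => f (mk (fun=> 0) t) (inr j)].
pose r (v : I -> A) : V := [ffun j => f (mk v 0) (inr j)].
have mkD v1 t1 v2 t2 : mk (fun i => v1 i + v2 i) (t1 + t2) =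
    (fun k => mk v1 t1 k + mk v2 t2 k).
  by apply: funext => -[i|j] //=; rewrite ffunE.
have sL : linear s.
  move=> a t1 t2; apply/ffunP => j; rewrite !ffunE.
  have -> : mk (fun=> 0) (a *: t1 + t2) =
    (fun k => mk (fun=> 0) t1 k * a%:A + mk (fun=> 0) t2 k).
    apply: funext => -[i|j'] /=; first by rewrite mul0r addr0.
    by rewrite !ffunE mulr_algr.
  by rewrite fD fZ mulr_algr.
have fmk v t j : f (mk v t) (inr j) = (r v + s t) j.
  rewrite !ffunE -[in LHS](add0r t).
  have -> : mk v (0 + t) = (fun k => mk v 0 k + mk (fun=> 0) t k).
    by rewrite -mkD; congr mk; apply: funext => i; rewrite addr0.
  by rewrite fD.
have [n nP] := rpoly_inj char0 sL.
set al := rcos F n in nP; pose be := rsin F n.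
have ab1 : al ^+ 2 + be ^+ 2 = 1 by apply: rcos_rsin.
have s_add := semilinD s (@scale1r _ _) sL.
have s_scale := semilinZ s (@scale1r _ _) sL.
(* [L] is the identity minus the rotation composed with [s]; the completion [t] of [v] solves [L t]
   = rotated [r v], that is, [t] is the rotated z-part of the image. *)
pose L (t : V * V) : V * V := (t.1 + (- al) *: s t.1 + be *: s t.2,
                               t.2 + (- be) *: s t.1 + (- al) *: s t.2).
have LL : linear L.
  have comb (x y a : F) (t t1 t2 t' t1' t2' : V) :
      a *: t + t' + x *: (a *: t1 + t1') + y *: (a *: t2 + t2') =
      a *: (t + x *: t1 + y *: t2) + (t' + x *: t1' + y *: t2').
    by vector_ring.
  by move=> a [t1 t2] [t1' t2']; rewrite /L /= !s_add !s_scale !comb.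
have rot (x y : V) : al *: (al *: x - be *: y) + be *: (be *: x + al *: y) = x.
  rewrite -[RHS]scale1r -ab1; vector_ring.
have rot' (x y : V) : al *: (be *: x + al *: y) - be *: (al *: x - be *: y) = y.
  rewrite -[RHS]scale1r -ab1; vector_ring.
(* If [t] is the rotation of [s t], the rotation polynomial X^2 - 2 [al] X + 1 at [s] kills both
   components, which the choice of [n] forbids. *)
have L0 t : L t = 0 -> t = 0.
  case: t => t1 t2 [] /= l1 l2.
  have e1 : t1 = al *: s t1 - be *: s t2.
    by rewrite -[LHS]subr0 -l1; vector_ring.
  have e2 : t2 = be *: s t1 + al *: s t2.
    by rewrite -[LHS]subr0 -l2; vector_ring.
  have f1 : s t1 = al *: s (s t1) - be *: s (s t2).
    by rewrite {1}e1 s_add -scaleNr !s_scale scaleNr.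
  have f2 : s t2 = be *: s (s t1) + al *: s (s t2).
    by rewrite {1}e2 s_add !s_scale.
  have k1 := rot (s (s t1)) (s (s t2)); rewrite -f1 -f2 in k1.
  have k2 := rot' (s (s t1)) (s (s t2)); rewrite -f1 -f2 in k2.
  have t10 : t1 = 0.
    by apply: nP; rewrite -k1 {3}e1; vector_ring.
  have t20 : t2 = 0.
    by apply: nP; rewrite -k2 {3}e2; vector_ring.
  by rewrite t10 t20.
have [q qL] : exists q : (I -> A) * (I -> A) -> V * V, forall v,
    L (q v) = (al *: r v.1 - be *: r v.2, be *: r v.1 + al *: r v.2).
  exists (fun v => sval (cid (inj_linear_surj LL L0
    (al *: r v.1 - be *: r v.2, be *: r v.1 + al *: r v.2)))) => v.
  by case: cid.
pose y1 v := r v.1 + s (q v).1; pose y2 v := r v.2 + s (q v).2.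
have q1 v : (q v).1 = al *: y1 v - be *: y2 v.
  have := congr1 fst (qL v); rewrite /= => e.
  apply: (addIr (- al *: s (q v).1 + be *: s (q v).2)).
  by rewrite addrA e /y1 /y2; vector_ring.
have q2 v : (q v).2 = be *: y1 v + al *: y2 v.
  have := congr1 snd (qL v); rewrite /= => e.
  apply: (addIr (- be *: s (q v).1 + - al *: s (q v).2)).
  by rewrite addrA e /y1 /y2; vector_ring.
have hz v w : herm sigma z (q v).1 (q w).1 + herm sigma z (q v).2 (q w).2 =
    herm sigma z (y1 v) (y1 w) + herm sigma z (y2 v) (y2 w).
  have ffD (x y : F) (t t' : V) j : (x *: t + y *: t') j = x *: t j + y *: t' j.
    by rewrite !ffunE.
  rewrite /herm -!big_split; apply: eq_bigr => j _ /=.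
  rewrite !q1 !q2 -!scaleNr !ffD !sigmaD !sigmaZ.
  move: (y1 v j) (y2 v j) (y1 w j) (y2 w j) => a1 a2 b1 b2.
  rewrite !(mulrDl, mulrDr) -!scalerAl -!scalerAr.
  rewrite -[RHS]scale1r -ab1.
  have vring (w1 w2 w3 w4 : A) :
    al *: (al *: w1) + - be *: (al *: w2) + (al *: (- be *: w3) + - be *: (- be *: w4)) +
    (be *: (be *: w1) + al *: (be *: w2) + (be *: (al *: w3) + al *: (al *: w4)))
      = (al ^+ 2 + be ^+ 2) *: (w1 + w4) by vector_ring.
  by rewrite vring.
pose e (p : I * bool) : (I -> A) * (I -> A) :=
  ((fun i => ((i == p.1) && p.2)%:R), (fun i => ((i == p.1) && ~~ p.2)%:R)).
pose x1 p := mk (e p).1 (q (e p)).1; pose x2 p := mk (e p).2 (q (e p)).2.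
exists (fun k p => if k.2 then f (x1 p) (inl k.1) else f (x2 p) (inl k.1)).
move=> p p'.
have splitE (g : J * bool -> A) :
    \sum_k g k = \sum_j g (j, true) + \sum_j g (j, false).
  rewrite -big_split /= (eq_bigr (fun k => g (k.1, k.2))); last by case.
  rewrite -(pair_bigA _ (fun j b => g (j, b))) /=; apply: eq_bigr => j _.
  by rewrite big_bool.
rewrite splitE /=.
have x1E v w := fh (mk (v.1) (q v).1) (mk w.1 (q w).1).
have x2E v w := fh (mk (v.2) (q v).2) (mk w.2 (q w).2).
have := congr2 +%R (x1E (e p) (e p')) (x2E (e p) (e p')).
rewrite !herm_sumfam.
have yE v t : f (mk v t) \o inr = (r v + s t : V) by apply: funext => j; rewrite /= fmk.
have mkr v t : mk v t \o inr = (t : Z -> A) by apply: funext.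
have mkl v t : mk v t \o inl = v by apply: funext.
rewrite !yE !mkr !mkl addrACA -/(y1 (e p)) -/(y1 (e p')) -/(y2 (e p)) -/(y2 (e p')).
rewrite [in RHS]addrACA hz => /addIr; rewrite /x1 /x2 /herm /= => ->.
have hE (x y : bool) : \sum_i sigma ((i == p.1) && x)%:R * c i * ((i == p'.1) && y)%:R =
    c p.1 *+ [&& p.1 == p'.1, x & y].
  rewrite (bigD1 p.1) //= eqxx big1 => [|i /negPf->]; last by rewrite sigma0 !mul0r.
  by case: x; rewrite ?sigma1 ?sigma0 ?mul1r ?mul0r ?addr0 ?andbF //=; rewrite mulr_natr.
rewrite !hE -mulrnDr; congr (_ *+ _).
rewrite -[p == p']/((p.1 == p'.1) && (p.2 == p'.2)).
by case: (p.1 == p'.1); case: p.2; case: p'.2.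
Qed.

End Cancellation.

(** * Weak hyperbolicity in terms of matrices u over the algebra with u^* u = -1 *)

Section WeaklyHyperbolic.
Variables (F : fieldType) (B : algType F) (sigma : B -> B).
Hypothesis sigmaL : linear sigma.
Hypothesis sigmaM : forall x y, sigma (x * y) = sigma y * sigma x.
Hypothesis sigma1 : sigma 1 = 1.
Hypothesis F2 : 2%:R != 0 :> F.

Let sD : {morph sigma : x y / x + y}.
Proof. exact: (semilinD sigma (@scale1r _ _) sigmaL). Qed.

Let sigma0 : sigma 0 = 0.
Proof. exact: (semilin0 sigma (@scale1r _ _) sigmaL). Qed.

Let sigmaZ a x : sigma (a *: x) = a *: sigma x.
Proof. exact: (semilinZ sigma (@scale1r _ _) sigmaL). Qed.

Section Size.
Variable n : nat.
Local Notation T := (tensor (idfun : F -> F) 'M[F]_n.+1 B).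

Definition of_entries (X : 'I_n.+1 -> 'I_n.+1 -> B) : T :=
  \sum_i \sum_j tens (idfun : F -> F) (delta_mx i j : 'M[F]_n.+1) (X i j).

Lemma of_entriesM X Y : of_entries X * of_entries Y =
  of_entries (fun i j => \sum_k X i k * Y k j).
Proof.
rewrite /of_entries mulr_suml; apply: eq_bigr => i _.
under [RHS]eq_bigr => j _ do rewrite tens_sumr.
rewrite [RHS]exchange_big mulr_suml; apply: eq_bigr => k _ /=.
rewrite mulr_sumr (bigD1 k) //= [X in _ + X]big1 => [|k' k'k].
  rewrite addr0 mulr_sumr; apply: eq_bigr => j _.
  by rewrite tensM -mulmxE mul_delta_mx.
rewrite mulr_sumr big1 // => j _.
by rewrite tensM -mulmxE mul_delta_mx_cond eq_sym (negPf k'k) mulr0n tens0l.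
Qed.

Lemma of_entries1 : of_entries (fun i j => (i == j)%:R) = 1.
Proof.
rewrite -tens1 -[1 in RHS]/(1%:M) scalar_mx_sum_delta tens_suml.
apply: eq_bigr => i _; rewrite scale1r (bigD1 i) //= eqxx big1 ?addr0 // => j ji.
by rewrite eq_sym (negPf ji) tens0r.
Qed.

Lemma tensor_mapD (x y : T) : tensor_map idfun trmx sigma (x + y) =
  tensor_map idfun trmx sigma x + tensor_map idfun trmx sigma y.
Proof.
rewrite /tensor_map -big_split; apply: eq_bigr => i _ /=.
by rewrite ffunE sD tensDr.
Qed.

Lemma trmxL : linear (trmx : 'M[F]_n.+1 -> 'M[F]_n.+1).
Proof. by move=> a x y; rewrite linearP. Qed.

Lemma tensor_map_sum (I : Type) (r : seq I) (P : pred I) (f : I -> T) :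
  tensor_map idfun trmx sigma (\sum_(i <- r | P i) f i) =
  \sum_(i <- r | P i) tensor_map idfun trmx sigma (f i).
Proof.
apply: (big_morph _ tensor_mapD); apply: (addrI (tensor_map idfun trmx sigma 0)).
by rewrite -tensor_mapD !addr0.
Qed.

Lemma of_entries_map X : tensor_map idfun trmx sigma (of_entries X) =
  of_entries (fun i j => sigma (X j i)).
Proof.
rewrite /of_entries tensor_map_sum [RHS]exchange_big; apply: eq_bigr => i _ /=.
rewrite tensor_map_sum; apply: eq_bigr => j _.
by rewrite tensor_map_tens ?trmx_delta //; apply: trmxL.
Qed.

(** [entry] reads a matrix over [B] off a tensor and serves to exploit weak hyperbolicity;
    [of_entries] goes the other way and serves to establish it. *)
Definition entry (x : T) i j : B :=
  tens_lift (fun (m : 'M[F]_n.+1) (b : B) => m i j *: b) x.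

Lemma entryD x y i j : entry (x + y) i j = entry x i j + entry y i j.
Proof. by apply: tens_liftD => m b b'; rewrite scalerDr. Qed.

Lemma entry_tens (m : 'M[F]_n.+1) (b : B) i j :
  entry (tens idfun m b) i j = m i j *: b.
Proof.
apply: (tens_liftE (f := fun (m : 'M[F]_n.+1) b => m i j *: b)) => [m1 m2 b'|c m' b'].
  by rewrite mxE scalerDl.
by rewrite mxE scalerA mulrC.
Qed.

Lemma entryM x y i j : entry (x * y) i j = \sum_k entry x i k * entry y k j.
Proof.
pose g y x := entry (x * y) i j; pose h y x := \sum_k entry x i k * entry y k j.
apply: (@tens_ext _ _ _ _ _ _ (g y) (h y)) => [u v|u v|a b].
- by rewrite /g mulrDl entryD.
- by rewrite /h -big_split; apply: eq_bigr => k _; rewrite entryD mulrDl.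
pose x' := tens (idfun : F -> F) a b.
apply: (@tens_ext _ _ _ _ _ _ (fun y => g y x') (fun y => h y x')) => [u v|u v|a' b'].
- by rewrite /g mulrDr entryD.
- by rewrite /h -big_split; apply: eq_bigr => k _; rewrite entryD mulrDr.
rewrite /g /h /x' tensM entry_tens mxE scaler_suml; apply: eq_bigr => k _.
by rewrite !entry_tens -scalerAl -scalerAr scalerA.
Qed.

Lemma entry1 i j : entry 1 i j = (i == j)%:R.
Proof. by rewrite -tens1 entry_tens mxE; case: (i == j); rewrite ?scale1r ?scale0r. Qed.

Lemma entry_map x i j :
  entry (tensor_map idfun trmx sigma x) i j = sigma (entry x j i).
Proof.
pose g x := entry (tensor_map idfun trmx sigma x) i j.
pose h x := sigma (entry x j i).
apply: (@tens_ext _ _ _ _ _ _ g h) => [u v|u v|a b]; rewrite /g /h.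
- by rewrite tensor_mapD entryD.
- by rewrite entryD sD.
by rewrite tensor_map_tens ?entry_tens ?mxE ?sigmaZ //; apply: trmxL.
Qed.

End Size.

(** For the given idempotent [e], the element v = 2e - 1 satisfies v^2 = 1 and is negated by the
    involution, so the product of its adjoint with v is -1. *)
Lemma weakly_hyperbolic_skew : weakly_hyperbolic sigma ->
  exists (n : nat) (u : 'I_n.+1 -> 'I_n.+1 -> B),
    forall i j, \sum_k sigma (u k i) * u k j = - (i == j)%:R.
Proof.
move=> [n [e [e2 es]]]; exists n.
pose v := e + e - 1; exists (entry v) => i j.
have v2 : v * v = 1.
  have ee : e * e = e by rewrite -expr2.
  have : (v + 1) * (v + 1) = v + 1 + (v + 1) by rewrite subrK mulrDl mulrDr ee.
  rewrite mulrDl mulrDr mulr1 mul1r => /addIr.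
  by rewrite [v + 1]addrC => /addIr.
have sT1 : tensor_map idfun trmx sigma 1 = 1 :> tensor idfun 'M[F]_n.+1 B.
  by rewrite -[1]tens1 tensor_map_tens ?sigma1 ?trmx1 //; apply: trmxL.
have vs : tensor_map idfun trmx sigma v = - v.
  have vE : v + 1 = e + e by rewrite subrK.
  have := tensor_mapD v 1; rewrite vE tensor_mapD es sT1 => h.
  apply: (addIr 1); rewrite -h /v opprB opprD.
  by rewrite addrACA [RHS]addrAC.
rewrite -[LHS]opprK -sumrN; congr (- _).
rewrite -(entry1 i j) -v2 entryM; apply: eq_bigr => k _.
rewrite -entry_map vs -mulNr; congr (_ * _).
have entryN x : entry (- x) i k = - entry x i k.
  apply: (addIr (entry x i k)); rewrite -entryD !addNr.
  by apply: (addrI (entry x i k)); rewrite -entryD !addr0.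
by rewrite entryN opprK.
Qed.

(** [u] need not be skew, but the block matrix [V] with blocks u and -u^* off the diagonal is skew
    and squares to 1; the idempotent is (1 + V)/2. *)
Lemma skew_weakly_hyperbolic (N : finType) (u : N -> N -> B) (x0 : N) :
  (forall x y, \sum_k sigma (u k x) * u k y = - (x == y)%:R) ->
  (forall x y, \sum_k u x k * sigma (u y k) = - (x == y)%:R) ->
  involutive sigma ->
  weakly_hyperbolic sigma.
Proof.
move=> uu uu' sK.
have [n nE] : exists n, #|{: N + N}| = n.+1.
  by exists #|{: N + N}|.-1; rewrite prednK //; apply/card_gt0P; exists (inl x0).
pose g (x : N + N) : 'I_n.+1 := cast_ord nE (enum_rank x).
pose g' (i : 'I_n.+1) : N + N := enum_val (cast_ord (esym nE) i).
have gK : cancel g g' by move=> x; rewrite /g /g' cast_ordK enum_rankK.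
have g'K : cancel g' g by move=> x; rewrite /g /g' enum_valK cast_ordKV.
pose V (x y : N + N) : B := match x, y with
  | inl a, inr b => u a b | inr a, inl b => - sigma (u b a) | _, _ => 0 end.
pose X i j : B := V (g' i) (g' j).
have VV x y : \sum_k V x k * V k y = (x == y)%:R.
  rewrite big_sumType; case: x y => [a|a] [b|b] /=.
  - rewrite big1 ?add0r => [|k _]; last by rewrite mul0r.
    by under eq_bigr => k _ do rewrite mulrN; rewrite sumrN uu' opprK.
  - by rewrite !big1 ?addr0 // => k _; rewrite ?mulr0 ?mul0r.
  - by rewrite !big1 ?addr0 // => k _; rewrite ?mulr0 ?mul0r.
  - rewrite addrC big1 ?add0r => [|k _]; last by rewrite mul0r.
    by under eq_bigr => k _ do rewrite mulNr; rewrite sumrN uu opprK.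
have sN x : sigma (- x) = - sigma x by rewrite -scaleN1r sigmaZ scaleN1r.
have Vs x y : sigma (V y x) = - V x y.
  by case: x y => [a|a] [b|b] /=; rewrite ?sigma0 ?oppr0 ?sN ?sK ?opprK.
pose v := of_entries X.
have vv : v * v = 1.
  rewrite of_entriesM -of_entries1; congr of_entries.
  apply: funext => i; apply: funext => j.
  rewrite (reindex g) /=; last by exists g' => k _.
  rewrite /X; under eq_bigr => k _ do rewrite gK.
  by rewrite VV (can_eq g'K).
have vs : tensor_map idfun trmx sigma v = - v.
  rewrite of_entries_map /v /of_entries -sumrN; apply: eq_bigr => i _.
  rewrite -sumrN; apply: eq_bigr => j _; rewrite /X Vs.
  by rewrite -scaleN1r tensZr scaleN1r.
exists n, (2%:R^-1 *: (1 + v)); split.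
  rewrite expr2 -scalerAl -scalerAr scalerA mulrDl mul1r mulrDr mulr1 vv.
  rewrite [v + 1]addrC -mulr2n -scaler_nat scalerA; congr (_ *: _).
  by field.
have sT1 : tensor_map idfun trmx sigma 1 = 1 :> tensor idfun 'M[F]_n.+1 B.
  by rewrite -[1]tens1 tensor_map_tens ?sigma1 ?trmx1 //; apply: trmxL.
have sZ (a : F) (x : tensor idfun 'M[F]_n.+1 B) :
    tensor_map idfun trmx sigma (a *: x) = a *: tensor_map idfun trmx sigma x.
  rewrite /tensor_map scaler_sumr; apply: eq_bigr => i _.
  by rewrite ffunE sigmaZ tensZr.
rewrite sZ tensor_mapD sT1 vs; apply: (addrI (2%:R^-1 *: (1 + v))).
rewrite [RHS]addrC subrK -scalerDr addrACA subrr addr0 -mulr2n -scaler_nat scalerA.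
by rewrite mulVf // scale1r.
Qed.

End WeaklyHyperbolic.

(** Cancellation of the tail yields a square matrix U with U^* U = -1, and finite dimension gives U
    U^* = -1 as well. *)
Lemma neutral1_weakly_hyperbolic (F : fieldType) (A : falgType F)
    (sigma : A -> A) :
  first_kind_involution sigma -> (forall n, n.+1%:R != 0 :> F) ->
  neutral sigma [:: 1] -> weakly_hyperbolic sigma.
Proof.
move=> [sL sM sK] char0 [k [z kz]].
have s1 : sigma 1 = 1 by rewrite -[LHS]mul1r -{1}[1]sK -sM mul1r sK.
have kz' : embl sigma (mulc k.+1 [:: 1] ++ z) (mulc k.+1 [:: -1] ++ z) := kz.
have /(emb_cancel sL s1 char0)[u uE] := embl_sumfam kz'.
pose I := 'I_(size (mulc k.+1 [:: 1 : A])); pose J := 'I_(size (mulc k.+1 [:: -1 : A])).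
have c1 (i : I) : (mulc k.+1 [:: 1 : A])`_i = 1.
  have : (mulc k.+1 [:: 1 : A])`_i \in mulc k.+1 [:: 1 : A] by rewrite mem_nth.
  by move=> /flattenP[s]; rewrite mem_nseq => /andP[_ /eqP->]; rewrite inE => /eqP.
have d1 (i : J) : (mulc k.+1 [:: -1 : A])`_i = -1.
  have : (mulc k.+1 [:: -1 : A])`_i \in mulc k.+1 [:: -1 : A] by rewrite mem_nth.
  by move=> /flattenP[s]; rewrite mem_nseq => /andP[_ /eqP->]; rewrite inE => /eqP.
have IJ : size (mulc k.+1 [:: 1 : A]) = size (mulc k.+1 [:: -1 : A]).
  by rewrite !size_flatten /shape !map_nseq.
pose N := (I * bool)%type.
pose h (x : N) : J * bool := (cast_ord IJ x.1, x.2).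
have hb : bijective h.
  exists (fun y : J * bool => (cast_ord (esym IJ) y.1, y.2)).
    by case=> x b; rewrite /h /= cast_ordK.
  by case=> x b; rewrite /h /= cast_ordKV.
pose U (x y : N) := u (h x) y.
have UU x y : \sum_k sigma (U k x) * U k y = - (x == y)%:R.
  have := uE x y; rewrite c1 (reindex h); last exact: onW_bij.
  under eq_bigr => j _ do rewrite d1 mulrN1 mulNr.
  by rewrite sumrN => /eqP; rewrite eqr_oppLR => /eqP.
pose V := {ffun N -> A}.
(* [U] acts injectively on columns over A, hence surjectively; preimages of the unit columns form a
   right inverse, which must be the negated adjoint. *)
pose f (x : V) : V := [ffun i => \sum_j U i j * x j].
have fL : linear f.
  move=> a x y; apply/ffunP => i; rewrite !ffunE scaler_sumr -big_split.
  by apply: eq_bigr => j _; rewrite !ffunE mulrDr scalerAr.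
have Uf (x : V) i : \sum_k sigma (U k i) * f x k = - x i.
  under eq_bigr => j _ do rewrite ffunE mulr_sumr.
  rewrite exchange_big (bigD1 i) //= [X in _ + X]big1 => [|j ji].
    under eq_bigr => j _ do rewrite mulrA.
    by rewrite -mulr_suml UU eqxx mulN1r addr0.
  under eq_bigr => l _ do rewrite mulrA.
  by rewrite -mulr_suml UU eq_sym (negPf ji) oppr0 mul0r.
have f0 x : f x = 0 -> x = 0.
  move=> fx; apply/ffunP => i; rewrite -[LHS]opprK -Uf fx ffunE big1 ?oppr0 //.
  by move=> j _; rewrite ffunE mulr0.
have x0 : N.
  have k0 : (0 < size (mulc k.+1 [:: 1%R : A]))%N by rewrite size_flatten /shape map_nseq.
  exact: (Ordinal k0, true).
apply: (skew_weakly_hyperbolic sL s1 _ x0 UU _ sK) => [|x y]; first exact: (char0 1%N).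
have [t tE] := inj_linear_surj fL f0 [ffun i => (i == y)%:R].
have tU i : t i = - sigma (U y i).
  rewrite -[LHS]opprK -Uf tE (bigD1 y) //= big1 => [|j jy].
    by rewrite ffunE eqxx mulr1 addr0.
  by rewrite ffunE (negPf jy) mulr0.
have /ffunP/(_ x) := tE; rewrite !ffunE => <-; rewrite -sumrN.
by apply: eq_bigr => i _; rewrite tU mulrN opprK.
Qed.

(** * An invariant trace on A and its Casimir element *)

Section Trace.
Variables (F : fieldType) (A : falgType F) (sigma : A -> A).
Hypothesis char0 : forall n, n.+1%:R != 0 :> F.
Hypothesis A_csa : central_simple A.
Hypothesis sigma_inv : first_kind_involution sigma.

Let sL : linear sigma := involution_linear sigma_inv.
Let sM := involution_mul sigma_inv.
Let sK := involution_invol sigma_inv.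

Local Notation e := (vbasis {:A}).
Local Notation co := (coord (vbasis {:A})).

(** The trace of left multiplication by [x]. *)
Definition trl (x : A) : F := \sum_i co i (x * e`_i).

Lemma trlL a x y : trl (a *: x + y) = a * trl x + trl y.
Proof.
rewrite /trl mulr_sumr -big_split; apply: eq_bigr => i _ /=.
by rewrite mulrDl -scalerAl linearP.
Qed.

Lemma coE x : x = \sum_i co i x *: e`_i.
Proof. exact: coord_vbasis (memvf x). Qed.

Lemma trlC x y : trl (x * y) = trl (y * x).
Proof.
have trE a b : trl (a * b) = \sum_(i < \dim {:A}) \sum_(j < \dim {:A}) co j (b * e`_i) * co i (a * e`_j).
  apply: eq_bigr => i _; rewrite -mulrA {1}(coE (b * e`_i)) mulr_sumr linear_sum.
  by apply: eq_bigr => j _; rewrite -scalerAr linearZ.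
rewrite !trE exchange_big; apply: eq_bigr => i _; apply: eq_bigr => j _.
by rewrite mulrC.
Qed.

Lemma trl1 : trl 1 = (\dim {:A})%:R.
Proof.
rewrite /trl; under eq_bigr => i _.
  rewrite mul1r coord_free ?(basis_free (vbasisP _)) // eqxx; over.
by rewrite sumr_const card_ord.
Qed.

(* Symmetrized so as to be [sigma]-invariant without recourse to the reduced trace. *)
Definition tra x := trl x + trl (sigma x).

Lemma traL a x y : tra (a *: x + y) = a * tra x + tra y.
Proof. by rewrite /tra sL !trlL mulrDr addrACA. Qed.

Lemma traC x y : tra (x * y) = tra (y * x).
Proof. by rewrite /tra !sM trlC [trl (sigma y * _)]trlC. Qed.

Lemma traS x : tra (sigma x) = tra x.
Proof. by rewrite /tra sK addrC. Qed.

Lemma first_kind1 : sigma 1 = 1.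
Proof. by rewrite -[LHS]mul1r -{1}[1]sK -sM mul1r sK. Qed.

Lemma involutionX s k : sigma s = s -> sigma (s ^+ k) = s ^+ k.
Proof.
move=> ss; elim: k => [|k IHk]; first by rewrite expr0 first_kind1.
by rewrite exprS sM IHk ss -exprSr exprS.
Qed.

Lemma tra1 : tra 1 = (\dim {:A}).*2%:R.
Proof. by rewrite /tra first_kind1 trl1 -natrD addnn. Qed.

Lemma dimA_gt0 : (0 < \dim {:A})%N.
Proof.
rewrite lt0n dimv_eq0; apply/eqP => A0; have := memvf (1 : A).
by rewrite A0 memv0 oner_eq0.
Qed.

Lemma tra1_neq0 : tra 1 != 0.
Proof. by rewrite tra1 -(prednK dimA_gt0) doubleS. Qed.

Lemma tra0 : tra 0 = 0.
Proof. exact: semilin0 (@mul1r F) traL. Qed.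

Lemma traD : {morph tra : x y / x + y}.
Proof. exact: semilinD (@mul1r F) traL. Qed.

Lemma traZ a x : tra (a *: x) = a * tra x.
Proof. exact: (semilinZ tra (@mul1r F) traL). Qed.

Lemma tra_sum (I : Type) (r : seq I) (P : pred I) (f : I -> A) :
  tra (\sum_(i <- r | P i) f i) = \sum_(i <- r | P i) tra (f i).
Proof. exact: (semilin_sum tra (@mul1r F) traL). Qed.

(** The radical is a two-sided ideal, and it does not contain 1 because [tra 1] is twice the
    dimension, nonzero in characteristic 0. *)
Lemma tra_nondeg x : (forall y, tra (x * y) = 0) -> x = 0.
Proof.
pose f (x : A) : 'rV[F]_(\dim {:A}) := \row_i tra (x * e`_i).
have fL : linear f.
  by move=> a u v; apply/rowP => i; rewrite !mxE mulrDl -scalerAl traL.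
pose fl : {linear A -> 'rV[F]_(\dim {:A})} :=
  HB.pack f (GRing.isLinear.Build F A 'rV[F]_(\dim {:A}) *:%R f fL).
pose I := lker (linfun fl).
have IP u : reflect (forall y, tra (u * y) = 0) (u \in I).
  rewrite memv_ker lfunE /=; apply: (iffP eqP) => [/rowP fu y|h]; last first.
    by apply/rowP => i; rewrite !mxE h.
  rewrite (coE y) mulr_sumr tra_sum big1 // => i _.
  by have := fu i; rewrite !mxE -scalerAr traZ => ->; rewrite mulr0.
have [||I0|IT] := A_csa.2 I.
- apply/prodvP => a u _ /IP uI; apply/IP => y.
  by rewrite traC mulrA traC uI.
- by apply/prodvP => u a /IP uI _; apply/IP => y; rewrite -mulrA.
- by move=> /IP; rewrite I0 memv0 => /eqP.
have /IP/(_ 1) : 1 \in I by rewrite IT memvf.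
by rewrite mulr1 => /eqP; rewrite (negPf tra1_neq0).
Qed.

Lemma center_scalar (x : A) : (forall y, x * y = y * x) -> exists c : F, x = c%:A.
Proof.
move=> xc; have : x \in 'Z({:A})%VS.
  by rewrite memv_cap memvf /=; apply/centvP => y _; rewrite xc.
by rewrite A_csa.1 => /vlineP.
Qed.

Lemma dual_basis : exists f : 'I_(\dim {:A}) -> A,
  forall i j : 'I_(\dim {:A}), tra (e`_i * f j) = (i == j)%:R.
Proof.
pose n := \dim {:A}.
pose G : 'M[F]_n := \matrix_(i, j) tra (e`_i * e`_j).
have Gu : G \in unitmx.
  rewrite -row_free_unit -kermx_eq0; apply/rowV0P => c /sub_kermxP cG.
  pose x := \sum_i c 0 i *: e`_i.
  have x0 : x = 0.
    apply: tra_nondeg => y; rewrite (coE y) mulr_sumr tra_sum big1 // => j _.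
    rewrite -scalerAr traZ; have /rowP/(_ j) := cG; rewrite !mxE => cGj.
    suff -> : tra (x * e`_j) = 0 by rewrite mulr0.
    rewrite mulr_suml tra_sum -[RHS]cGj.
    by apply: eq_bigr => i _; rewrite -scalerAl traZ mxE.
  apply/rowP => i; rewrite mxE -[c 0 i](coord_sum_free (c 0) i (basis_free (vbasisP {:A}))).
  by rewrite -/x x0 linear0.
pose f (j : 'I_n) := \sum_k invmx G k j *: e`_k.
exists f => i j.
rewrite mulr_sumr tra_sum; have /matrixP/(_ i j) := mulmxV Gu.
rewrite !mxE => <-; apply: eq_bigr => k _.
by rewrite -scalerAr traZ mxE mulrC.
Qed.

(** For dual bases e, f the sums of e_i x f_i and of f_i e_i are central, hence scalars c and k.
    Taking traces gives c [tra 1] = k [tra x], and k is nonzero because its trace is the dimension;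
    this explains the factor [tra 1 / k]. *)
Lemma casimir : exists (n : nat) (p q : 'I_n -> A),
  forall x, \sum_i p i * x * q i = (tra x)%:A.
Proof.
pose n := \dim {:A}; have [f ef] := dual_basis.
have fE x : x = \sum_(i < n) tra (x * f i) *: e`_i.
  rewrite {1}(coE x); apply: eq_bigr => i _; congr (_ *: _).
  rewrite [in RHS](coE x) mulr_suml tra_sum (bigD1 i) //= big1 => [|j ji].
    by rewrite -scalerAl traZ ef eqxx mulr1 addr0.
  by rewrite -scalerAl traZ ef (negPf ji) mulr0.
have eE x : x = \sum_(i < n) tra (x * e`_i) *: f i.
  apply/eqP; rewrite -subr_eq0; apply/eqP/tra_nondeg => y.
  rewrite (coE y) mulr_sumr tra_sum big1 // => j _; rewrite -scalerAr traZ.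
  rewrite mulrBl -scaleN1r addrC traL mulN1r mulr_suml tra_sum (bigD1 j) //=.
  rewrite big1 => [|i ij].
    by rewrite -scalerAl traZ [tra (f _ * _)]traC ef eqxx mulr1 addr0 addNr mulr0.
  by rewrite -scalerAl traZ [tra (f _ * _)]traC ef eq_sym (negPf ij) mulr0.
(* Expanding [f i * a] in the dual basis and resumming over [i] moves [a] from the right to the
   left. *)
have Cc x a : (\sum_(i < n) e`_i * x * f i) * a = a * \sum_(i < n) e`_i * x * f i.
  transitivity (\sum_(i < n) \sum_(j < n) tra (a * e`_j * f i) *: (e`_i * x * f j)).
    rewrite mulr_suml; apply: eq_bigr => i _.
    rewrite -mulrA {1}(eE (f i * a)) mulr_sumr; apply: eq_bigr => j _.
    by rewrite -scalerAr -!mulrA traC !mulrA.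
  rewrite exchange_big mulr_sumr; apply: eq_bigr => j _ /=.
  rewrite !mulrA {2}(fE (a * e`_j)) !mulr_suml; apply: eq_bigr => i _.
  by rewrite -!scalerAl.
have Kc a : (\sum_(i < n) f i * e`_i) * a = a * \sum_(i < n) f i * e`_i.
  transitivity (\sum_(i < n) \sum_(j < n) tra (a * f j * e`_i) *: (f i * e`_j)).
    rewrite mulr_suml; apply: eq_bigr => i _.
    rewrite -mulrA {1}(fE (e`_i * a)) mulr_sumr; apply: eq_bigr => j _.
    by rewrite -scalerAr -!mulrA traC !mulrA.
  rewrite exchange_big mulr_sumr; apply: eq_bigr => j _ /=.
  rewrite !mulrA {2}(eE (a * f j)) !mulr_suml; apply: eq_bigr => i _.
  by rewrite -!scalerAl.
have [k kE] := center_scalar Kc.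
have k0 : k != 0.
  have : tra (\sum_(i < n) f i * e`_i) = (\dim {:A})%:R.
    rewrite tra_sum; under eq_bigr => i _ do rewrite traC ef eqxx.
    by rewrite sumr_const card_ord.
  rewrite kE traZ => h; apply: contraTneq (char0 (\dim {:A}).-1) => k0.
  by rewrite negbK prednK ?dimA_gt0 // -h k0 mul0r.
exists n, (fun i => (tra 1 / k) *: e`_i), f => x.
have [c cE] := center_scalar (Cc x).
under eq_bigr => i _ do rewrite -!scalerAl.
rewrite -scaler_sumr cE scalerA; congr (_ *: _).
have : tra (\sum_(i < n) e`_i * x * f i) = k * tra x.
  rewrite tra_sum; under eq_bigr => i _ do rewrite -mulrA traC -mulrA.
  by rewrite -tra_sum -mulr_sumr kE mulr_algr traZ.
rewrite cE traZ => h.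
by rewrite mulrAC [tra 1 * c]mulrC h mulrAC divff // mul1r.
Qed.

End Trace.

(** * Scalar extension of the involution and of the trace form *)

Section ScalarExtension.
Variables (F M : fieldType) (iota : {rmorphism F -> M}).
Variables (A : falgType F) (sigma : A -> A).
Hypothesis sigma_inv : first_kind_involution sigma.

Local Notation B := (tensor iota A M^o).
Local Notation t a := (tens iota a (1 : M^o)).

Definition ext_inv : B -> B := tensor_map iota sigma idfun.

Lemma tensE (a : A) (b : M^o) : tens iota a b = b *: t a.
Proof. by rewrite -tensZr; rewrite [X in tens _ _ X = _](_ : _ = b *: (1 : M^o)) //; rewrite [RHS]mulr1. Qed.

Lemma tens_ext1 (V : lmodType M) (g h : B -> V) :
  (forall c x y, g (c *: x + y) = c *: g x + g y) ->
  (forall c x y, h (c *: x + y) = c *: h x + h y) ->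
  (forall a, g (t a) = h (t a)) -> g =1 h.
Proof.
move=> gL hL gh.
have D (f : B -> V) : (forall c x y, f (c *: x + y) = c *: f x + f y) ->
    {morph f : x y / x + y}.
  by move=> fL x y; rewrite -[x]scale1r fL !scale1r.
have Z (f : B -> V) : (forall c x y, f (c *: x + y) = c *: f x + f y) ->
    forall c x, f (c *: x) = c *: f x.
  move=> fL c x; have f0 : f 0 = 0 by apply: (addrI (f 0)); rewrite -D // !addr0.
  by rewrite -[c *: x]addr0 fL f0 addr0.
apply: tens_ext; [exact: D|exact: D|move=> a b].
by rewrite tensE !Z // gh.
Qed.

Lemma ext_invL : linear ext_inv.
Proof.
move=> c x y; rewrite /ext_inv /tensor_map scaler_sumr -big_split.
by apply: eq_bigr => i _ /=; rewrite !ffunE tensDr tensZr.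
Qed.

Lemma ext_inv_tens a b : ext_inv (tens iota a b) = tens iota (sigma a) b.
Proof.
by rewrite /ext_inv tensor_map_tens //; apply: (involution_linear sigma_inv).
Qed.

Lemma ext_invM x y : ext_inv (x * y) = ext_inv y * ext_inv x.
Proof.
move: x; apply: tens_ext1 => [c x x'|c x x'|a].
- by rewrite mulrDl -scalerAl ext_invL.
- by rewrite ext_invL mulrDr scalerAr.
move: y; apply: tens_ext1 => [c x x'|c x x'|a'].
- by rewrite mulrDr -scalerAr ext_invL.
- by rewrite ext_invL mulrDl scalerAl.
by rewrite tensM !ext_inv_tens tensM (involution_mul sigma_inv) mul1r.
Qed.

Lemma ext_invK : involutive ext_inv.
Proof.
apply: tens_ext1 => [c x x'|c x x'|a] //; first by rewrite !ext_invL.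
by rewrite !ext_inv_tens (involution_invol sigma_inv).
Qed.

Lemma ext_inv1 : ext_inv 1 = 1.
Proof. by rewrite -tens1 ext_inv_tens (first_kind1 sigma_inv). Qed.

Definition ext_tr (x : B) : M^o :=
  tens_lift (fun (a : A) (b : M^o) => b * iota (tra sigma a)) x.

Lemma ext_trL c x y : ext_tr (c *: x + y) = c * ext_tr x + ext_tr y.
Proof.
rewrite /ext_tr /tens_lift mulr_sumr -big_split; apply: eq_bigr => i _ /=.
by rewrite !ffunE mulrDl -mulrA.
Qed.

Lemma ext_tr_tens a b : ext_tr (tens iota a b) = b * iota (tra sigma a).
Proof.
apply: (tens_liftE (f := fun (a : A) (b : M^o) => b * iota (tra sigma a)))
  => [a1 a2 b'|c a' b'].
  by rewrite (traD sigma_inv) rmorphD mulrDr.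
by rewrite (traZ sigma_inv) rmorphM mulrCA mulrA.
Qed.

Lemma ext_trC x y : ext_tr (x * y) = ext_tr (y * x).
Proof.
move: x; apply: tens_ext1 => [c x x'|c x x'|a].
- by rewrite mulrDl -scalerAl ext_trL.
- by rewrite mulrDr -scalerAr ext_trL.
move: y; apply: tens_ext1 => [c x x'|c x x'|a'].
- by rewrite mulrDr -scalerAr ext_trL.
- by rewrite mulrDl -scalerAl ext_trL.
by rewrite !tensM !ext_tr_tens (traC sigma_inv).
Qed.

Lemma ext_trS x : ext_tr (ext_inv x) = ext_tr x.
Proof.
move: x; apply: tens_ext1 => [c x x'|c x x'|a].
- by rewrite ext_invL ext_trL.
- by rewrite ext_trL.
by rewrite ext_inv_tens !ext_tr_tens (traS sigma_inv).
Qed.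

Lemma ext_tr1 : ext_tr 1 = iota (tra sigma 1).
Proof. by rewrite -tens1 ext_tr_tens mul1r. Qed.

Definition trform (x y : A) : F := tra sigma (sigma x * y).

Definition ext_trform (x y : B) : M := ext_tr (ext_inv x * y).

Lemma trform_sym x y : trform x y = trform y x.
Proof.
by rewrite /trform -(traS sigma_inv) (involution_mul sigma_inv)
  (involution_invol sigma_inv).
Qed.

Lemma ext_trform_sym x y : ext_trform x y = ext_trform y x.
Proof. by rewrite /ext_trform -ext_trS ext_invM ext_invK. Qed.

Lemma ext_trformL c x y z :
  ext_trform (c *: x + y) z = c * ext_trform x z + ext_trform y z.
Proof. by rewrite /ext_trform ext_invL mulrDl -scalerAl ext_trL. Qed.

Lemma ext_trform_tens a a' : ext_trform (t a) (t a') = iota (trform a a').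
Proof. by rewrite /ext_trform ext_inv_tens tensM ext_tr_tens !mul1r. Qed.

Lemma trformL c x y z : trform (c *: x + y) z = c * trform x z + trform y z.
Proof.
by rewrite /trform (involution_linear sigma_inv) mulrDl -scalerAl (traL sigma_inv).
Qed.

Lemma trform_frame : 2%:R != 0 :> F ->
  exists (I : finType) (v : I -> A), frame trform v.
Proof.
move=> F2; apply: (frame_exists (n := \dim {:A}) (e := fun i => (vbasis {:A})`_i)) => //.
- exact: trform_sym.
- exact: trformL.
move=> x; exists (fun i => coord (vbasis {:A}) i x) => y.
rewrite {1}(coE x).
have tL a u v := trformL a u v y.
rewrite (semilin_sum (trform^~ y) (@mul1r F) tL); apply: eq_bigr => i _.
exact: (semilinZ (trform^~ y) (@mul1r F) tL).
Qed.

(** Both sides of Parseval's identity are bilinear over M, so the elements of A suffice to test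
    it. *)
Lemma ext_frame (I : finType) (v : I -> A) :
  frame trform v -> frame ext_trform (fun i => t (v i)).
Proof.
move=> [[vo v0] vE]; split; first split.
- by move=> i j /vo ij; rewrite ext_trform_tens ij rmorph0.
- by move=> i; rewrite ext_trform_tens fmorph_eq0.
have sumS x y : \sum_i ext_trform x (t (v i)) * ext_trform (t (v i)) y /
      ext_trform (t (v i)) (t (v i)) =
    \sum_i ext_trform y (t (v i)) * ext_trform (t (v i)) x /
      ext_trform (t (v i)) (t (v i)).
  apply: eq_bigr => i _; rewrite [ext_trform x _]ext_trform_sym.
  by rewrite [ext_trform y _]ext_trform_sym [ext_trform _ x * _]mulrC.
have sumL c x x' y : \sum_i ext_trform (c *: x + x') (t (v i)) * ext_trform (t (v i)) y /
      ext_trform (t (v i)) (t (v i)) =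
    c * (\sum_i ext_trform x (t (v i)) * ext_trform (t (v i)) y /
      ext_trform (t (v i)) (t (v i))) +
    \sum_i ext_trform x' (t (v i)) * ext_trform (t (v i)) y /
      ext_trform (t (v i)) (t (v i)).
  rewrite mulr_sumr -big_split; apply: eq_bigr => i _ /=.
  by rewrite ext_trformL !mulrDl !mulrA.
move=> x y; move: x; apply: (@tens_ext1 M^o) => [c x x'|c x x'|a].
- exact: ext_trformL.
- exact: sumL.
rewrite ext_trform_sym sumS.
move: y; apply: (@tens_ext1 M^o) => [c x x'|c x x'|a'].
- exact: ext_trformL.
- exact: sumL.
rewrite ext_trform_tens vE rmorph_sum; apply: eq_bigr => i _ /=.
by rewrite !ext_trform_tens fmorph_div rmorphM.
Qed.

End ScalarExtension.

(** Multiplication by the matrix [u] carries copies of the trace form over K into copies of its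
    negative. The inertia bound for a semiordering over [P] applies in both directions, and the
    common factor [n.+1] cancels. *)
Lemma trform_balanced (F K : fieldType) (iota : {rmorphism F -> K})
    (A : falgType F) (sigma : A -> A) (P : set F) (I : finType) (v : I -> A) :
  first_kind_involution sigma -> is_ordering P -> totally_positive iota ->
  weakly_hyperbolic
    (tensor_map iota sigma idfun : tensor iota A K^o -> tensor iota A K^o) ->
  frame (trform sigma) v ->
  #|[pred i | `[< P (trform sigma (v i) (v i)) >]]| =
  #|[pred i | `[< P (- trform sigma (v i) (v i)) >]]|.
Proof.
move=> sI P_ord K_tp wh fv.
have [S [S_semi SP]] := K_tp P (ordering_semi P_ord).
have SE x : S (iota x) = P x by rewrite -SP.
have [n [u uE]] := weakly_hyperbolic_skew (@ext_invL F K iota A sigma)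
  (@ext_inv1 F K iota A sigma sI) wh.
pose d i := trform sigma (v i) (v i).
have [[_ v0] _] := fv; have [[fo f0] fE] := @ext_frame F K iota A sigma sI I v fv.
pose t (a : A) := tens iota a (1 : K^o).
pose tf := @ext_trform F K iota A sigma.
have tfE i : tf (t (v i)) (t (v i)) = iota (d i) by apply: ext_trform_tens.
(* Coordinates, in the extended frame, of the image under [u] of the frame vector [v x.2] placed in
   the copy [x.1]. *)
pose g (x y : 'I_n.+1 * I) := tf (u y.1 x.1 * t (v x.2)) (t (v y.2)) / iota (d y.2).
have id0 i : iota (d i) != 0 by rewrite fmorph_eq0 v0.
have gE (x x' : 'I_n.+1 * I) :
    \sum_y g x y * iota (d y.2) * g x' y = (- iota (d x.2)) *+ (x == x').
  transitivity (\sum_k tf (u k x.1 * t (v x.2)) (u k x'.1 * t (v x'.2))).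
    rewrite (eq_bigr (fun y => g x (y.1, y.2) * iota (d y.2) * g x' (y.1, y.2)));
      last by case.
    rewrite -(pair_bigA _ (fun k i => g x (k, i) * iota (d i) * g x' (k, i))) /=.
    apply: eq_bigr => k _; rewrite /tf fE; apply: eq_bigr => i _.
    rewrite -/tf -/(t (v i)) tfE /g /= [tf (t _) _](ext_trform_sym sI) -/tf.
    by field; rewrite id0.
  transitivity (- (x.1 == x'.1)%:R * tf (t (v x.2)) (t (v x'.2))).
    pose tr := @ext_tr F K iota A sigma; have trL := @ext_trL F K iota A sigma.
    rewrite /tf /ext_trform -/tr -(semilin_sum tr (@mul1r K) trL).
    under eq_bigr => k _ do rewrite (ext_invM sI) -mulrA [ext_inv _ (u _ _) * _]mulrA.
    rewrite -mulr_sumr -mulr_suml uE.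
    case: (x.1 == x'.1); last by rewrite !(mulr0n, oppr0, mul0r, mulr0) (semilin0 tr (@mul1r K) trL).
    rewrite !mulr1n !mulN1r mulrN -scaleN1r (semilinZ tr (@mul1r K) trL) mulN1r.
    by [].
  rewrite -[x == x']/((x.1 == x'.1) && (x.2 == x'.2)).
  case: (x.1 == x'.1); last by rewrite !(mulr0n, oppr0, mul0r).
  have [->|ne] := eqVneq x.2 x'.2; first by rewrite tfE mulN1r.
  by rewrite /tf /t (fo _ _ ne) mulr0.
have cardE (p : pred I) : #|[pred x : 'I_n.+1 * I | p x.2]| = (n.+1 * #|p|)%N.
  by rewrite -[n.+1 in RHS]card_ord -cardX; apply: eq_card => -[j i]; rewrite !inE.
have countE (a : I -> K) (p : pred I) : (forall i, `[< S (a i) >] = p i) ->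
    #|[pred x : 'I_n.+1 * I | `[< S (a x.2) >]]| = (n.+1 * #|p|)%N.
  by move=> ap; rewrite -cardE; apply: eq_card => x; rewrite !inE ap.
have PE i : `[< S (iota (d i)) >] = `[< P (d i) >] by rewrite SE.
have NE i : `[< S (- iota (d i)) >] = `[< P (- d i) >] by rewrite -rmorphN SE.
have pE := countE (fun i => iota (d i)) (fun i => `[< P (d i) >]) PE.
have nE := countE (fun i => - iota (d i)) (fun i => `[< P (- d i) >]) NE.
apply/eqP; rewrite eqn_leq; apply/andP; split.
  rewrite -(leq_pmul2l (ltn0Sn n)).
  apply: (leq_trans (eq_leq (esym pE))); apply: leq_trans (eq_leq nE).
  apply: (orth_count (g := g) S_semi) => [x|x x']; first exact: id0.
  under eq_bigr => y _ do rewrite mulrN mulNr.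
  by rewrite sumrN gE mulNrn opprK.
rewrite -(leq_pmul2l (ltn0Sn n)).
apply: (leq_trans (eq_leq (esym nE))); apply: leq_trans (eq_leq pE).
by apply: (orth_count (g := g) S_semi) => // x; rewrite oppr_eq0.
Qed.

(** * Self-adjoint matrices with separable characteristic polynomial *)

Lemma char_poly_conj (F : fieldType) n (V f : 'M[F]_n) : V \in unitmx ->
  char_poly (invmx V *m f *m V) = char_poly f.
Proof.
move=> Vu; have -> : char_poly (invmx V *m f *m V) =
    \det (map_mx polyC (invmx V) *m char_poly_mx f *m map_mx polyC V).
  rewrite /char_poly /char_poly_mx mulmxBr mulmxBl mul_mx_scalar -scalemxAl.
  by rewrite -map_mxM mulVmx // map_mx1 scalemx1 !map_mxM.
rewrite !det_mulmx mulrAC -det_mulmx -map_mxM mulVmx // map_mx1 det1 mul1r.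
by [].
Qed.

Lemma char_poly_diag (F : fieldType) n (d : 'rV[F]_n) :
  char_poly (diag_mx d) = \prod_i ('X - (d 0 i)%:P).
Proof.
rewrite char_poly_trig ?diag_mx_is_trig //.
by apply: eq_bigr => i _; rewrite mxE eqxx mulr1n.
Qed.

Lemma sym_mx_diag (L : fieldType) n (S : 'M[L]_n) :
  2%:R != 0 :> L -> S^T = S -> S \in unitmx ->
  exists (R : 'M[L]_n) (d : 'rV[L]_n), R \in unitmx /\ R *m S *m R^T = diag_mx d.
Proof.
move=> L2 ST Su; pose beta (x y : 'rV[L]_n) : L := (x *m S *m y^T) 0 0.
have bS x y : beta x y = beta y x.
  rewrite /beta; have -> : y *m S *m x^T = (x *m S *m y^T)^T.
    by rewrite !trmx_mul trmxK ST mulmxA.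
  by rewrite [RHS]mxE.
have bL a x y z : beta (a *: x + y) z = a * beta x z + beta y z.
  by rewrite /beta !mulmxDl -!scalemxAl !mxE.
have [I [v [[vo v0] vE]]] : exists (I : finType) (v : I -> 'rV[L]_n), frame beta v.
  apply: (frame_exists (n := n) (e := fun i => delta_mx 0 i)) => // x.
  exists (x 0) => y; rewrite {1}(row_sum_delta x).
  have bL' a u w := bL a u w y.
  rewrite (semilin_sum (beta^~ y) (@mul1r L) bL'); apply: eq_bigr => i _.
  exact: (semilinZ (beta^~ y) (@mul1r L) bL').
pose k := #|I|; pose R : 'M[L]_(k, n) := \matrix_i v (enum_val i).
pose d : 'rV[L]_k := \row_i beta (v (enum_val i)) (v (enum_val i)).
have RSR : R *m S *m R^T = diag_mx d.
  apply/matrixP => i j; rewrite !mxE.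
  transitivity (beta (v (enum_val i)) (v (enum_val j))).
    rewrite /beta mxE; apply: eq_bigr => l _; rewrite !mxE; congr (_ * _).
    by apply: eq_bigr => l' _; rewrite mxE.
  have [->|ij] := eqVneq i j; first by rewrite mulr1n.
  by rewrite mulr0n vo // (inj_eq enum_val_inj).
have du : diag_mx d \in unitmx.
  rewrite unitmxE det_diag unitfE; apply/prodf_neq0 => i _.
  by rewrite mxE v0.
have SE : S = S *m R^T *m invmx (diag_mx d) *m R *m S.
  have dV : invmx (diag_mx d) = diag_mx (\row_i (d 0 i)^-1).
    rewrite -[LHS]mulmx1; apply: (canLR (mulKmx du)).
    by rewrite mulmx_diag; apply/matrixP => i j; rewrite !mxE divff ?v0.
  rewrite dV; apply/matrixP => i j.
  have sE a b : S a b = beta (delta_mx 0 a) (delta_mx 0 b).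
    by rewrite /beta -rowE trmx_delta -colE !mxE.
  rewrite sE vE (reindex (@enum_val _ I)) /=; last exact: onW_bij (enum_val_bij _).
  rewrite -[S *m R^T *m _ *m R *m S]mulmxA mxE; apply: eq_bigr => l _.
  rewrite mul_mx_diag !mxE; rewrite mulrAC; congr (_ * _ * _).
    rewrite /beta -rowE !mxE; apply: eq_bigr => m _; by rewrite !mxE.
  rewrite /beta trmx_delta -colE !mxE; apply: eq_bigr => m _; by rewrite !mxE.
(* Invertibility of the diagonal matrix bounds [k] by [n]; Parseval's identity factors the
   invertible [S] through dimension [k], which bounds [n] by [k]. *)
have kn : k = n.
  apply/eqP; rewrite eqn_leq; apply/andP; split.
    have := mxrank_unit du; rewrite -RSR => <-.
    apply: leq_trans (mxrankM_maxl _ _) _; apply: leq_trans (mxrankM_maxl _ _) _.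
    exact: rank_leq_col.
  have := mxrank_unit Su; rewrite {1}SE => <-.
  do 2! [apply: leq_trans (mxrankM_maxl _ _) _].
  apply: leq_trans (mxrankM_maxl _ _) _; exact: rank_leq_col.
move: R d RSR du {SE}; rewrite kn => R d RSR du.
exists R, d; split=> //.
by move: du; rewrite -RSR !unitmx_mul => /andP[/andP[]].
Qed.

(** In a basis diagonalizing [S] every diagonal matrix is self-adjoint; the entries 0, 1, ..., n - 1
    are distinct in characteristic 0. *)
Lemma self_adjoint_separable (L : fieldType) n (S : 'M[L]_n) :
  (forall k, k.+1%:R != 0 :> L) -> S^T = S -> S \in unitmx ->
  exists X : 'M[L]_n, (S *m X)^T = S *m X /\ separable_poly (char_poly X).
Proof.
move=> char0 ST Su; have [R [d [Ru RSR]]] := sym_mx_diag (char0 1%N) ST Su.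
pose V := invmx R^T; have Vu : V \in unitmx by rewrite unitmx_inv unitmx_tr.
pose t : 'rV[L]_n := \row_i (val i)%:R.
have RtE : R^T = invmx V by rewrite invmxK.
exists (invmx V *m diag_mx t *m V); split.
  have -> : S *m (invmx V *m diag_mx t *m V) = V^T *m (diag_mx d *m diag_mx t) *m V.
    rewrite -RSR -RtE !mulmxA; congr (_ *m _ *m _).
    have -> : V^T *m R = 1%:M.
      by rewrite -[R]trmxK -trmx_mul RtE mulVmx ?trmx1.
    by rewrite mul1mx.
  rewrite !trmx_mul trmxK !tr_diag_mx !mulmxA; congr (_ *m _).
  by rewrite -!mulmxA diag_mxC.
rewrite char_poly_conj // char_poly_diag.
have -> : \prod_i ('X - (t 0 i)%:P) = \prod_(x <- [seq (val i)%:R | i <- enum 'I_n]) ('X - x%:P).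
  by rewrite big_map big_enum; apply: eq_bigr => i _; rewrite mxE.
rewrite separable_prod_XsubC map_inj_uniq ?enum_uniq //.
by move=> i j /(natr_inj_char0 char0)/val_inj.
Qed.

(* The discriminant of the characteristic polynomial of Z + X Y is a nonzero
   polynomial in X, so it does not vanish at all natural numbers. *)
Lemma generic_separable1 (L : fieldType) n (Y Z : 'M[L]_n) c :
  (forall k, k.+1%:R != 0 :> L) -> separable_poly (char_poly (Z + c *: Y)) ->
  exists a : nat, separable_poly (char_poly (Z + a%:R *: Y)).
Proof.
move=> char0; case: n Y Z => [|n] Y Z sep.
  by exists 0%N; move: sep; rewrite /char_poly !det_mx00.
pose W : 'M[{poly L}]_n.+1 := map_mx polyC Z + 'X *: map_mx polyC Y.
pose chi := char_poly W.
have chiE a : map_poly (horner_eval a) chi = char_poly (Z + a *: Y).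
  rewrite /chi map_char_poly; congr char_poly; apply/matrixP => i j.
  rewrite /W !mxE.
  change (((Z i j)%:P + 'X * (Y i j)%:P).[a] = Z i j + a * Y i j).
  by rewrite hornerD hornerM hornerX !hornerC.
have chiM : chi \is monic by apply: char_poly_monic.
have szchi : size chi = n.+2 by apply: size_char_poly.
(* Specialization is applied to the resultant with both leading coefficients surviving: they are 1
   and this one. *)
have dlead : lead_coef chi^`() = n.+1%:R.
  have dn : chi^`()`_n = n.+1%:R.
    have chin : chi`_n.+1 = 1 by have := monicP chiM; rewrite lead_coefE szchi.
    by rewrite coef_deriv chin.
  have szd : (size chi^`() <= n.+1)%N by rewrite -ltnS -szchi lt_size_deriv ?monic_neq0.
  rewrite lead_coefE; suff -> : size chi^`() = n.+1 by [].
  apply/eqP; rewrite eqn_leq szd ltnNge; apply/negP => le.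
  move/eqP: dn; rewrite nth_default // eq_sym -polyC_natr polyC_eq0.
  exact/negP.
pose r := resultant chi chi^`().
have rE a : r.[a] = resultant (char_poly (Z + a *: Y)) (char_poly (Z + a *: Y))^`().
  rewrite -[LHS]/(horner_eval a r) map_resultant.
  - by rewrite -deriv_map chiE.
  - by rewrite (monicP chiM) rmorph1 oner_eq0.
  - by rewrite dlead rmorph_nat char0.
have sepE (p : {poly L}) : p != 0 -> (resultant p p^`() != 0) = separable_poly p.
  move=> p0; rewrite resultant_eq0 -leqNgt separable_poly.unlock coprimep_def eqn_leq.
  by rewrite size_poly_gt0 gcdp_eq0 (negPf p0) /= andbT.
have r0 : r != 0.
  apply: contraTneq sep => r0; rewrite -sepE ?monic_neq0 ?char_poly_monic //.
  by rewrite -rE r0 horner0 eqxx.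
pose s : seq L := [seq k%:R | k <- iota 0 (size r)].
have [x xs rx] : exists2 x, x \in s & r.[x] != 0.
  apply: contrapT => h.
  have au : all (root r) s.
    by apply/allP => x xs; apply: contrapT => /negP rx; apply: h; exists x.
  have us : uniq s by rewrite map_inj_uniq ?iota_uniq //; apply: natr_inj_char0.
  by have := max_poly_roots r0 au us; rewrite size_map size_iota ltnn.
have [a _ xE] := mapP xs; exists a; rewrite -sepE ?monic_neq0 ?char_poly_monic //.
by rewrite -rE -xE.
Qed.

(** The coefficients are replaced one at a time. Natural numbers come from every subfield, so the
    resulting element can be taken in A rather than in its extension to L. *)
Lemma generic_separable (L : fieldType) n N (Y : 'I_N -> 'M[L]_n)
    (c : 'I_N -> L) (Z : 'M[L]_n) :
  (forall k, k.+1%:R != 0 :> L) ->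
  separable_poly (char_poly (Z + \sum_i c i *: Y i)) ->
  exists a : 'I_N -> nat, separable_poly (char_poly (Z + \sum_i (a i)%:R *: Y i)).
Proof.
move=> char0; elim: N Y c Z => [|N IHN] Y c Z.
  by rewrite big_ord0 => sep; exists (fun=> 0%N); rewrite big_ord0.
rewrite big_ord_recl addrA => /IHN[a].
rewrite addrAC => /(generic_separable1 char0)[a0 sep].
exists (fun i => if unlift ord0 i is Some j then a j else a0).
rewrite big_ord_recl unlift_none; under eq_bigr => i _ do rewrite liftK.
by rewrite addrA addrAC.
Qed.

Lemma irreducible_factor (F : fieldType) (p : {poly F}) : (1 < size p)%N ->
  exists g, [/\ irreducible_poly g, g \is monic & g %| p].
Proof.
have [n] := ubnP (size p); elim: n p => [//|n IHn] p sp p1.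
have p0 : p != 0 by rewrite -size_poly_gt0 ltnW.
have [pI|pnI] := pselect (irreducible_poly p).
  have lp : (lead_coef p)^-1 != 0 by rewrite invr_eq0 lead_coef_eq0.
  exists ((lead_coef p)^-1 *: p); split; last by rewrite dvdpZl.
  - split=> [|q q1]; first by rewrite size_scale.
    by rewrite dvdpZr // => /(pI.2 q q1) qp; rewrite eqp_sym (eqp_ltrans (eqp_scale _ lp)) eqp_sym.
  - by rewrite monicE lead_coefZ mulVf ?lead_coef_eq0.
have [q [q1 qp nqp]] : exists q : {poly F}, [/\ size q != 1%N, q %| p & ~ (q %= p)].
  apply: contrapT => h; apply: pnI; split=> // q q1 qp.
  by apply: contrapT => nqp; apply: h; exists q.
have q0 : q != 0 by apply: contraTneq qp => ->; rewrite dvd0p.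
have [||g [gI gM gq]] := IHn q.
- have := dvdp_leq p0 qp; rewrite leq_eqVlt => /orP[/eqP spq|lt].
    by case: nqp; rewrite -dvdp_size_eqp // spq.
  exact: leq_trans lt _.
- by rewrite ltn_neqAle eq_sym q1 size_poly_gt0.
by exists g; split=> //; apply: dvdp_trans qp.
Qed.

Lemma splitting_field (F : fieldType) (p : {poly F}) : p != 0 ->
  exists (E : fieldType) (iota : {rmorphism F -> E}) (rs : seq E),
    map_poly iota p %= \prod_(z <- rs) ('X - z%:P).
Proof.
have [n] := ubnP (size p); elim: n F p => [//|n IHn] F p sp p0.
have [p1|p1] := leqP (size p) 1.
  exists F, idfun, [::]; rewrite big_nil map_poly_id //.
  by rewrite -size_poly_eq1 eqn_leq p1 size_poly_gt0.
have [g [gI gM gp]] := irreducible_factor p1.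
have [M [iota [al [evE _]]]] := root_field gI gM.
have /factor_theorem[h hE] : root (map_poly iota p) al by rewrite /root evE.
have h0 : h != 0.
  have : map_poly iota p != 0 by rewrite map_poly_eq0.
  by rewrite hE mulf_eq0 negb_or => /andP[].
have [|E [j [rs rsE]]] := IHn M h _ h0.
  by move: sp; rewrite -(size_map_poly iota p) hE size_Mmonic ?monicXsubC // size_XsubC addn2.
exists E, (j \o iota), (j al :: rs).
rewrite big_cons map_poly_comp hE rmorphM /= map_polyXsubC mulrC.
by rewrite eqp_mul2l // polyXsubC_eq0.
Qed.

(** [X] is diagonalizable with distinct eigenvalues, so [Y] is diagonal in the same basis and is
    recovered by Lagrange interpolation with the polynomials [ell]. *)
Lemma commutant_separable (E : fieldType) n (X Y : 'M[E]_n.+1) (rs : seq E) :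
  separable_poly (char_poly X) -> char_poly X = \prod_(z <- rs) ('X - z%:P) ->
  X *m Y = Y *m X -> exists q, Y = horner_mx X q.
Proof.
move=> sep chiE XY.
have rsu : uniq rs by move: sep; rewrite chiE separable_prod_XsubC.
have : diagonalizable X.
  by apply/diagonalizableP; exists rs => //; rewrite -chiE mxminpoly_dvd_char.
move=> [P Pu /diagonalizable_forPex[d /(simmxLR Pu) XE]].
have {}XE : X = invmx P *m diag_mx d *m P.
  by rewrite XE mxpoly.conjVmx.
have dI : injective (fun i => d 0 i).
  move: sep; rewrite XE char_poly_conj // char_poly_diag.
  have -> : \prod_i ('X - (d 0 i)%:P) =
      \prod_(x <- [seq d 0 i | i <- enum 'I_n.+1]) ('X - x%:P).
    by rewrite big_map big_enum.
  by rewrite separable_prod_XsubC => /injectiveP.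
pose Z := P *m Y *m invmx P.
have YE : Y = invmx P *m Z *m P.
  by rewrite /Z !mulmxA mulVmx // mul1mx -mulmxA mulVmx // mulmx1.
have DZ : diag_mx d *m Z = Z *m diag_mx d.
  have DE : diag_mx d = P *m X *m invmx P.
    by rewrite XE !mulmxA mulmxV // mul1mx -mulmxA mulmxV // mulmx1.
  rewrite DE /Z !mulmxA -[P *m X *m _ *m P]mulmxA mulVmx // mulmx1.
  rewrite -[P *m Y *m _ *m P]mulmxA mulVmx // mulmx1.
  by rewrite -[P *m X *m Y]mulmxA XY mulmxA.
have Zd i j : i != j -> Z i j = 0.
  move=> ij; have /matrixP/(_ i j) := DZ; rewrite mul_diag_mx mul_mx_diag !mxE.
  move=> /eqP; rewrite mulrC -subr_eq0 -mulrBr mulf_eq0 subr_eq0 (inj_eq dI).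
  by rewrite (negPf ij) orbF => /eqP.
move: Z YE Zd {DZ} => Z YE Zd.
pose ell i := \prod_(j | j != i) ((d 0 i - d 0 j)^-1 *: ('X - (d 0 j)%:P)).
have ellE i k : (ell i).[d 0 k] = (i == k)%:R.
  rewrite /ell horner_prod; have [->|ik] := eqVneq i k.
    rewrite big1 // => j jk; rewrite hornerZ hornerXsubC mulVf // subr_eq0.
    by rewrite (inj_eq dI) eq_sym.
  rewrite (bigD1 k) /=; last by rewrite eq_sym.
  by rewrite hornerZ hornerXsubC subrr mulr0 mul0r.
exists (\sum_i Z i i *: ell i).
rewrite XE horner_mx_uconjC // horner_mx_diag {1}YE; congr (_ *m _ *m _).
apply/matrixP => i j; rewrite !mxE; have [->|ij] := eqVneq i j; last by rewrite Zd.
rewrite mulr1n horner_sum (bigD1 j) //= hornerZ ellE eqxx mulr1 big1 ?addr0 //.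
by move=> k kj; rewrite hornerZ ellE (negPf kj) mulr0.
Qed.

Lemma poly_ideal_generator (F : fieldType) (J : {poly F} -> Prop) (p0 : {poly F}) :
  (forall p q, J p -> J q -> J (p - q)) -> (forall p q, J p -> J (q * p)) ->
  p0 != 0 -> J p0 -> exists2 mu, mu \is monic & forall p, J p <-> mu %| p.
Proof.
move=> JB JM p00 Jp0.
pose Q n := `[< exists p, [/\ J p, p != 0 & size p = n] >].
have exQ : exists n, Q n by exists (size p0); apply/asboolP; exists p0.
case: (ex_minnP exQ) => n /asboolP[g [Jg g0 sg]] gmin.
have lg : (lead_coef g)^-1 != 0 by rewrite invr_eq0 lead_coef_eq0.
exists ((lead_coef g)^-1 *: g).
  by rewrite monicE lead_coefZ mulVf ?lead_coef_eq0.
move=> p; rewrite dvdpZl //; split=> [Jp|/dvdpP[q ->]]; last exact: JM.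
apply/modp_eq0P/eqP; apply: contrapT => /negP r0.
have : (n <= size (p %% g)%R)%N.
  apply: gmin; apply/asboolP; exists (p %% g); split=> //.
  have -> : p %% g = p - p %/ g * g by rewrite {2}(divp_eq p g) addrC addKr.
  by apply: JB => //; apply: JM.
by rewrite -sg leqNgt ltn_modpN0.
Qed.

Lemma coef_sumXn (F : fieldType) d (c : 'I_d -> F) (j : 'I_d) :
  (\sum_(i < d) c i *: 'X^i)`_j = c j.
Proof.
rewrite coef_sum (bigD1 j) //= big1 => [|i ij].
  by rewrite coefZ coefXn eqxx mulr1 addr0.
by rewrite coefZ coefXn eq_sym (inj_eq val_inj) (negPf ij) mulr0.
Qed.

Lemma size_sumXn (F : fieldType) d (c : 'I_d -> F) :
  (size (\sum_(i < d) c i *: 'X^i)%R <= d)%N.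
Proof.
apply: (leq_trans (size_sum _ _ _)); apply/bigmax_leqP => i _.
by apply: (leq_trans (size_scale_leq _ _)); rewrite size_polyXn.
Qed.

Lemma poly_sumXn (F : fieldType) d (p : {poly F}) : (size p <= d)%N ->
  p = \sum_(i < d) p`_i *: 'X^i.
Proof.
move=> sp; apply/polyP => k; have [lt_kd|le_dk] := ltnP k d.
  by rewrite -[k in RHS]/(val (Ordinal lt_kd)) coef_sumXn.
by rewrite !nth_default //; [apply: leq_trans (size_sumXn _) _|apply: leq_trans le_dk].
Qed.

(** * Minimal polynomials and centralizers in A, descended from a splitting field *)

Section MinimalPolynomial.
Variables (F : fieldType) (A : falgType F) (s : A).
Local Notation N := (\dim {:A}).
Local Notation co := (coord (vbasis {:A})).

(** Polynomials in [s] become a row space defined over F, whose rank and inclusions are insensitive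
    to field extension. *)
Definition powers d : 'M[F]_(d, N) := \matrix_(i, k) co k (s ^+ i).

Lemma horner_alg_poly d (c : 'I_d -> F) :
  horner_alg s (\sum_(i < d) c i *: 'X^i) = \sum_(i < d) c i *: s ^+ i.
Proof.
rewrite linear_sum; apply: eq_bigr => i _.
by rewrite linearZ /= rmorphXn /= horner_algX mulr_algl.
Qed.

Lemma powersE d (c : 'rV[F]_d) k :
  (c *m powers d) 0 k = co k (\sum_(i < d) c 0 i *: s ^+ i).
Proof.
rewrite mxE linear_sum; apply: eq_bigr => i _.
by rewrite linearZ /= mxE.
Qed.

Lemma co_inj (x y : A) : (forall k, co k x = co k y) -> x = y.
Proof. by move=> xy; rewrite (coE x) (coE y); apply: eq_bigr => i _; rewrite xy. Qed.

Lemma minimal_poly : exists2 mu : {poly F}, mu \is monic &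
  forall p, (horner_alg s p == 0) = (mu %| p).
Proof.
pose J p := horner_alg s p = 0.
have [c [c0 cP]] : exists c : 'rV[F]_N.+1, c != 0 /\ c *m powers N.+1 = 0.
  have k0 : kermx (powers N.+1) != 0.
    rewrite -mxrank_eq0 mxrank_ker subn_eq0 -ltnNge ltnS; exact: rank_leq_col.
  by have /rowV0Pn[c /sub_kermxP cP c0] := k0; exists c.
pose p0 := \sum_(i < N.+1) c 0 i *: 'X^i.
have Jp0 : J p0.
  rewrite /J horner_alg_poly; apply: co_inj => k.
  by rewrite -powersE cP mxE linear0.
have p00 : p0 != 0.
  apply: contraNneq c0 => p00; apply/eqP/rowP => i; rewrite mxE.
  by rewrite -(coef_sumXn (c 0) i) -/p0 p00 coef0.
have [||mu muM muE] := @poly_ideal_generator F J p0 _ _ p00 Jp0.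
- by move=> p q Jp Jq; rewrite /J rmorphB [X in X - _]Jp [X in _ - X]Jq subrr.
- by move=> p q Jp; rewrite /J rmorphM [X in _ * X]Jp mulr0.
by exists mu => // p; apply/eqP/idP => /muE.
Qed.

Lemma powers_free mu : mu \is monic ->
  (forall p, (horner_alg s p == 0) = (mu %| p)) -> row_free (powers (size mu).-1).
Proof.
move=> muM muE; rewrite -kermx_eq0; apply/rowV0P => c /sub_kermxP cP.
pose p := \sum_(i < (size mu).-1) c 0 i *: 'X^i.
have p0 : p = 0.
  apply/eqP; apply: contrapT => /negP pn0.
  have : mu %| p.
    rewrite -muE horner_alg_poly; apply/eqP/co_inj => k.
    by rewrite -powersE cP mxE linear0.
  move=> /(dvdp_leq pn0); rewrite leqNgt => /negP[].
  apply: leq_ltn_trans (size_sumXn _) _.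
  by rewrite prednK // size_poly_gt0 monic_neq0.
by apply/rowP => i; rewrite mxE -(coef_sumXn (c 0) i) -/p p0 coef0.
Qed.

End MinimalPolynomial.

(** [rep_free] states on a basis that the E-linear extension of [rho] is injective. *)
Record split_rep (F E : fieldType) (iota : {rmorphism F -> E}) (A : falgType F)
    (n : nat) (rho : A -> 'M[E]_n.+1) : Prop := SplitRep {
  rep_linear : forall c x y, rho (c *: x + y) = iota c *: rho x + rho y;
  rep_mul : forall x y, rho (x * y) = rho x *m rho y;
  rep_one : rho 1 = 1%:M;
  rep_free : forall c : 'I_(\dim {:A}) -> E,
    \sum_k c k *: rho (vbasis {:A})`_k = 0 -> forall k, c k = 0
}.

Lemma split_rep_map (F L E : fieldType) (iota : {rmorphism F -> L})
    (j : {rmorphism L -> E}) (A : falgType F) n (rho : A -> 'M[L]_n.+1) :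
  split_rep iota rho -> split_rep (j \o iota) (fun x => map_mx j (rho x)).
Proof.
move=> rR; split=> [c x y|x y||c c0 k].
- by rewrite (rep_linear rR) map_mxD map_mxZ.
- by rewrite (rep_mul rR) map_mxM.
- by rewrite (rep_one rR) map_mx1.
pose R : 'M[L]_(\dim {:A}, n.+1 * n.+1) := \matrix_k mxvec (rho (vbasis {:A})`_k).
have comb (E' : fieldType) (j' : {rmorphism L -> E'}) (c' : 'rV[E']_(\dim {:A})) :
    c' *m map_mx j' R = mxvec (\sum_k c' 0 k *: map_mx j' (rho (vbasis {:A})`_k)).
  rewrite mulmx_sum_row linear_sum; apply: eq_bigr => i _ /=.
  by rewrite linearZ /= -map_mxvec -map_row rowK.
have Rf : row_free R.
  rewrite -kermx_eq0; apply/rowV0P => c' /sub_kermxP cR.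
  apply/rowP => i; rewrite mxE; apply: (rep_free rR (c := c' 0)).
  have := comb L idfun c'; rewrite map_mx_id // cR => /esym/eqP.
  rewrite mxvec_eq0 => /eqP e; rewrite -[RHS]e; apply: eq_bigr => k' _.
  by rewrite map_mx_id.
have : row_free (map_mx j R) by rewrite row_free_map.
rewrite -kermx_eq0 => /eqP k0.
have : (\row_k c k <= kermx (map_mx j R))%MS.
  apply/sub_kermxP; rewrite comb; apply/eqP; rewrite mxvec_eq0; apply/eqP.
  by rewrite -[RHS]c0; apply: eq_bigr => i _; rewrite mxE.
by rewrite k0 submx0 => /eqP/rowP/(_ k); rewrite !mxE.
Qed.

Section SplitRep.
Variables (F E : fieldType) (iota : {rmorphism F -> E}) (A : falgType F).
Variables (n : nat) (rho : A -> 'M[E]_n.+1).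
Hypothesis rR : split_rep iota rho.
Local Notation N := (\dim {:A}).
Local Notation co := (coord (vbasis {:A})).

Lemma rep_sum (I : Type) (r : seq I) (f : I -> A) :
  rho (\sum_(i <- r) f i) = \sum_(i <- r) rho (f i).
Proof.
have rD : {morph rho : x y / x + y}.
  by move=> x y; rewrite -[x]scale1r (rep_linear rR) rmorph1 !scale1r.
by apply: (big_morph _ rD); apply: (addrI (rho 0)); rewrite -rD !addr0.
Qed.

Lemma repZ c x : rho (c *: x) = iota c *: rho x.
Proof.
have r0 : rho 0 = 0.
  by have := rep_linear rR (-1) 0 0; rewrite scaler0 addr0 rmorphN1 scaleN1r addNr.
by rewrite -[c *: x]addr0 (rep_linear rR) r0 addr0.
Qed.

Lemma repX x k : rho (x ^+ k) = rho x ^+ k.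
Proof.
by elim: k => [|k IHk]; rewrite ?(rep_one rR) // !exprS (rep_mul rR) IHk.
Qed.

Lemma rep_coE x : rho x = \sum_k iota (co k x) *: rho (vbasis {:A})`_k.
Proof.
by rewrite {1}(coE x) rep_sum; apply: eq_bigr => k _; rewrite repZ.
Qed.

Lemma rep_horner s (p : {poly F}) :
  rho (horner_alg s p) = horner_mx (rho s) (map_poly iota p).
Proof.
rewrite (poly_sumXn (leqnn (size p))) horner_alg_poly rep_sum !rmorph_sum /=.
apply: eq_bigr => i _; rewrite repZ repX map_polyZ map_polyXn linearZ /=.
by rewrite rmorphXn /= horner_mx_X.
Qed.

Lemma rep_powers s d (c : 'rV[E]_d) :
  horner_mx (rho s) (\sum_(i < d) c 0 i *: 'X^i) =
  \sum_k (c *m map_mx iota (powers s d)) 0 k *: rho (vbasis {:A})`_k.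
Proof.
rewrite rmorph_sum /=.
transitivity (\sum_(i < d) \sum_k (c 0 i * iota (co k (s ^+ i))) *: rho (vbasis {:A})`_k).
  apply: eq_bigr => i _; rewrite linearZ /= rmorphXn /= horner_mx_X -repX rep_coE.
  by rewrite scaler_sumr; apply: eq_bigr => k _; rewrite scalerA.
rewrite exchange_big; apply: eq_bigr => k _; rewrite -scaler_suml; congr (_ *: _).
by rewrite mxE; apply: eq_bigr => i _; rewrite !mxE.
Qed.

Lemma rep_inj (c c' : 'rV[E]_N) :
  \sum_k c 0 k *: rho (vbasis {:A})`_k = \sum_k c' 0 k *: rho (vbasis {:A})`_k ->
  c = c'.
Proof.
move=> /eqP; rewrite -subr_eq0 -sumrB => /eqP cc'; apply/rowP => k.
apply/eqP; rewrite -subr_eq0; apply/eqP.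
apply: (rep_free rR (c := fun k => c 0 k - c' 0 k)).
by rewrite -[RHS]cc'; apply: eq_bigr => i _; rewrite scalerBl.
Qed.

Variables (s : A) (mu : {poly F}).
Hypothesis muM : mu \is monic.
Hypothesis muE : forall p, (horner_alg s p == 0) = (mu %| p).
Hypothesis sep : separable_poly (char_poly (rho s)).

(** [mu] divides the characteristic polynomial over E: the remainder kills [rho s], while the powers
    of [s] below the degree of [mu] stay independent over E. *)
Lemma minimal_poly_separable : separable_poly mu.
Proof.
rewrite -(separable_map iota); apply: dvdp_separable sep.
set muE' := map_poly iota mu; set chi := char_poly (rho s).
have mu0 : muE' != 0 by rewrite map_poly_eq0 monic_neq0.
have hmu : horner_mx (rho s) muE' = 0.
  have := rep_horner s mu; have /eqP -> : horner_alg s mu == 0 by rewrite muE.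
  by rewrite -[0 in X in X -> _](scale0r 1) repZ rmorph0 scale0r.
pose r := chi %% muE'; pose d := (size mu).-1.
have szr : (size r <= d)%N.
  have := ltn_modpN0 chi mu0; rewrite size_map_poly -/r /d.
  by case: (size mu).
have hr : horner_mx (rho s) r = 0.
  have := Cayley_Hamilton (rho s); rewrite -/chi (divp_eq chi muE') rmorphD rmorphM.
  by rewrite /= hmu mulr0 add0r.
apply/modp_eq0P; rewrite -/r.
pose c : 'rV[E]_d := \row_i r`_i.
have rE : r = \sum_(i < d) c 0 i *: 'X^i.
  by rewrite {1}(poly_sumXn szr); apply: eq_bigr => i _; rewrite mxE.
have : c *m map_mx iota (powers s d) = 0.
  by apply: rep_inj; rewrite -rep_powers -rE hr big1 // => k _; rewrite mxE scale0r.
have : row_free (map_mx iota (powers s d)) by rewrite row_free_map (powers_free muM muE).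
rewrite -kermx_eq0 => /eqP k0 /sub_kermxP; rewrite k0 submx0 => /eqP c0.
by rewrite rE c0 big1 // => i _; rewrite mxE scale0r.
Qed.

(** Over E the image of [y] is a polynomial in that of [s]; membership in a row space defined over F
    descends to F. *)
Lemma commutant_powers (rs : seq E) y :
  char_poly (rho s) = \prod_(z <- rs) ('X - z%:P) ->
  s * y = y * s -> exists p, y = horner_alg s p.
Proof.
move=> chiE sy.
have [q qE] : exists q, rho y = horner_mx (rho s) q.
  by apply: (commutant_separable sep chiE); rewrite -!(rep_mul rR) sy.
pose d := size q; pose c : 'rV[E]_d := \row_i q`_i.
have cE : \row_k iota (co k y) = c *m map_mx iota (powers s d).
  apply: rep_inj; rewrite -rep_powers.
  have -> : \sum_(i < d) c 0 i *: 'X^i = q.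
    by rewrite [RHS](poly_sumXn (leqnn (size q))); apply: eq_bigr => i _; rewrite mxE.
  by rewrite -qE rep_coE; apply: eq_bigr => k _; rewrite mxE.
have : (map_mx iota (\row_k co k y) <= map_mx iota (powers s d))%MS.
  apply/submxP; exists c; rewrite -cE; apply/rowP => k; by rewrite !mxE.
rewrite map_submx => /submxP[b bE].
exists (\sum_(i < d) b 0 i *: 'X^i); rewrite horner_alg_poly.
by apply: co_inj => k; rewrite -powersE -bE mxE.
Qed.

End SplitRep.

(** Orthogonality enters here: a symmetric form over L has self-adjoint operators with distinct
    eigenvalues, whereas the symmetric elements of a symplectic involution have characteristic
    polynomials that are squares. Such an operator is an L-combination of the symmetrized basis
    elements [sk] of A, and its coefficients can be replaced by natural numbers. *)
Lemma generic_symmetric (F : fieldType) (A : falgType F) (sigma : A -> A) :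
  (forall k, k.+1%:R != 0 :> F) -> orthogonal_involution sigma ->
  exists (s : A) (mu : {poly F}),
    [/\ sigma s = s, mu \is monic, separable_poly mu,
        forall p, (horner_alg s p == 0) = (mu %| p) &
        forall y, s * y = y * s -> exists p, y = horner_alg s p].
Proof.
move=> char0 [sI [L [iota [n [phi [S [phib Su ST phiS]]]]]]].
have char0L k : k.+1%:R != 0 :> L by rewrite -(rmorph_nat iota) fmorph_eq0.
pose t (a : A) := tens iota a (1 : L^o).
pose rho (a : A) := phi (t a).
have phi0 x : phi x = 0 -> x = 0.
  by move=> x0; apply: (bij_inj phib); rewrite x0 linear0.
have rR : split_rep iota rho.
  split=> [c x y|x y||c].
  - by rewrite /rho /t tensDl tensZl tensZr linearD linearZ.
  - by rewrite /rho /t mulmxE -rmorphM tensM mulr1.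
  - by rewrite /rho /t tens1 rmorph1.
  move=> c0 k; pose x : tensor iota A L^o := [ffun k => c k].
  have x0 : x = 0.
    apply: phi0; rewrite [x]tens_coord linear_sum -[RHS]c0; apply: eq_bigr => i _.
    by rewrite tensE linearZ ffunE.
  by have /ffunP/(_ k) := x0; rewrite !ffunE.
have [X [SX sepX]] := self_adjoint_separable char0L ST Su.
pose x := sval (cid (let: Bijective g _ gK := phib in ex_intro (fun x => phi x = X) (g X) (gK X))).
have phix : phi x = X by rewrite /x; case: cid.
pose sig := ext_inv sigma : tensor iota A L^o -> tensor iota A L^o.
have sigx : sig x = x.
  apply: (bij_inj phib).
  have h : (phi (sig x))^T *m S = X^T *m S.
    transitivity (S *m phi x); first exact: phiS.
    by rewrite phix -SX trmx_mul ST.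
  by apply: trmx_inj; rewrite phix; apply: (can_inj (mulmxK Su)).
pose sk k := (2%:R^-1 : F) *: ((vbasis {:A})`_k + sigma (vbasis {:A})`_k).
have sE : x = \sum_k x k *: t (sk (val k)).
  have two (u : tensor iota A L^o) : u = iota 2%:R^-1 *: (u + u).
    by rewrite -mulr2n -scaler_nat scalerA fmorphV rmorph_nat mulVf ?(char0L 1%N) // scale1r.
  have xE : x = \sum_k x k *: t (vbasis {:A})`_k.
    by rewrite [LHS]tens_coord; apply: eq_bigr => k _; rewrite tensE.
  have sxE : sig x = \sum_k x k *: t (sigma (vbasis {:A})`_k).
    have sigL : linear sig := @ext_invL F L iota A sigma.
    rewrite [x in LHS]xE (semilin_sum sig (@scale1r _ _) sigL); apply: eq_bigr => k _.
    rewrite (semilinZ sig (@scale1r _ _) sigL); congr (_ *: _).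
    exact: ext_inv_tens.
  rewrite [LHS]two -{2}sigx {1}xE sxE -big_split scaler_sumr; apply: eq_bigr => k _.
  rewrite /= -scalerDr scalerA mulrC -scalerA; congr (_ *: _).
  by rewrite /t /sk tensZl tensZr tensDl.
have [|a sep] := @generic_separable L n.+1 (\dim {:A}) (fun k => rho (sk (val k))) x 0 char0L.
  rewrite add0r; have -> // : \sum_i x i *: rho (sk (val i)) = X.
  by rewrite -phix [in RHS]sE linear_sum; apply: eq_bigr => k _; rewrite linearZ.
pose s := \sum_k (a k)%:R *: sk (val k).
have rhos : rho s = 0 + \sum_k (a k)%:R *: rho (sk (val k)).
  by rewrite add0r /s (rep_sum rR); apply: eq_bigr => k _; rewrite (repZ rR) rmorph_nat.
rewrite -rhos in sep.
have sL := involution_linear sI.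
have ss : sigma s = s.
  rewrite /s (semilin_sum sigma (@scale1r _ _) sL); apply: eq_bigr => k _.
  rewrite !(semilinZ sigma (@scale1r _ _) sL) (semilinD sigma (@scale1r _ _) sL).
  by rewrite (involution_invol sI) addrC.
have [E [j [rs]]] := splitting_field (monic_neq0 (char_poly_monic (rho s))).
rewrite eqp_monic ?map_monic ?char_poly_monic ?monic_prod_XsubC // => /eqP chiE.
have rR' := split_rep_map j rR.
have sep' : separable_poly (char_poly (map_mx j (rho s))).
  by rewrite -map_char_poly separable_map.
have chiE' : char_poly (map_mx j (rho s)) = \prod_(z <- rs) ('X - z%:P).
  by rewrite -map_char_poly.
have [mu muM muE] := minimal_poly s.
exists s, mu; split=> //.
- exact: (minimal_poly_separable rR' muM muE sep').
- by move=> y; apply: (commutant_powers rR' sep' chiE').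
Qed.

(** * Matrix units from a symmetric idempotent of rank one *)

Section MatrixUnits.
Variables (M : fieldType) (B : algType M) (sg : B -> B) (T : B -> M).
Hypotheses (sgL : linear sg) (sgM : forall x y, sg (x * y) = sg y * sg x).
Hypothesis sgK : involutive sg.
Hypothesis TL : forall c x y, T (c *: x + y) = c * T x + T y.
Hypothesis TC : forall x y, T (x * y) = T (y * x).
Hypothesis T_nondeg : forall x, (forall y, T (x * y) = 0) -> x = 0.
Variables (n N : nat) (b : 'I_n -> B) (p q : 'I_N -> B).
Hypothesis b_span : forall x, exists c : 'I_n -> M, x = \sum_i c i *: b i.
Hypothesis pq_casimir : forall x, \sum_i p i * x * q i = (T x)%:A.
Variable e : B.
Hypotheses (e_neq0 : e != 0) (ee : e * e = e) (sge : sg e = e).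
Hypothesis e_rank1 : forall x, exists c, e * x * e = c *: e.

(* The Casimir identity replaces the simplicity of [B]. *)
Lemma corner_eq0 y : (forall x, y * x * e = 0) -> y = 0.
Proof.
move=> ye.
have TZy z : T (e * z) *: y = 0.
  rewrite -mulr_algr -pq_casimir mulr_sumr big1 // => i _.
  by rewrite !mulrA ye !mul0r.
apply/eqP; apply: contraNT e_neq0 => y0; apply/eqP/T_nondeg => z.
by have /eqP := TZy z; rewrite scaler_eq0 (negPf y0) orbF => /eqP.
Qed.

Let sgZ c x : sg (c *: x) = c *: sg x.
Proof. exact: (semilinZ sg (@scale1r _ _) sgL). Qed.

(** The corner of [e] consists of scalars, so the corner component of [sg x * y] is a symmetric
    bilinear form [beta] with values in M. An orthogonal frame [w] of it gives v_i = w_i e, and the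
    resolution of 1 is Parseval's identity. *)
Lemma rank1_matrix_units : 2%:R != 0 :> M ->
  exists (I : finType) (v : I -> B) (phi : I -> M),
    [/\ forall i, phi i != 0,
        forall i j, sg (v i) * v j = (phi i *: e) *+ (i == j),
        forall i, v i * e = v i &
        \sum_i (phi i)^-1 *: (v i * sg (v i)) = 1].
Proof.
move=> M2.
pose cf x : M := projT1 (cid (e_rank1 x)).
have cfE x : e * x * e = cf x *: e by rewrite /cf; case: cid.
have cf_uniq x m : e * x * e = m *: e -> cf x = m.
  rewrite cfE => /eqP; rewrite -subr_eq0 -scalerBl scaler_eq0 (negPf e_neq0) orbF.
  by rewrite subr_eq0 => /eqP.
have cfL c x y : cf (c *: x + y) = c * cf x + cf y.
  apply: cf_uniq; rewrite mulrDr mulrDl -scalerAr -scalerAl !cfE.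
  by rewrite scalerA -scalerDl.
pose beta x y := cf (sg x * y).
have bS x y : beta x y = beta y x.
  apply: cf_uniq; have -> : e * (sg x * y) * e = sg (e * (sg y * x) * e).
    by rewrite !sgM sgK sge !mulrA.
  by rewrite cfE sgZ sge.
have bL c x y z : beta (c *: x + y) z = c * beta x z + beta y z.
  by rewrite /beta sgL mulrDl -scalerAl cfL.
have [|I [w [[wo w0] wE]]] := @frame_exists M B n beta b M2 bS bL.
  move=> x; have [c xE] := b_span x; exists c => y.
  have bL' a u v := bL a u v y.
  rewrite {1}xE (semilin_sum (beta^~ y) (@mul1r M) bL'); apply: eq_bigr => i _.
  exact: (semilinZ (beta^~ y) (@mul1r M) bL').
exists I, (fun i => w i * e), (fun i => beta (w i) (w i)); split=> //.
- move=> i j; rewrite sgM sge -mulrA [_ * (w j * e)]mulrA mulrA cfE -/(beta _ _).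
  by case: eqVneq => [->|/wo->]; rewrite ?mulr1n ?scale0r ?mulr0n.
- by move=> i; rewrite -mulrA ee.
(* The defect [y] of the resolution of 1 has vanishing corners e x y z e for all x and z;
   [corner_eq0] then removes the factors on both sides. *)
apply/eqP; rewrite eq_sym -subr_eq0; apply/eqP; set y := _ - _.
have yE x z : e * (x * (y * z)) * e = 0.
  have -> : x * (y * z) = x * z -
      \sum_i (beta (w i) (w i))^-1 *: ((x * w i) * e * (sg (w i) * z)).
    rewrite /y mulrBl mul1r mulrBr mulr_suml mulr_sumr; congr (_ - _).
    apply: eq_bigr => i _; rewrite -scalerAl -scalerAr; congr (_ *: _).
    by rewrite sgM sge !mulrA -[x * w i * e * e]mulrA ee.
  rewrite mulrBr mulrBl cfE mulr_sumr mulr_suml; apply/eqP; rewrite subr_eq0; apply/eqP.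
  have -> : cf (x * z) = beta (sg x) z by rewrite /beta sgK.
  rewrite wE scaler_suml; apply: eq_bigr => i _.
  have -> : e * ((beta (w i) (w i))^-1 *: (x * w i * e * (sg (w i) * z))) * e =
      (beta (w i) (w i))^-1 *: ((e * (x * w i) * e) * (e * (sg (w i) * z) * e)).
    by rewrite -scalerAr -scalerAl !mulrA -[_ * e * e]mulrA ee.
  rewrite !cfE -scalerAl -scalerAr ee !scalerA; congr (_ *: _).
  by rewrite /beta sgK mulrC mulrA.
have yz z : y * z * e = 0.
  have sg0 : sg 0 = 0 by rewrite -(scale0r 0) sgZ !scale0r.
  apply: (can_inj sgK); rewrite sg0; apply: corner_eq0 => x.
  transitivity (sg (e * (sg x * (y * z)) * e)); last by rewrite yE.
  by rewrite !sgM sgK sge !mulrA.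
exact: corner_eq0.
Qed.

Section Frame.
Variables (I : finType) (v : I -> B) (phi : I -> M).
Hypothesis phi0 : forall i, phi i != 0.
Hypothesis vv : forall i j, sg (v i) * v j = (phi i *: e) *+ (i == j).
Hypothesis ve : forall i, v i * e = v i.
Hypothesis v1 : \sum_i (phi i)^-1 *: (v i * sg (v i)) = 1.

Let T0 : T 0 = 0.
Proof. exact: (semilin0 T (@mul1r M) TL). Qed.

Let TZ c x : T (c *: x) = c * T x.
Proof. exact: (semilinZ T (@mul1r M) TL). Qed.

Let T_sum (J : finType) (x : J -> B) : T (\sum_j x j) = \sum_j T (x j).
Proof. exact: (semilin_sum T (@mul1r M) TL). Qed.

Lemma trace_matrix_unit i j : T (v i * sg (v j)) = (phi i * T e) *+ (i == j).
Proof. by rewrite TC vv eq_sym; case: eqP => [->|_]; rewrite ?mulr1n ?TZ. Qed.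

Lemma trace_one_rank1 : T 1 = #|I|%:R * T e.
Proof.
rewrite -v1 T_sum (eq_bigr (fun=> T e)) => [|i _].
  by rewrite sumr_const mulr_natl.
by rewrite TZ trace_matrix_unit eqxx mulKf.
Qed.

(** The products v_i sg(v_j) are matrix units up to scalars, hence an orthogonal basis; coordinates
    come from inserting the resolution of 1 on both sides of an element. *)
Lemma matrix_unit_frame : T 1 != 0 ->
  frame (fun x y => T (sg x * y)) (fun ij : I * I => v ij.1 * sg (v ij.2)) /\
  forall ij : I * I, T (sg (v ij.1 * sg (v ij.2)) * (v ij.1 * sg (v ij.2))) =
    phi ij.1 * phi ij.2 * T e.
Proof.
rewrite trace_one_rank1 mulf_eq0 negb_or => /andP[_ Te].
pose E (ij : I * I) := v ij.1 * sg (v ij.2).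
have EE (x y : I * I) : T (sg (E x) * E y) = (phi x.1 * phi x.2 * T e) *+ (x == y).
  rewrite /E sgM sgK mulrA -[v x.2 * _ * _]mulrA vv.
  case: x y => [i j] [k l] /=; rewrite xpair_eqE.
  have [_|_] /= := eqVneq i k; last by rewrite mulr0 mul0r T0.
  by rewrite -scalerAr ve -scalerAl TZ trace_matrix_unit -mulrnAr -mulrnAr mulrA.
have EEn x : T (sg (E x) * E x) != 0.
  by rewrite EE eqxx !mulf_neq0.
split; last by move=> x; rewrite -/(E x) EE eqxx.
split.
  by split=> [x y xy|//]; rewrite EE (negPf xy).
move=> x y; pose cf z : M := projT1 (cid (e_rank1 z)).
have cfE z : e * z * e = cf z *: e by rewrite /cf; case: cid.
pose c (ij : I * I) := cf (sg (v ij.1) * y * v ij.2) / (phi ij.1 * phi ij.2).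
have yE : y = \sum_ij c ij *: E ij.
  rewrite -[LHS]mul1r -[LHS]mulr1 -v1 !mulr_suml.
  rewrite (eq_bigr (fun ij => c (ij.1, ij.2) *: E (ij.1, ij.2))); last by case.
  rewrite -(pair_bigA _ (fun i j => c (i, j) *: E (i, j))); apply: eq_bigr => i _.
  rewrite mulr_sumr; apply: eq_bigr => j _ /=.
  rewrite -scalerAr -!scalerAl scalerA /c /E /= mulrC -invfM mulrC.
  rewrite [cf _ / _]mulrC -scalerA; congr (_ *: _).
  transitivity (v i * (e * (sg (v i) * y * v j) * e) * sg (v j)).
    by rewrite !mulrA ve -[_ * v j * e]mulrA ve.
  by rewrite cfE -scalerAr -scalerAl ve.
rewrite {1}yE mulr_sumr T_sum; apply: eq_bigr => ij _.
rewrite -scalerAr TZ mulrC -mulrA; congr (_ * _).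
rewrite yE mulr_sumr T_sum (bigD1 ij) //= big1 => [|kl kl_ij].
  by rewrite addr0 -scalerAr TZ mulfK //; apply: EEn.
by rewrite -scalerAr TZ EE eq_sym (negPf kl_ij) mulr0.
Qed.

End Frame.

End MatrixUnits.

(** * A Pfister form isometric to its negative over the split algebra *)

Section EmbProducts.
Variables (M : fieldType) (B : algType M) (sg : B -> B) (e : B).
Hypotheses (sgL : linear sg) (sgM : forall x y, sg (x * y) = sg y * sg x).
Hypothesis sgK : involutive sg.
Variables (I : finType) (v : I -> B) (l eps : I -> M) (tau : I -> I).
Hypotheses (l0 : forall k, l k != 0) (eps2 : forall k, eps k * eps k = 1).
Hypothesis vv : forall i j, sg (v i) * v j = ((eps i * l i)^-1 *: e) *+ (i == j).
Hypothesis ve : forall i, v i * e = v i.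
Hypothesis v1 : \sum_i (eps i * l i) *: (v i * sg (v i)) = 1.
Hypotheses (tau_bij : bijective tau) (eps_tau : forall k, eps (tau k) = - eps k).

Let sgD : {morph sg : x y / x + y}.
Proof. exact: (semilinD sg (@scale1r _ _) sgL). Qed.

Let sg0 : sg 0 = 0.
Proof. exact: (semilin0 sg (@scale1r _ _) sgL). Qed.

Let sgZ c x : sg (c *: x) = c *: sg x.
Proof. exact: (semilinZ sg (@scale1r _ _) sgL). Qed.

Let sg1 : sg 1 = 1.
Proof. by rewrite -[LHS]mul1r -{1}[1]sgK -sgM mul1r sgK. Qed.

Let eps0 k : eps k != 0.
Proof. by apply: contraTneq isT => k0; have := eps2 k; rewrite k0 mul0r => /eqP; rewrite eq_sym oner_eq0. Qed.

Lemma emb_scalar_scale (J : finType) (w : B) (a b r : J -> M) :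
  (forall j, b j * r j ^+ 2 = a j) ->
  emb sg (fun j => a j *: w) (fun j => b j *: w).
Proof.
move=> ab; apply: (emb_matrix sgD sgM (u := fun j i => if j == i then (r j)%:A else 0)) => i i'.
rewrite (bigD1 i) //= big1 => [|j ji]; last by rewrite (negPf ji) sg0 !mul0r.
rewrite eqxx addr0; case: eqVneq => [_|_]; last by rewrite mulr0.
rewrite sgZ sg1 mulr1n -!scalerAl mul1r -scalerAr mulr1 !scalerA -ab.
by congr (_ *: _); rewrite expr2; ring.
Qed.

Definition prod_over (S : {set I}) : M := \prod_(k in S) l k.
Local Notation c := prod_over.

(** The resolution of 1 decomposes <1> into rank-one pieces, the columns being the [sg (v k)]. Their
    coefficients are multiples of [e] and need not be units, which one-directional embeddings
    tolerate. *)
Lemma emb_split : emb sg (fun S => (c S)%:A)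
  (fun x : {set I} * I => (c x.1 * (eps x.2 * l x.2)) *: e).
Proof.
apply: (emb_matrix sgD sgM (u := fun x S => if x.1 == S then sg (v x.2) else 0)) => S S'.
rewrite -(pair_bigA _ (fun R k => sg (if R == S then sg (v k) else 0) *
   ((c R * (eps k * l k)) *: e) * (if R == S' then sg (v k) else 0))) /=.
rewrite (bigD1 S) //= [X in _ + X]big1 => [|R RS]; last first.
  by rewrite big1 // => k _; rewrite (negPf RS) sg0 !mul0r.
rewrite addr0 eqxx; case: eqVneq => [_|_]; last first.
  by rewrite big1 // => k _; rewrite mulr0.
rewrite mulr1n -v1 scaler_sumr; apply: eq_bigr => k _.
by rewrite sgK -scalerAr -scalerAl ve scalerA.
Qed.

Lemma emb_merge : emb sg (fun x : {set I} * I => (- c x.1 * (eps x.2 * l x.2)) *: e)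
  (fun S => (- c S)%:A).
Proof.
apply: (emb_matrix sgD sgM
  (u := fun S x => if x.1 == S then (eps x.2 * l x.2) *: v x.2 else 0)) => -[S k] [S' k'] /=.
rewrite (bigD1 S) //= big1 => [|R RS]; last first.
  by rewrite eq_sym (negPf RS) sg0 !mul0r.
rewrite addr0 eqxx xpair_eqE eq_sym; case: eqVneq => [_|_]; last by rewrite mulr0.
rewrite sgZ -!scalerAl mulr_algr -!scalerAl -scalerAr vv scalerA.
case: eqVneq => [->|_]; last by rewrite !mulr0n !scaler0.
by rewrite !mulr1n !scalerA; congr (_ *: _); field; rewrite l0 eps0.
Qed.

Definition symdiff1 (S : {set I}) k := if k \in S then S :\ k else k |: S.

Lemma symdiff1K k : involutive (symdiff1^~ k).
Proof.
move=> S; rewrite /symdiff1; case: (boolP (k \in S)) => kS.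
  by rewrite finset.setD11 finset.setD1K.
by rewrite finset.setU11 finset.setU1K.
Qed.

(* Up to squares, multiplication by [eps k * l k] permutes the slots of the Pfister
   form and multiplies by the sign [eps k], which [tau] reverses. *)
Lemma prod_symdiff1 S k :
  c S * (eps k * l k) = eps k * c (symdiff1 S k) * (if k \in S then l k else 1) ^+ 2.
Proof.
rewrite /symdiff1 /c; case: (boolP (k \in S)) => kS.
  by rewrite (big_setD1 k kS) /=; ring.
by rewrite (big_setU1 _ kS) /=; ring.
Qed.

(** After splitting, toggling [k] in [S] trades the coefficient c_S eps_k l_k for eps_k c_S up to
    squares. There [tau] can flip the sign, and the same steps taken backwards reassemble the
    negative form. *)
Lemma emb_prod_over : emb sg (fun S => (c S)%:A) (fun S => (- c S)%:A).
Proof.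
pose f (x : {set I} * I) := (symdiff1 x.1 x.2, x.2).
have fK : involutive f by case=> S k; rewrite /f /= symdiff1K.
pose a s (x : {set I} * I) := s * (eps x.2 * c x.1).
pose W s x := a s x *: e.
have step1 : emb sg (fun x : {set I} * I => (c x.1 * (eps x.2 * l x.2)) *: e) (W 1 \o f).
  apply: (@emb_scalar_scale _ e (fun x => c x.1 * (eps x.2 * l x.2)) (a 1 \o f)
    (fun x => if x.2 \in x.1 then l x.2 else 1)).
  by move=> -[S k] /=; rewrite /a mul1r prod_symdiff1.
have step2 : emb sg (W 1 \o f) (W 1).
  by apply: (emb_reindex sg (h := f)) => //; exists f.
have step3 : emb sg (W 1) (W (-1)).
  apply: (emb_reindex sg (h := fun x => (x.1, tau x.2))) => [|[S k]].
    have [tau' tK tK'] := tau_bij.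
    by exists (fun x => (x.1, tau' x.2)) => -[S k] /=; rewrite ?tK ?tK'.
  by rewrite /W /a /= eps_tau; congr (_ *: _); ring.
have step4 : emb sg (W (-1)) (W (-1) \o f).
  by apply: (emb_reindex sg (h := f)) => [|x]; [exists f|rewrite /= fK].
have step5 : emb sg (W (-1) \o f) (fun x : {set I} * I => (- c x.1 * (eps x.2 * l x.2)) *: e).
  apply: (@emb_scalar_scale _ e (a (-1) \o f) (fun x => - c x.1 * (eps x.2 * l x.2))
    (fun x => if x.2 \in x.1 then (l x.2)^-1 else 1)).
  move=> -[S k] /=; rewrite /a mulNr prod_symdiff1; case: ifP => _; last by ring.
  by field; apply: l0.
exact: emb_trans emb_split (emb_trans step1 (emb_trans step2 (emb_trans step3
  (emb_trans step4 (emb_trans step5 emb_merge))))).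
Qed.

End EmbProducts.

(** The two sign classes have equal size, so their enumerations are matched position by position. *)
Lemma sign_reversing_bijection (I : finType) (s : I -> int) :
  (forall i, s i = 1 \/ s i = -1) -> \sum_i s i = 0 ->
  exists2 tau : I -> I, bijective tau & forall i, s (tau i) = - s i.
Proof.
move=> s1 s0; pose E (b : bool) := enum [pred i | s i == (-1) ^+ b].
have sE i (b : bool) : (s i == (-1) ^+ b) = (b == (s i == -1)).
  by case: (s1 i) => ->; case: b.
have memE i b : (i \in E b) = (b == (s i == -1)) by rewrite mem_enum -sE.
have szE : size (E true) = size (E false).
  have : \sum_i s i = (size (E false))%:Z - (size (E true))%:Z.
    rewrite -!cardE -[Posz #|_|]natz -[Posz #|[pred i | s i == (-1) ^+ true]|]natz.
    rewrite -!sum1_card !natr_sum [X in _ = X - _]big_mkcond [X in _ = _ - X]big_mkcond -sumrB.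
    by apply: eq_bigr => i _; rewrite !inE /=; case: (s1 i) => ->.
  by rewrite s0 => /esym/eqP; rewrite subr_eq0 => /eqP[].
have szEb b : size (E b) = size (E (~~ b)) by case: b.
pose b i := s i == -1; pose tau i := nth i (E (~~ b i)) (index i (E (b i))).
have iE i : i \in E (b i) by rewrite memE.
have lt_i i : (index i (E (b i)) < size (E (~~ b i)))%N by rewrite -szEb index_mem.
have btau i : b (tau i) = ~~ b i.
  by have := mem_nth i (lt_i i); rewrite memE -/(tau i) => /eqP.
exists tau.
  exists tau => i; rewrite /tau /= -/(tau i) btau negbK;
  by rewrite /tau index_uniq ?lt_i ?enum_uniq // (set_nth_default i) ?nth_index ?index_mem.
move=> i; have := btau i; rewrite /b.
by case: (s1 i) => ->; case: (s1 (tau i)) => ->.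
Qed.

(** * The rank-one idempotent attached to a root of the minimal polynomial *)

Section RankOne.
Variables (F M : fieldType) (iota : {rmorphism F -> M}).
Variables (A : falgType F) (sigma : A -> A) (s : A) (mu : {poly F}) (al : M).
Hypotheses (sI : first_kind_involution sigma) (ss : sigma s = s).
Hypotheses (muM : mu \is monic) (mu_sep : separable_poly mu).
Hypothesis muE : forall p, (horner_alg s p == 0) = (mu %| p).
Hypothesis commutant : forall y, s * y = y * s -> exists p, y = horner_alg s p.
Hypothesis mu_al : (map_poly iota mu).[al] = 0.

Local Notation B := (tensor iota A M^o).
Local Notation N := (\dim {:A}).
Local Notation co := (coord (vbasis {:A})).
Local Notation t a := (tens iota a (1 : M^o)).
Local Notation S := (t s).

Lemma tens_expr k : S ^+ k = t (s ^+ k).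
Proof. by elim: k => [|k IHk]; rewrite ?expr0 ?tens1 // !exprS IHk tensM mulr1. Qed.

Lemma ext_horner_alg d (c : 'I_d -> M) :
  horner_alg S (\sum_(i < d) c i *: 'X^i) = \sum_(i < d) c i *: t (s ^+ i).
Proof.
rewrite linear_sum; apply: eq_bigr => i _.
by rewrite linearZ /= rmorphXn /= horner_algX tens_expr mulr_algl.
Qed.

Lemma ext_horner_alg_map p : horner_alg S (map_poly iota p) = t (horner_alg s p).
Proof.
rewrite (poly_sumXn (leqnn (size p))) horner_alg_poly tens_suml rmorph_sum /=.
rewrite (eq_bigr (fun i : 'I_(size p) => iota p`_i *: 'X^i)) => [|i _]; last first.
  by rewrite map_polyZ map_polyXn.
by rewrite ext_horner_alg; apply: eq_bigr => i _; rewrite tensZl tensZr.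
Qed.

(** Commuting with [s] is a linear system with matrix [Ad] over F; its solutions over M are spanned
    by those over F, which are the polynomials in [s]. *)
Lemma ext_commutant (y : B) : S * y = y * S -> exists p, y = horner_alg S p.
Proof.
move=> Sy; pose d := (size mu).-1.
pose Ad : 'M[F]_N := \matrix_(k, j) co j (s * (vbasis {:A})`_k - (vbasis {:A})`_k * s).
have kerAd : (kermx Ad <= powers s d)%MS.
  apply/row_subP => i; have := row_sub i (kermx Ad).
  move: (row i _) => u /sub_kermxP uAd.
  pose x := \sum_k u 0 k *: (vbasis {:A})`_k.
  have [p xp] : exists p, x = horner_alg s p.
    apply: commutant; apply/eqP; rewrite -subr_eq0; apply/eqP/co_inj => j.
    rewrite linear0; have /rowP/(_ j) := uAd; rewrite !mxE => uj; rewrite -[RHS]uj.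
    rewrite /x mulr_sumr mulr_suml -sumrB linear_sum; apply: eq_bigr => k _.
    by rewrite mxE -scalerAl -scalerAr -scalerBr linearZ.
  have {}xp : x = horner_alg s (p %% mu).
    rewrite xp [in LHS](divp_eq p mu) rmorphD rmorphM /=.
    have /eqP -> : horner_alg s mu == 0 by rewrite muE.
    by rewrite mulr0 add0r.
  have sz : (size (p %% mu)%R <= d)%N.
    have := ltn_modpN0 p (monic_neq0 muM); rewrite /d; by case: (size mu).
  apply/submxP; exists (\row_i (p %% mu)`_i); apply/rowP => k.
  rewrite powersE -[u 0 k](coord_sum_free (u 0) k (basis_free (vbasisP {:A}))) -/x xp.
  rewrite {1}(poly_sumXn sz) horner_alg_poly; congr (co k _).
  by apply: eq_bigr => j _; rewrite mxE.
pose c : 'rV[M]_N := \row_k y k.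
have cAd : c *m map_mx iota Ad = 0.
  apply/rowP => j; rewrite !mxE.
  have /ffunP/(_ j) : S * y - y * S = 0 by rewrite Sy subrr.
  rewrite {1 2}[y]tens_coord mulr_sumr mulr_suml -sumrB sum_ffunE !ffunE => h.
  rewrite -[RHS]h; apply: eq_bigr => k _; rewrite !mxE !ffunE.
  by rewrite !tensM mul1r mulr1 !ffunE linearB rmorphB mulrC -scalerBl.
have : (c <= map_mx iota (powers s d))%MS.
  apply: (@submx_trans _ _ _ _ _ _ (map_mx iota (kermx Ad))); last by rewrite map_submx.
  by rewrite map_kermx; apply/sub_kermxP.
move=> /submxP[b cb]; exists (\sum_(i < d) b 0 i *: 'X^i).
rewrite ext_horner_alg; apply/ffunP => k; rewrite sum_ffunE.
have /rowP/(_ k) := cb; rewrite !mxE => ->; apply: eq_bigr => i _.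
by rewrite !mxE !ffunE; congr (_ * _); rewrite [RHS]mulr1.
Qed.

(** With h = [mu]/(X - [al]), the element h(s)/h(al) is the projection onto the eigenvalue [al]. Any
    e x e commutes with [s], hence is a polynomial in [s], and such polynomials act on [e] by
    scalars. *)
Lemma rank1_idempotent : exists e : B,
  [/\ e != 0, e * e = e, ext_inv sigma e = e &
      forall x, exists m, e * x * e = m *: e].
Proof.
have [h hE] : exists h, map_poly iota mu = h * ('X - al%:P).
  by apply/factor_theorem/eqP.
have hal : h.[al] != 0.
  have : separable_poly (map_poly iota mu) by rewrite separable_map.
  rewrite hE separable_mul => /and3P[_ _].
  by rewrite coprimep_XsubC rootE.
pose E := horner_alg S h.
have hM : h \is monic.
  have : map_poly iota mu \is monic by rewrite map_monic.
  by rewrite hE monicMr // monicXsubC.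
have sz : size h = (size mu).-1.
  rewrite -(size_map_poly iota mu) hE size_Mmonic ?monic_neq0 ?monicXsubC //.
  by rewrite size_XsubC addn2.
(* [h] has smaller degree than [mu], and the powers of [s] below that degree stay independent over
   M. *)
have E0 : E != 0.
  apply: contraNneq hal => E0.
  pose c : 'rV[M]_(size mu).-1 := \row_i h`_i.
  have hc : h = \sum_(i < (size mu).-1) c 0 i *: 'X^i.
    rewrite {1}(poly_sumXn (eq_leq sz)).
    by apply: eq_bigr => j _; rewrite mxE.
  have : c *m map_mx iota (powers s (size mu).-1) = 0.
    apply/rowP => k; rewrite !mxE; have /ffunP/(_ k) := E0.
    rewrite /E hc ext_horner_alg sum_ffunE !ffunE => hk; rewrite -[RHS]hk.
    by apply: eq_bigr => i _; rewrite !mxE !ffunE; congr (_ * _); rewrite [RHS]mulr1.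
  have : row_free (map_mx iota (powers s (size mu).-1)).
    by rewrite row_free_map (powers_free muM muE).
  rewrite -kermx_eq0 => /eqP k0 /sub_kermxP; rewrite k0 submx0 => /eqP c0.
  by rewrite hc c0 big1 ?horner0 // => i _; rewrite mxE scale0r.
have pE p : horner_alg S p * E = p.[al] *: E.
  have [q pq] : exists q, p - p.[al]%:P = q * ('X - al%:P).
    by apply/factor_theorem; rewrite rootE !hornerE subrr.
  have -> : p = q * ('X - al%:P) + p.[al]%:P by rewrite -pq subrK.
  move: (p.[al]) => a; rewrite hornerD hornerM hornerXsubC subrr mulr0 add0r hornerC.
  rewrite rmorphD /= horner_algC mulrDl mulr_algl /E -rmorphM -mulrA.
  rewrite [_ * h]mulrC -hE rmorphM /= ext_horner_alg_map.
  have /eqP -> : horner_alg s mu == 0 by rewrite muE.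
  by rewrite tens0l mulr0 add0r.
have EC p : E * horner_alg S p = horner_alg S p * E.
  by rewrite /E -!rmorphM mulrC.
exists (h.[al]^-1 *: E); split.
- by rewrite scaler_eq0 invr_eq0 negb_or hal.
- by rewrite -scalerAl -scalerAr pE !scalerA; congr (_ *: E); field.
- have L := @ext_invL F M iota A sigma.
  have sZ := semilinZ (@ext_inv F M iota A sigma) (@scale1r _ _) L.
  rewrite sZ /E (poly_sumXn (leqnn (size h))) ext_horner_alg (semilin_sum _ (@scale1r _ _) L).
  congr (_ *: _); apply: eq_bigr => i _; rewrite sZ (ext_inv_tens iota sI).
  by rewrite (involutionX sI).
move=> x; set e := _ *: E.
have eE p : horner_alg S p * e = p.[al] *: e.
  by rewrite /e -scalerAr pE !scalerA mulrC.
have Ee p : e * horner_alg S p = p.[al] *: e.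
  by rewrite -eE /e -scalerAl EC scalerAr.
have ee : e * e = e.
  by rewrite /e -scalerAl -scalerAr pE !scalerA; congr (_ *: E); field.
have [p yp] : exists p, e * x * e = horner_alg S p.
  apply: ext_commutant; have SX : S = horner_alg S 'X by rewrite horner_algX.
  transitivity (al *: (e * x * e)).
    by rewrite SX !mulrA eE hornerX -!scalerAl.
  by rewrite SX -[RHS]mulrA Ee hornerX -[RHS]scalerAr.
exists p.[al]; rewrite -eE -yp. by rewrite -[RHS]mulrA ee.
Qed.

End RankOne.

(** * The Pfister form over M obtained from a balanced trace form *)

Section ExtendedEmb.
Variables (F M : fieldType) (iota : {rmorphism F -> M}).
Variables (A : falgType F) (sigma : A -> A).
Hypothesis char0 : forall n, n.+1%:R != 0 :> F.
Hypothesis A_csa : central_simple A.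
Hypothesis sI : first_kind_involution sigma.

Local Notation B := (tensor iota A M^o).
Local Notation N := (\dim {:A}).
Local Notation t a := (tens iota a (1 : M^o)).
Local Notation T := (@ext_tr F M iota A sigma).

Lemma ext_tr_nondeg (x : B) : (forall y, T (x * y) = 0) -> x = 0.
Proof.
move=> xT; have [f ef] := dual_basis char0 A_csa sI.
apply/ffunP => j; rewrite ffunE -[RHS](xT (t (f j))) {2}[x]tens_coord mulr_suml.
rewrite (semilin_sum T (@mul1r M) (@ext_trL F M iota A sigma)) (bigD1 j) //= big1 => [|i ij].
  by rewrite tensM (ext_tr_tens iota sI) ef eqxx rmorph1 !mulr1 addr0.
by rewrite tensM (ext_tr_tens iota sI) ef (negPf ij) rmorph0 mulr0.
Qed.

Lemma ext_casimir : exists (n : nat) (p q : 'I_n -> B),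
  forall x : B, \sum_i p i * x * q i = (T x : M) *: (1 : B).
Proof.
have [n [p [q pq]]] := casimir char0 A_csa sI.
exists n, (fun i => t (p i)), (fun i => t (q i)).
apply: tens_ext1 => [c x y|c x y|a].
- rewrite scaler_sumr -big_split; apply: eq_bigr => i _ /=.
  by rewrite mulrDr mulrDl -scalerAr -scalerAl.
- by rewrite ext_trL scalerDl scalerA.
rewrite (ext_tr_tens iota sI) mul1r -tens1 -tensZr -tensZl -pq tens_suml.
by apply: eq_bigr => i _; rewrite !tensM !mulr1.
Qed.

(** Comparing two frames of the extended trace form at [Q] gives 0 = sgn(phi)^2 sgn(T e), so phi has
    signature 0 and a sign-reversing bijection of its entries exists. *)
Lemma ext_emb_prod_over (P : set F) (Q : set M) (J : finType) (fv : J -> A)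
    (s : A) (mu : {poly F}) (al : M) :
  is_ordering P -> is_ordering Q -> (forall x, P x -> Q (iota x)) ->
  frame (trform sigma) fv -> \sum_j sgP P (trform sigma (fv j) (fv j)) = 0 ->
  sigma s = s -> mu \is monic -> separable_poly mu ->
  (forall p, (horner_alg s p == 0) = (mu %| p)) ->
  (forall y, s * y = y * s -> exists p, y = horner_alg s p) ->
  (map_poly iota mu).[al] = 0 ->
  exists (I : finType) (l : I -> M), (forall k, l k != 0 /\ Q (l k)) /\
    emb (@ext_inv F M iota A sigma) (fun S : {set I} => (prod_over l S)%:A)
        (fun S => (- prod_over l S)%:A).
Proof.
move=> P_ord Q_ord PQ fvF bal ss muM mu_sep muE comm mu_al.
have [e [e0 ee sge e1]] := rank1_idempotent sI ss muM mu_sep muE comm mu_al.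
have sL := @ext_invL F M iota A sigma.
have sM := @ext_invM F M iota A sigma sI; have sK := @ext_invK F M iota A sigma sI.
have TL := @ext_trL F M iota A sigma; have TC := @ext_trC F M iota A sigma sI.
have [n [p [q pq]]] := ext_casimir.
have span (x : B) : exists c : 'I_N -> M, x = \sum_i c i *: t (vbasis {:A})`_i.
  by exists x; rewrite [LHS]tens_coord; apply: eq_bigr => i _; exact: tensE.
have M2 : 2%:R != 0 :> M by rewrite -(rmorph_nat iota) fmorph_eq0.
have [I [v [phi [phi0 vv ve v1]]]] :=
  rank1_matrix_units sL sM sK ext_tr_nondeg span pq e0 ee sge e1 M2.
have T1 : T 1 != 0 by rewrite (ext_tr1 iota sI) fmorph_eq0 tra1_neq0.
have [fE fEE] := matrix_unit_frame sM sK TL TC e1 phi0 vv ve v1 T1.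
have Te : T e != 0.
  by move: T1; rewrite (trace_one_rank1 TL TC phi0 vv v1) mulf_eq0 negb_or => /andP[].
have phiB : \sum_i sgP Q (phi i) = 0.
  have := frame_sgP (@ext_trform_sym F M iota A sigma sI) Q_ord (ext_frame iota sI fvF) fE.
  rewrite (eq_bigr _ (fun ij _ => congr1 (sgP Q) (fEE ij))).
  rewrite (eq_bigr (fun j => sgP P (trform sigma (fv j) (fv j)))) => [|j _]; last first.
    by rewrite (ext_trform_tens iota sI) (sgP_map P_ord Q_ord PQ).
  rewrite bal (eq_bigr (fun ij => sgP Q (phi ij.1) * sgP Q (phi ij.2) * sgP Q (T e)));
    last by move=> ij _; rewrite !(sgPM Q_ord).
  rewrite -mulr_suml -(pair_bigA _ (fun i j => sgP Q (phi i) * sgP Q (phi j))) /=.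
  rewrite (eq_bigr (fun i => sgP Q (phi i) * \sum_j sgP Q (phi j))) => [|i _]; last first.
    by rewrite mulr_sumr.
  rewrite -mulr_suml => /esym/eqP; rewrite mulf_eq0 mulf_eq0 orbb.
  case/orP => /eqP // sT; have := sgP_sqr Q_ord Te.
  by rewrite sT mulr0.
pose s1 i := sgP Q (phi i).
have s1E i : s1 i = 1 \/ s1 i = -1.
  by rewrite /s1; have [Qp|Qp] := ordering_total Q_ord (phi i);
    [left; rewrite sgP_pos|right; rewrite sgP_neg].
have [tau tau_bij tauE] := sign_reversing_bijection s1E phiB.
(* [eps i] is the sign of [phi i] at [Q] and [l i] the inverse of its absolute value, hence
   positive. *)
pose eps i : M := (s1 i)%:~R; pose l i := eps i / phi i.
have eps2 i : eps i * eps i = 1.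
  by rewrite /eps; case: (s1E i) => ->; rewrite ?rmorphN1 ?mulrNN ?mulr1.
have eps0 i : eps i != 0.
  by apply: contraTneq isT => i0; have /eqP := eps2 i; rewrite i0 mul0r eq_sym oner_eq0.
have l0 i : l i != 0 by rewrite mulf_neq0 ?invr_eq0.
have el i : eps i * l i = (phi i)^-1 by rewrite /l mulrA eps2 mul1r.
exists I, l; split=> [k|].
  split=> //; have lE : l k = eps k * phi k * (phi k)^-1 ^+ 2.
    by rewrite /l; field; apply: phi0.
  rewrite lE; apply: (ordering_mul Q_ord); last exact: ordering_sqr.
  rewrite /eps /s1; have [Qp|Qp] := ordering_total Q_ord (phi k).
    by rewrite sgP_pos // mul1r.
  by rewrite sgP_neg // mulrN1z mulN1r.
have vv' i j : ext_inv sigma (v i) * v j = ((eps i * l i)^-1 *: e) *+ (i == j).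
  by rewrite el invrK vv.
have v1' : \sum_i (eps i * l i) *: (v i * ext_inv sigma (v i)) = 1.
  by rewrite -[RHS]v1; apply: eq_bigr => i _; rewrite el.
have eps_tau k : eps (tau k) = - eps k by rewrite /eps -/(s1 _) tauE rmorphN.
exact: (emb_prod_over sL sM sK l0 eps2 vv' ve v1' tau_bij eps_tau).
Qed.

End ExtendedEmb.

(** * Transfer of hermitian forms along an F-linear functional on M *)

Section Transfer.
Variables (F M : fieldType) (iota : {rmorphism F -> M}) (lam : M -> F).
Hypothesis lamL : forall a x y, lam (iota a * x + y) = a * lam x + lam y.

Lemma transfer0 : lam 0 = 0.
Proof.
have := lamL 1 0 0; rewrite mulr0 addr0 mul1r => /eqP.
by rewrite -subr_eq0 opprD addNKr oppr_eq0 => /eqP.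
Qed.

Lemma transferD : {morph lam : x y / x + y}.
Proof. by move=> x y; rewrite -[x]mul1r -(rmorph1 iota) lamL rmorph1 !mul1r. Qed.

Lemma transferZ a x : lam (iota a * x) = a * lam x.
Proof. by rewrite -[iota a * x]addr0 lamL transfer0 addr0. Qed.

(* [gam] is an orthogonal basis of M over F for the form lam (c x y). *)
Definition transfer_frame (c : M) (K : finType) (gam : K -> M) (d : K -> F) :=
  [/\ forall k, d k != 0,
      forall k k', lam (c * gam k * gam k') = d k *+ (k == k') &
      forall m, m = \sum_k iota (lam (c * gam k * m) / d k) * gam k].

Lemma transfer_frame_opp c K gam d : @transfer_frame c K gam d ->
  transfer_frame (- c) gam (fun k => - d k).
Proof.
have lamN m : lam (- m) = - lam m.
  by rewrite -mulN1r -(rmorphN1 iota) transferZ mulN1r.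
move=> [d0 dE mE]; split=> [k|k k'|m]; first by rewrite oppr_eq0.
  by rewrite !mulNr lamN dE mulNrn.
by rewrite {1}[m]mE; apply: eq_bigr => k _; rewrite !mulNr lamN invrN mulrNN.
Qed.

Variables (A : falgType F) (sigma : A -> A).
Hypothesis sI : first_kind_involution sigma.
Local Notation B := (tensor iota A M^o).
Local Notation t a := (tens iota a (1 : M^o)).
Local Notation sg := (@ext_inv F M iota A sigma).

(** The identity of A tensored with [lam]; it is right A-linear, so composing it with a hermitian
    form over the extension gives a form over A. *)
Definition ext_transfer (x : B) : A :=
  tens_lift (fun (a : A) (b : M^o) => lam b *: a) x.

Lemma ext_transferD : {morph ext_transfer : x y / x + y}.
Proof. by apply: tens_liftD => a b b'; rewrite transferD scalerDl. Qed.

Lemma ext_transfer_tens a b : ext_transfer (tens iota a b) = lam b *: a.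
Proof.
apply: (tens_liftE (f := fun (a : A) (b : M^o) => lam b *: a)) => [u v w|c u v].
  by rewrite scalerDr.
by rewrite scalerA [LHS]/= transferZ mulrC.
Qed.

Lemma ext_transfer0 : ext_transfer 0 = 0.
Proof. by rewrite -(tens0l iota _ (0 : M^o)) ext_transfer_tens scaler0. Qed.

Lemma ext_transferM x a : ext_transfer (x * t a) = ext_transfer x * a.
Proof.
move: x; apply: (@tens_ext F M iota A M^o) => [x y|x y|a' b].
- by rewrite mulrDl ext_transferD.
- by rewrite ext_transferD mulrDl.
by rewrite tensM mulr1 !ext_transfer_tens scalerAl.
Qed.

Lemma ext_transfer_sum (J : finType) (x : J -> B) :
  ext_transfer (\sum_j x j) = \sum_j ext_transfer (x j).
Proof. exact: (big_morph _ ext_transferD ext_transfer0). Qed.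

Lemma ext_frame_sum (c : M) (K : finType) (gam : K -> M) (d : K -> F) (x : B) :
  transfer_frame c gam d ->
  x = \sum_k tens iota ((d k)^-1 *: ext_transfer ((c * gam k) *: x)) (gam k : M^o).
Proof.
move=> [_ _ mE]; move: x; apply: (@tens_ext F M iota A M^o) => //.
  move=> x y; rewrite -big_split; apply: eq_bigr => k _.
  by rewrite scalerDr ext_transferD scalerDr tensDl.
move=> a b; rewrite {1}(mE b) tens_sumr; apply: eq_bigr => k _.
rewrite -tensZr ext_transfer_tens scalerA tensZl [_^-1 * _]mulrC.
by [].
Qed.

Lemma herm_transfer (J : finType) (c : J -> M) (K : J -> finType)
    (gam : forall j, K j -> M) (d : forall j, K j -> F)
    (x y : {j : J & K j} -> A) :
  (forall j, transfer_frame (c j) (gam j) (d j)) ->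
  herm sigma (fun u => (d (tag u) (tagged u))%:A) x y =
  ext_transfer (herm sg (fun j => (c j)%:A)
    (fun j => \sum_k tens iota (x (@Tagged J j K k)) (gam j k : M^o))
    (fun j => \sum_k tens iota (y (@Tagged J j K k)) (gam j k : M^o))).
Proof.
move=> cF; rewrite /herm ext_transfer_sum.
transitivity (\sum_j \sum_k
    sigma (x (@Tagged J j K k)) * (d j k)%:A * y (@Tagged J j K k)).
  by rewrite sig_big_dep; apply: eq_bigr => -[j k].
apply: eq_bigr => j _; have [_ dE _] := cF j.
rewrite (semilin_sum sg (@scale1r _ _) (@ext_invL F M iota A sigma)) -scalerAr mulr1 scaler_sumr mulr_suml ext_transfer_sum.
apply: eq_bigr => k _.
rewrite mulr_sumr ext_transfer_sum (bigD1 k) //= big1 => [|k' k'k].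
  rewrite addr0 (ext_inv_tens iota sI) -tensZr tensM ext_transfer_tens.
  by rewrite dE eqxx mulr1n -scalerAr mulr1 -scalerAl.
rewrite (ext_inv_tens iota sI) -tensZr tensM ext_transfer_tens.
by rewrite dE eq_sym (negPf k'k) scale0r.
Qed.

(** The embedding itself is unchanged: [X] assembles vectors over M from their coordinates over A,
    and [Z] reads the coordinates of the image. *)
Lemma emb_transfer (J J' : finType) (c : J -> M) (c' : J' -> M)
    (K : J -> finType) (gam : forall j, K j -> M) (d : forall j, K j -> F)
    (K' : J' -> finType) (gam' : forall j, K' j -> M) (d' : forall j, K' j -> F) :
  (forall j, transfer_frame (c j) (gam j) (d j)) ->
  (forall j, transfer_frame (c' j) (gam' j) (d' j)) ->
  emb sg (fun j => (c j)%:A) (fun j => (c' j)%:A) ->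
  emb sigma (fun u : {j : J & K j} => (d (tag u) (tagged u))%:A)
            (fun u : {j : J' & K' j} => (d' (tag u) (tagged u))%:A).
Proof.
move=> cF c'F [f [fD fZ fh]].
pose X (x : {j : J & K j} -> A) j : B :=
  \sum_k tens iota (x (@Tagged J j K k)) (gam j k : M^o).
pose Z (y : J' -> B) (u : {j : J' & K' j}) : A :=
  (d' (tag u) (tagged u))^-1 *:
     ext_transfer ((c' (tag u) * gam' (tag u) (tagged u)) *: y (tag u)).
have ZE y : (fun j => \sum_k tens iota (Z y (@Tagged J' j K' k)) (gam' j k : M^o)) = y.
  by apply: funext => j; rewrite [RHS](ext_frame_sum (y j) (c'F j)).
exists (fun x => Z (f (X x))); split=> [x y|x a|x y].
- have -> : X (fun i => x i + y i) = (fun j => X x j + X y j).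
    by apply: funext => j; rewrite -big_split; apply: eq_bigr => k _; rewrite tensDl.
  by rewrite fD; apply: funext => u; rewrite /Z scalerDr ext_transferD scalerDr.
- have -> : X (fun i => x i * a) = (fun j => X x j * t a).
    apply: funext => j; rewrite mulr_suml; apply: eq_bigr => k _.
    by rewrite tensM mulr1.
  by rewrite fZ; apply: funext => u; rewrite /Z scalerAl ext_transferM scalerAl.
by rewrite (herm_transfer _ _ c'F) !ZE fh (herm_transfer _ _ cF).
Qed.

End Transfer.

Lemma sum_unit (V : nmodType) (f : unit -> V) : \sum_i f i = f tt.
Proof. by rewrite (bigD1 tt) //= big1 ?addr0 // => -[]. Qed.

(** * Witt relations for forms with commuting symmetric coefficients *)

Section CommutingForms.
Variables (A : nzRingType) (sigma : A -> A).
Hypothesis sigmaD : {morph sigma : x y / x + y}.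
Hypothesis sigmaM : forall x y, sigma (x * y) = sigma y * sigma x.
Variables (R : comNzRingType) (r : {rmorphism R -> A}).
Hypothesis r_sym : forall p, sigma (r p) = r p.

Local Notation w p := (wt sigma (r p)).

(** Equality of classes needs embeddings in both directions, so the inverse matrix [u'] is supplied
    with [u]; both have entries in the commutative ring [R]. *)
Lemma wt_matrix (I J : finType) (c : I -> R) (d : J -> R) (u : J -> I -> R)
    (u' : I -> J -> R) :
  (forall i i', r (\sum_j u j i * d j * u j i') = r (c i) *+ (i == i')) ->
  (forall j j', r (\sum_i u' i j * c i * u' i j') = r (d j) *+ (j == j')) ->
  \sum_i w (c i) = \sum_j w (d j).
Proof.
have mx (I' J' : finType) (c' : I' -> R) (d' : J' -> R) (v : J' -> I' -> R) :
    (forall i i', r (\sum_j v j i * d' j * v j i') = r (c' i) *+ (i == i')) ->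
    emb sigma (r \o c') (r \o d').
  move=> vE; apply: (emb_matrix sigmaD sigmaM (u := fun j i => r (v j i))) => i i'.
  rewrite -vE rmorph_sum; apply: eq_bigr => j _.
  by rewrite /= r_sym !rmorphM.
move=> uE u'E; have := wt_emb (embl_codom (mx _ _ _ _ _ uE)) (embl_codom (mx _ _ _ _ _ u'E)).
by rewrite !big_image.
Qed.

Lemma wtX p x y : r (x * y) = 1 -> w (p * x ^+ 2) = w p.
Proof.
move=> xy; have := @wt_matrix unit unit (fun=> p * x ^+ 2) (fun=> p)
  (fun _ _ => x) (fun _ _ => y).
rewrite !sum_unit; apply=> -[] []; rewrite eqxx mulr1n.
  by congr (r _); ring.
rewrite [X in r X = _](_ : _ = p * (x * y) ^+ 2); last by ring.
by rewrite rmorphM rmorphXn /= xy expr1n mulr1.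
Qed.

(** The matrix with rows (1, b) and (1, -a) carries <a + b, ab(a + b)> to <a, b>; its inverse has
    rows z(a, b) and z(1, -1), where z inverts a + b. *)
Lemma wtD c a b z : r ((a + b) * z) = 1 ->
  w (c * a) + w (c * b) = w (c * (a + b)) + w (c * (a * b * (a + b))).
Proof.
move=> abz; have := @wt_matrix bool bool
  (fun i => if i then c * (a + b) else c * (a * b * (a + b)))
  (fun j => if j then c * a else c * b)
  (fun j i => if i then 1 else if j then b else - a)
  (fun i j => if i then z * (if j then a else b) else if j then z else - z).
rewrite !big_bool /= => h; rewrite h //; case; case; rewrite big_bool /= ?mulr1n ?mulr0n.
- by congr (r _); ring.
- by rewrite -(rmorph0 r); congr (r _); ring.
- by rewrite -(rmorph0 r); congr (r _); ring.
- by congr (r _); ring.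
- rewrite [X in r X = _](_ : _ = c * a * ((a + b) * z) ^+ 2); last by ring.
  by rewrite rmorphM rmorphXn /= abz expr1n mulr1.
- by rewrite -(rmorph0 r); congr (r _); ring.
- by rewrite -(rmorph0 r); congr (r _); ring.
rewrite [X in r X = _](_ : _ = c * b * ((a + b) * z) ^+ 2); last by ring.
by rewrite rmorphM rmorphXn /= abz expr1n mulr1.
Qed.

Lemma wt_split u1 u2 p : r (u1 + u2) = 1 -> r (u1 * u2) = 0 ->
  w p = w (u1 * p) + w (u2 * p).
Proof.
move=> u1D u1M; have := @wt_matrix unit bool (fun=> p)
  (fun j => if j then u1 * p else u2 * p) (fun _ _ => 1)
  (fun _ j => if j then u1 else u2).
rewrite sum_unit !big_bool /=; apply=> [[] []|j j'].
  rewrite mulr1n (_ : _ + _ = p * (u1 + u2)); last by ring.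
  by rewrite rmorphM u1D mulr1.
rewrite sum_unit; case: j; case: j'; rewrite ?mulr1n ?mulr0n.
- rewrite [X in r X = _](_ : _ = u1 * p * (u1 + u2) - p * (u1 * u2)); last by ring.
  by rewrite rmorphB [r (_ * (u1 + u2))]rmorphM u1D mulr1 [r (p * _)]rmorphM u1M mulr0 subr0.
- rewrite [X in r X = _](_ : _ = p * (u1 * u2)); last by ring.
  by rewrite rmorphM u1M mulr0.
- rewrite [X in r X = _](_ : _ = p * (u1 * u2)); last by ring.
  by rewrite rmorphM u1M mulr0.
rewrite [X in r X = _](_ : _ = u2 * p * (u1 + u2) - p * (u1 * u2)); last by ring.
by rewrite rmorphB [r (_ * (u1 + u2))]rmorphM u1D mulr1 [r (p * _)]rmorphM u1M mulr0 subr0.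
Qed.

End CommutingForms.

(** * The trace functional of F[X]/(g), and the conclusion *)

Lemma ptr_transfer (F M : fieldType) (iota : {rmorphism F -> M}) (g : {poly F}) (al : M) :
  (forall n, n.+1%:R != 0 :> F) -> g \is monic ->
  (forall p, ((map_poly iota p).[al] == 0) = (g %| p)) ->
  (forall m, exists p, m = (map_poly iota p).[al]) ->
  exists lam : M -> F, [/\ forall a x y, lam (iota a * x + y) = a * lam x + lam y,
    forall p, lam (map_poly iota p).[al] = ptr g p &
    forall m, (forall m', lam (m * m') = 0) -> m = 0].
Proof.
move=> char0 gM gE lift.
pose L m := sval (cid (lift m)); pose lam m := ptr g (L m).
have LE m : (map_poly iota (L m)).[al] = m by rewrite /L; case: cid.
have lamE p : lam (map_poly iota p).[al] = ptr g p.
  apply: ptr_mod; rewrite -gE rmorphB hornerD hornerN LE.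
  by rewrite /= subrr.
(* The trace of 1 is the degree of [g], nonzero in characteristic 0; nondegeneracy follows on
   pairing a nonzero element with its inverse. *)
have lam1 : lam 1 != 0.
  have -> : 1 = (map_poly iota 1).[al] by rewrite rmorph1 hornerC.
  have [g' sg] : exists n, size g = n.+2.
    case sg: (size g) => [|[|n]]; last by exists n.
      by have /eqP := monic_neq0 gM; case; apply/eqP; rewrite -size_poly_eq0 sg.
    have g1 : g %= 1 by rewrite -size_poly_eq1 sg.
    by have := gE 1; rewrite (eqp_dvdl _ g1) dvdpp rmorph1 hornerC oner_eq0.
  rewrite lamE /ptr mul1r /res modp_small.
    rewrite coef_deriv sg /= -[g'.+1]/(g'.+2.-1) -sg -lead_coefE (monicP gM).
    by rewrite sg; apply: char0.
  exact: lt_size_deriv (monic_neq0 gM).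
exists lam; split=> // [a x y|m mE].
  have [p xE] := lift x; have [q yE] := lift y.
  have -> : iota a * x + y = (map_poly iota (a *: p + q)).[al].
    by rewrite rmorphD /= map_polyZ hornerD hornerZ -xE -yE.
  by rewrite lamE xE yE !lamE ptrD ptrZ.
apply/eqP; apply: contraNT lam1 => m0.
by rewrite -(divff m0) mE.
Qed.

(** Evaluation at [al] moves a frame from polynomials to M; since lam(c x y) is nondegenerate on M,
    Parseval's identity becomes an actual expansion of elements. *)
Lemma tform_transfer_frame (F M : fieldType) (iota : {rmorphism F -> M}) (P : set F)
    (g u : {poly F}) (al : M) (lam : M -> F) :
  is_ordering P -> g != 0 ->
  (forall a x y, lam (iota a * x + y) = a * lam x + lam y) ->
  (forall p, lam (map_poly iota p).[al] = ptr g p) ->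
  (forall m, (forall m', lam (m * m') = 0) -> m = 0) ->
  (forall m, exists p, m = (map_poly iota p).[al]) ->
  (map_poly iota u).[al] != 0 ->
  exists (K : finType) (gam : K -> M) (d : K -> F),
    transfer_frame iota lam (map_poly iota u).[al] gam d /\
    \sum_k sgP P (d k) = sgn P (tform g u).
Proof.
move=> P_ord g0 lamL lamE lam_nd lift u0; set c := (_).[al] in u0 *.
have [tS [K [w wF]]] := tform_framed u (ordering_char0 P_ord 1) g0.
pose ev p := (map_poly iota p).[al].
have tE p q : tform g u p q = lam (c * ev p * ev q).
  by rewrite /tform -lamE !rmorphM !hornerM.
pose gam k := ev (w k); pose d k := tform g u (w k) (w k).
exists K, gam, d; split; last by rewrite (sgn_frame P_ord tS wF).
have [[wo w0] wE] := wF; split=> [k|k k'|m]; first exact: w0.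
  rewrite -tE; case: eqVneq => [<-|kk']; first by rewrite mulr1n.
  by rewrite wo.
apply/eqP; rewrite -subr_eq0; apply/eqP.
have lam0 := transfer0 lamL; have lamD := transferD lamL.
have lamZ := transferZ lamL.
apply: (mulfI u0); rewrite mulr0; apply: lam_nd => m'.
have [p mE] := lift m; have [q m'E] := lift m'; rewrite mE m'E -/(ev p) -/(ev q).
have lamN x : lam (- x) = - lam x.
  by rewrite -mulN1r -(rmorphN1 iota) lamZ mulN1r.
rewrite mulrBr mulrBl lamD lamN -tE wE mulr_sumr mulr_suml (big_morph lam lamD lam0).
apply/eqP; rewrite subr_eq0; apply/eqP; apply: eq_bigr => k _.
have -> : c * (iota (lam (c * gam k * ev p) / d k) * gam k) * ev q =
    iota (lam (c * gam k * ev p) / d k) * (c * gam k * ev q) by ring.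
by rewrite lamZ -!tE [tform g u p _]tS mulrAC.
Qed.

Lemma poly_witt_horner (F : fieldType) (A : falgType F) (sigma : A -> A) (s : A)
    (mu : {poly F}) :
  first_kind_involution sigma -> sigma s = s ->
  (forall p, (horner_alg s p == 0) = (mu %| p)) ->
  poly_witt mu (fun p => wt sigma (horner_alg s p)).
Proof.
move=> sI ss muE.
have sL := involution_linear sI.
have sD := semilinD sigma (@scale1r _ _) sL.
have sP p : sigma (horner_alg s p) = horner_alg s p.
  rewrite (poly_sumXn (leqnn (size p))) horner_alg_poly.
  rewrite (semilin_sum sigma (@scale1r _ _) sL); apply: eq_bigr => i _.
  by rewrite (semilinZ sigma (@scale1r _ _) sL) (involutionX sI).
have mod_eq p q : mu %| p - q -> horner_alg s p = horner_alg s q.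
  by rewrite -muE rmorphB subr_eq0 => /eqP.
have inv x : coprimep x mu -> exists y, horner_alg s (x * y) = 1.
  move=> /Bezout_eq1_coprimepP[[y v] /= yv]; exists y.
  rewrite -[RHS](rmorph1 (horner_alg s)); apply: mod_eq.
  have -> : x * y - 1 = - v * mu by rewrite -yv; ring.
  exact: dvdp_mull.
have sM := involution_mul sI.
split=> [p q /mod_eq-> //|p|p x /inv[y xy]|c a b /inv[z abz]|u1 u2 p u1D u1M].
- by rewrite rmorphN wtN.
- exact: (wtX sD sM sP p xy).
- exact: (wtD sD sM sP c abz).
apply: (wt_split sD sM sP); first by rewrite -(rmorph1 (horner_alg s)); apply: mod_eq.
by apply/eqP; rewrite muE.
Qed.

(** The slots are the absolute values of the d_i at [P]. Each is absorbed by the Pfister form, which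
    turns the relation into the signature times the class of the form; as [G] has no torsion, that
    class is 0. *)
Lemma torsl_of_sum (F : fieldType) (G : zmodType) (w : F -> G) (P : set F)
    (I : finType) (d : I -> F) :
  (forall (x : G) k, x *+ k.+1 = 0 -> x = 0) -> (forall a, w (- a) = - w a) ->
  (forall a x, x != 0 -> w (a * x ^+ 2) = w a) -> is_ordering P ->
  (forall i, d i != 0) -> 0 < \sum_i sgP P (d i) ->
  (forall b, \sum_i w (b * d i) = 0) ->
  exists2 l, {in l, forall a, P a} & torsl w l.
Proof.
move=> G_tf wN wX P_ord d0 sd_gt0 wd.
have wfd l b : \sum_i wpf w (b * d i) l = 0.
  elim: l b => [|a l IHl] b /=; first exact: wd.
  rewrite big_split /= IHl add0r -[RHS](IHl (b * a)).
  by apply: eq_bigr => i _; rewrite mulrAC.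
pose a i := (sgP P (d i))%:~R * d i.
have aP i : [/\ P (a i), a i != 0 & forall b l, wpf w (b * d i) l = wpf w (b * a i) l *~ sgP P (d i)].
  rewrite /a; have [Pd|Pd] := ordering_total P_ord (d i).
    by rewrite sgP_pos // mul1r; split.
  rewrite sgP_neg // mulrN1z mulN1r; split=> [||b l]; rewrite ?oppr_eq0 //.
  by rewrite mulrN wpfN // mulrN1z opprK.
exists (codom a) => [x /codomP[i ->]|b]; first by case: (aP i).
have := wfd (codom a) b.
rewrite (eq_bigr (fun i => wpf w b (codom a) *~ sgP P (d i))) => [|i _]; last first.
  by have [_ ai0 ->] := aP i; rewrite wpf_absorb // codom_f.
rewrite -mulrz_sumr; move: sd_gt0; case: (\sum_i _) => [[//|n]|//] _.
exact: G_tf.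
Qed.

Theorem theorem1p2 (F K : fieldType) (iota : {rmorphism F -> K})
    (A : falgType F) (sigma : A -> A)
    (F_real : formally_real F) (K_totpos : totally_positive iota)
    (A_csa : central_simple A) (sigma_orth : orthogonal_involution sigma) :
  weakly_hyperbolic
    (tensor_map iota sigma idfun : tensor iota A K^o -> tensor iota A K^o) ->
  weakly_hyperbolic sigma.
Proof.
move=> whK; apply: contrapT => nwh.
have [sI _] := sigma_orth; have sL := involution_linear sI.
have sM := involution_mul sI.
have sD := semilinD sigma (@scale1r _ _) sL.
have char0 n : n.+1%:R != 0 :> F.
  apply/eqP => n0; apply: F_real; exists (nseq n 1).
  rewrite big_nseq expr1n iter_addr_0; apply/eqP.
  by rewrite eq_sym -addr_eq0 -n0 -[n.+1]addn1 natrD.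
have n1 : ~ neutral sigma [:: 1] by move=> /(neutral1_weakly_hyperbolic sI char0).
have s_alg a : sigma (in_alg A a) = in_alg A a.
  by rewrite /= (semilinZ sigma (@scale1r _ _) sL) (first_kind1 sI).
pose w (a : F) := wt sigma a%:A.
have G_tf (x : witt sigma) k : x *+ k.+1 = 0 -> x = 0 := @witt_torsion_free _ _ x k.
have wN a : w (- a) = - w a by rewrite /w scaleNr wtN.
have inv_alg x : x != 0 -> in_alg A (x * x^-1) = 1.
  by move=> x0; rewrite divff // rmorph1.
have wX a x : x != 0 -> w (a * x ^+ 2) = w a.
  by move=> /inv_alg; apply: (wtX sD sM s_alg a).
have wD a b : a + b != 0 -> w a + w b = w (a + b) + w (a * b * (a + b)).
  by move=> /inv_alg /(wtD sD sM s_alg 1); rewrite !mul1r.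
(* From the empty set only the empty list arises, and its consistency is the fact that <1> is not
   torsion. *)
have [|P [P_ord _ Pc]] := @consistent_ordering _ F w G_tf wN wX wD set0.
  case=> [|a l]; last by move=> /(_ a (mem_head _ _)).
  move=> _ /(_ 1) /=; rewrite /w scale1r => w1; apply: n1; apply/sum_wt_eq0.
  by rewrite big_seq1.
have [J [fv fvF]] := trform_frame sI (char0 1).
have bal : \sum_j sgP P (trform sigma (fv j) (fv j)) = 0.
  have [[_ fv0] _] := fvF.
  by rewrite sgP_count // (trform_balanced sI P_ord K_totpos whK fvF) subrr.
have [s [mu [ss muM mu_sep muE comm]]] := generic_symmetric char0 sigma_orth.
have wW := poly_witt_horner sI ss muE.
(* [w'] extends [w] from F to the commutative ring of polynomials in [s], whose elements are
   symmetric; consistency with [P] carries over because it concerns constant slots. *)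
pose w' (p : {poly F}) := wt sigma (horner_alg s p).
have wpfC b l : wpf w' b%:P (map polyC l) = wpf w b l.
  elim: l b => [|a l IHl] b /=; first by rewrite /w' horner_algC.
  by rewrite -polyCM !IHl.
have Pc' l : {in l, forall a, P a} -> ~ torsl w' (map polyC l).
  by move=> lP tl; apply: (Pc l lP) => b; rewrite -wpfC tl.
have [g [M [io [al [Q [Q_ord PQ gE lift [gM g_mu]]]]]]] :=
  real_factor G_tf mu_sep wW Pc'.
have g_sep : separable_poly g := dvdp_separable g_mu mu_sep.
have mu_al : (map_poly io mu).[al] = 0 by apply/eqP; rewrite gE.
have g_al : (map_poly io g).[al] = 0 by apply/eqP; rewrite gE.
have [I [l [lQ lE]]] := ext_emb_prod_over char0 A_csa sI P_ord Q_ord PQ fvF bal ss muM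
  mu_sep muE comm mu_al.
pose L k := sval (cid (lift (l k))).
have LE k : l k = (map_poly io (L k)).[al] by rewrite /L; case: cid.
pose u (S : {set I}) := \prod_(k in S) L k.
have uE S : (map_poly io (u S)).[al] = prod_over l S.
  by rewrite rmorph_prod horner_prod; apply: eq_bigr => k _; rewrite LE.
have c0 S : prod_over l S != 0 by apply/prodf_neq0 => k _; case: (lQ k).
have [lam [lamL lamE lam_nd]] := ptr_transfer char0 gM gE lift.
have frS S : exists (K : finType) (gam : K -> M) (d : K -> F),
    transfer_frame io lam (prod_over l S) gam d /\
    \sum_k sgP P (d k) = sgn P (tform g (u S)).
  have := tform_transfer_frame P_ord (monic_neq0 gM) lamL lamE lam_nd lift (u := u S).
  by rewrite uE; apply.
pose KS S := sval (cid (frS S)); pose gS S := sval (cid (svalP (cid (frS S)))).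
pose dS S := sval (cid (svalP (cid (svalP (cid (frS S)))))).
have dSP S : transfer_frame io lam (prod_over l S) (gS S) (dS S) /\
    \sum_k sgP P (dS S k) = sgn P (tform g (u S)).
  exact: (svalP (cid (svalP (cid (svalP (cid (frS S))))))).
have dSN S := transfer_frame_opp lamL (dSP S).1.
have embA := emb_transfer lamL sI (fun S => (dSP S).1) dSN lE.
pose d (x : {S : {set I} & KS S}) := dS (tag x) (tagged x).
have dneutral : neutral sigma (codom (fun x => (d x)%:A)).
  exists 0%N, [::]; rewrite /mulc /= !cats0.
  have -> : map -%R (codom (fun x => (d x)%:A)) = codom (fun x => (- d x)%:A : A).
    by rewrite /codom /image_mem -map_comp; apply: eq_map => x /=; rewrite scaleNr.
  exact: embl_codom embA.
have [||b|l' l'P /(Pc l')] := torsl_of_sum G_tf wN wX P_ord (d := d); last by apply.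
- by move=> [S k]; have [[d0 _ _] _] := dSP S; apply: d0.
- have -> : \sum_x sgP P (d x) = \sum_S sgn P (tform g (u S)).
    transitivity (\sum_S \sum_k sgP P (dS S k)).
      by rewrite sig_big_dep; apply: eq_bigr => -[S k].
    by apply: eq_bigr => S _; have [_ ->] := dSP S.
  have [h [hM h_sep _ hE]] := tform_root_split P_ord Q_ord PQ gM g_sep g_al.
  (* Products of the slots are positive at [Q], so the root [al] contributes 1 for every subset of
     [I], a positive total. *)
  rewrite (eq_bigr (fun S : {set I} => 1 + sgn Q (tform h (\prod_(k in S) map_poly io (L k)))))
    => [|S _]; last first.
    rewrite hE uE rmorph_prod sgP_pos //.
    apply: (big_ind Q) => [||k _]; [exact: ordering1|exact: ordering_mul|by case: (lQ k)].
  rewrite big_split /= sumr_const; apply: ltr_wpDr.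
    exact: sum_sgn_tform_ge0.
  by rewrite ltr0n; apply/card_gt0P; exists finset.set0.
have bc (x : A) : b%:A * x = x * b%:A by rewrite mulr_algl mulr_algr.
have := sum_wt_scale bc ((sum_wt_eq0 _ _).2 dneutral); rewrite big_image => h.
rewrite -[RHS]h; apply: eq_bigr => x _.
by rewrite /w mulr_algl scalerA.
Qed.
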